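(* Let $K$ be $\mathbb R$, $\mathbb C$ or a finite extension of $\mathbb Q_p$, let $U\subset K^n$ be open and let $f,g:U\to K$ be non-zero $K$-analytic functions such that $f/g$ is not constant. (1) Assume that there exists a point $x_0\in U$ such that $f(x_0)=0$ and $g(x_0)\neq0$. Then, for any positive test function $\Phi$ with support in a small enough neighborhood of $x_0$, the zeta function $Z_\Phi(s;f/g)$ has a negative pole. (2) Assume that there exists a point $x_0\in U$ such that $f(x_0)\ne0$ and $g(x_0)=0$. Then, for any positive test function $\Phi$ with support in a small enough neighborhood of $x_0$, the zeta function $Z_\Phi(s;f/g)$ has a positive pole. (3) In particular, if $K=\mathbb C$ and $f$ and $g$ are polynomials, then $Z_\Phi(s;f/g)$ always has a pole for an appropriate positive test function $\Phi$.
   Context: $|\cdot|_K$ is the modulus on $K$: the usual absolute value if $K=\mathbb R$, its square if $K=\mathbb C$, the normalized absolute value if $K$ is a finite extension of $\mathbb Q_p$. A test function is a $\mathbb C$-valued function with compact support contained in $U$, smooth if $K=\mathbb R,\mathbb C$ and locally constant if $K$ is a finite extension of $\mathbb Q_p$; it is called positive if it is non-zero and takes only real non-negative values. With $D_K=f^{-1}\{0\}\cup g^{-1}\{0\}$, $$Z_\Phi(s;f/g)=\int_{U\smallsetminus D_K}\Phi(x)\left|\frac{f(x)}{g(x)}\right|_K^s|dx|_K,$$ where $|dx|_K$ is the normalized Haar measure on $K^n$. It converges for $s$ in some vertical strip $\beta<\operatorname{Re}(s)<\alpha$ with $-\infty\le\beta<0<\alpha\le+\infty$ and has a meromorphic continuation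 to $\mathbb C$, denoted by the same symbol; poles refer to this continuation. A negative (positive) pole is a pole at a negative (positive) real number $s$.
   Formalization: In (1) and (2) Φ is also required to be non-zero at x_0 (else Φ could avoid the zero set); ''non-zero'' f, g means not identically zero on any non-empty open subset of U; in (3) U is all of C^n. *)

(* Defs.v *)
From HB Require Import structures.
From mathcomp Require Import all_boot all_order all_algebra all_field.
From mathcomp Require Import finmap complex.
From mathcomp Require Import all_classical all_reals all_analysis.
From mathcomp.multinomials Require mpoly.
Import (canonicals, coercions) mpoly.

Set Implicit Arguments.
Unset Strict Implicit.
Unset Printing Implicit Defensive.

Import Order.TTheory GRing.Theory Num.Theory.
Import numFieldNormedType.Exports.

Local Open Scope classical_set_scope.
Local Open Scope complex_scope.
Local Open Scope ring_scope.

(* The p-adic numbers, up to isometric isomorphism: the completion of the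
   rationals for the p-adic absolute value. An ultrametric absolute value with
   |p| = 1/p restricts to the p-adic one on the rationals. *)
Record padic_numbers (R : realType) (p : nat) := PadicNumbers {
  padic_field :> fieldType ;
  padic_abs : padic_field -> R ;
  padic_prime : prime p ;
  padic_abs_ge0 : forall x, 0 <= padic_abs x ;
  padic_abs_eq0 : forall x, padic_abs x = 0 <-> x = 0 ;
  padic_absM : forall x y, padic_abs (x * y) = padic_abs x * padic_abs y ;
  padic_absD : forall x y,
    padic_abs (x + y) <= Num.max (padic_abs x) (padic_abs y) ;
  padic_abs_p : padic_abs p%:R = p%:R^-1 ;
  padic_dense : forall (x : padic_field) (e : R), 0 < e ->
    exists q : rat, padic_abs (x - ratr q) < e ;
  padic_complete : forall u : nat -> padic_field,
    (forall e : R, 0 < e -> exists N, forall i j,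
       (N <= i)%N -> (N <= j)%N -> padic_abs (u i - u j) < e) ->
    exists l, (fun i => padic_abs (u i - l)) @ \oo --> (0 : R)
}.

(* N_{L/F}(x), the determinant of the F-linear map y |-> x * y. *)
Definition field_norm (F : fieldType) (L : fieldExtType F) (x : L) : F :=
  \det (\matrix_(i < \dim {:L}, j < \dim {:L})
          coord (vbasis {:L}) j (x * (vbasis {:L})`_i)).

Inductive local_field (R : realType) : Type :=
| RealField
| ComplexField
| PadicField (p : nat) (Qp : padic_numbers R p) (L : fieldExtType Qp).
Arguments RealField {R}.
Arguments ComplexField {R}.
Arguments PadicField {R p}.

Definition local_field_sort (R : realType) (K : local_field R) : fieldType :=
  match K with
  | RealField => R
  | ComplexField => R[i]
  | PadicField _ _ L => L
  end.
Coercion local_field_sort : local_field >-> GRing.Field.type.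

(* |x|_K. In the p-adic case |N(x)|_p sends a uniformizer of K to 1/q, where q
   is the cardinality of the residue field. *)
Definition modulus (R : realType) (K : local_field R) : K -> R :=
  match K return local_field_sort K -> R with
  | RealField => fun x => `|x|
  | ComplexField => fun z => complex.Re z ^+ 2 + complex.Im z ^+ 2
  | PadicField _ Qp L => fun x => padic_abs (field_norm x)
  end.

(* K^n with the topology defined by the modulus. For the complex numbers the
   modulus is not subadditive, but it still defines the usual topology. *)
Definition affine (R : realType) (K : local_field R) (n : nat) : Type :=
  'rV[K]_n.
HB.instance Definition _ (R : realType) (K : local_field R) (n : nat) :=
  GRing.Zmodule.on (affine K n).
HB.instance Definition _ (R : realType) (K : local_field R) (n : nat) :=
  isPointed.Build (affine K n) 0.

Section Topology.
Context (R : realType) (K : local_field R) (n : nat).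

Definition polydisc (x : affine K n) (e : R) : set (affine K n) :=
  [set y | forall i, modulus (y 0 i - x 0 i) < e].

Definition modulus_open : set (set (affine K n)) :=
  [set A | forall x, A x -> exists2 e : R, 0 < e & polydisc x e `<=` A].

Lemma modulus_openT : modulus_open setT.
Proof. by move=> x _; exists 1. Qed.

Lemma modulus_openI : setI_closed modulus_open.
Proof.
move=> A B oA oB x [Ax Bx].
have [e e0 eA] := oA x Ax; have [d d0 dB] := oB x Bx.
exists (Num.min e d); first by rewrite lt_min e0.
by move=> y xy; split; [apply: eA|apply: dB] => i;
  have := xy i; rewrite lt_min => /andP[].
Qed.

Lemma modulus_open_bigU (I : Type) (A : I -> set (affine K n)) :
  (forall i, modulus_open (A i)) -> modulus_open (\bigcup_i A i).
Proof.
move=> oA x [i _ Aix]; have [e e0 eA] := oA i x Aix.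
by exists e => // y /eA Aiy; exists i.
Qed.

HB.instance Definition _ := isOpenTopological.Build (affine K n)
  modulus_openT modulus_openI modulus_open_bigU.

End Topology.

Definition borel (R : realType) (K : local_field R) (n : nat) :=
  g_sigma_algebraType (@open (affine K n)).

Section Haar.
Context (R : realType) (K : local_field R) (n : nat).

Definition unit_box : set (affine K n) :=
  match K return set (affine K n) with
  | RealField => [set x | forall i, 0 <= (x 0 i : R) <= 1]
  | ComplexField => [set x | forall i,
      0 <= complex.Re (x 0 i) <= 1 /\ 0 <= complex.Im (x 0 i) <= 1]
  | PadicField _ _ _ => [set x | forall i, modulus (x 0 i) <= 1]
  end.

(* Lebesgue measure on R^n and on C^n = R^(2n); the Haar measure giving O_K^n
   mass 1 in the p-adic case. *)
Definition normalized_haar (mu : {measure set (borel K n) -> \bar R}) : Prop :=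
  (forall (A : set (borel K n)) (v : affine K n), measurable A ->
     mu [set x + v | x in (A : set (affine K n))] = mu A) /\
  mu unit_box = 1%E.

End Haar.

Section Analytic.
Context (R : realType) (K : local_field R) (n : nat).

(* unconditional summation of a family in K *)
Definition has_sum (I : choiceType) (u : I -> K) (l : K) : Prop :=
  forall e : R, 0 < e -> exists A : {fset I}, forall B : {fset I},
    fsubset A B -> modulus (\sum_(i <- B) u i - l) < e.

Definition analytic_at (f : affine K n -> K) (x : affine K n) : Prop :=
  exists (a : {ffun 'I_n -> nat} -> K) (e : R), 0 < e /\
    forall y, polydisc x e y ->
      has_sum (fun m : {ffun 'I_n -> nat} =>
                 a m * \prod_i (y 0 i - x 0 i) ^+ m i) (f y).

(* Only the values of f on the open set U matter. *)
Definition analytic_on (U : set (affine K n)) (f : affine K n -> K) : Prop :=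
  forall x, U x -> analytic_at f x.

(* On a connected open subset of R^n or C^n an analytic f satisfies this if and
   only if it is not the zero function. In general it is the condition which
   makes f^-1{0} a null set. *)
Definition nowhere_zero_germ (U : set (affine K n)) (f : affine K n -> K) :
    Prop :=
  forall V : set (affine K n), open V -> V `<=` U -> V !=set0 ->
    exists2 x, V x & f x != 0.

Definition quotient_nonconstant (U : set (affine K n))
    (f g : affine K n -> K) : Prop :=
  ~ exists c : K, forall x, U x -> g x != 0 -> f x / g x = c.

End Analytic.

Section TestFunctions.
Context (R : realType).

(* C^k for the real structure on K^n given by iota : R -> K: continuous, with
   all directional derivatives of class C^(k-1). *)
Fixpoint class_C (K : local_field R) (n : nat) (iota : R -> K) (k : nat)
    (phi : affine K n -> R) {struct k} : Prop :=
  continuous phi /\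
  match k with
  | 0%N => True
  | k'.+1 => forall v : 'rV[K]_n, exists psi : affine K n -> R,
      (forall x : 'rV[K]_n,
         is_derive (0 : R) (1 : R) (fun t : R => phi (x + iota t *: v) : R)
           (psi x)) /\
      class_C iota k' psi
  end.

Definition smooth (K : local_field R) (n : nat) (iota : R -> K)
    (Phi : affine K n -> R[i]) : Prop :=
  forall k, class_C iota k (fun x => complex.Re (Phi x)) /\
            class_C iota k (fun x => complex.Im (Phi x)).

Definition locally_constant (T : topologicalType) (S : Type) (Phi : T -> S) :
    Prop :=
  forall x, \forall y \near x, Phi y = Phi x.

Definition test_regularity (K : local_field R) (n : nat) :
    (affine K n -> R[i]) -> Prop :=
  match K return (affine K n -> R[i]) -> Prop with
  | RealField => @smooth RealField n (fun t => t)
  | ComplexField => @smooth ComplexField n (fun t => t%:C)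
  | PadicField _ Qp L => @locally_constant (affine (PadicField Qp L) n) R[i]
  end.

Definition supp (K : local_field R) (n : nat) (Phi : affine K n -> R[i]) :
    set (affine K n) :=
  closure [set x | Phi x != 0].

Definition test_function (K : local_field R) (n : nat) (U : set (affine K n))
    (Phi : affine K n -> R[i]) : Prop :=
  [/\ test_regularity Phi, compact (supp Phi) & supp Phi `<=` U].

(* In the order of R[i], 0 <= z means that z is real and nonnegative. *)
Definition positive (K : local_field R) (n : nat) (Phi : affine K n -> R[i]) :
    Prop :=
  (exists x, Phi x != 0) /\ forall x, 0 <= Phi x.

End TestFunctions.

Section Meromorphic.
Context (R : realType).

Definition cabs (z : R[i]) : R :=
  Num.sqrt (complex.Re z ^+ 2 + complex.Im z ^+ 2).

Definition holomorphic_at (h : R[i] -> R[i]) (s : R[i]) : Prop :=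
  exists (a : nat -> R[i]) (r : R), 0 < r /\
    forall z, cabs (z - s) < r ->
      (fun N => cabs (\sum_(k < N) a k * (z - s) ^+ k - h z)) @ \oo --> (0 : R).

Definition laurent_at (m : nat) (Z h : R[i] -> R[i]) (s : R[i]) : Prop :=
  holomorphic_at h s /\
  exists2 r : R, 0 < r & forall z, 0 < cabs (z - s) < r ->
    Z z = h z / (z - s) ^+ m.

Definition meromorphic (Z : R[i] -> R[i]) : Prop :=
  forall s, exists m h, laurent_at m Z h s.

Definition pole (Z : R[i] -> R[i]) (s : R[i]) : Prop :=
  exists m h, [/\ (0 < m)%N, laurent_at m Z h s & h s != 0].

End Meromorphic.

Section Zeta.
Context (R : realType).

(* t^s = exp(s ln t), for t > 0 *)
Definition cpow (t : R) (s : R[i]) : R[i] :=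
  (t `^ complex.Re s)%:C *
  (cos (complex.Im s * ln t) +i* sin (complex.Im s * ln t)).

Context (K : local_field R) (n : nat) (mu : {measure set (borel K n) -> \bar R}).

Definition cintegrable (D : set (affine K n)) (h : affine K n -> R[i]) : Prop :=
  mu.-integrable D (fun x => (complex.Re (h x))%:E) /\
  mu.-integrable D (fun x => (complex.Im (h x))%:E).

Definition cintegral (D : set (affine K n)) (h : affine K n -> R[i]) : R[i] :=
  (\int[mu]_(x in D) complex.Re (h x)) +i* (\int[mu]_(x in D) complex.Im (h x)).

Context (U : set (affine K n)) (f g : affine K n -> K).

Definition zeta_domain : set (affine K n) :=
  U `\` [set x | f x = 0 \/ g x = 0].

Definition zeta_integrand (Phi : affine K n -> R[i]) (s : R[i]) :
    affine K n -> R[i] :=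
  fun x => Phi x * cpow (modulus (f x / g x)) s.

Definition zeta_continuation (Phi : affine K n -> R[i]) (Z : R[i] -> R[i]) :
    Prop :=
  meromorphic Z /\
  exists beta alpha : \bar R, [/\ (beta < 0)%E, (0 < alpha)%E &
    forall s : R[i],
      (beta < (complex.Re s)%:E)%E -> ((complex.Re s)%:E < alpha)%E ->
      cintegrable zeta_domain (zeta_integrand Phi s) /\
      Z s = cintegral zeta_domain (zeta_integrand Phi s)].

(* The continuation is unique up to its values at isolated points, so its
   poles are well defined. *)
Definition zeta_pole (Phi : affine K n -> R[i]) (s : R[i]) : Prop :=
  exists2 Z, zeta_continuation Phi Z & pole Z s.

End Zeta.

Definition poly_fun (R : realType) (n : nat) (P : mpoly.mpoly n R[i]) :
    affine (@ComplexField R) n -> @ComplexField R :=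
  fun x => mpoly.meval (fun i => (x : 'rV[R[i]]_n) 0 i) P.

(* Main.v *)
(* Let I(t) be the integral of Phi |f/g|^(-t) over the domain of the zeta
   function. Landau's argument shows that the first real t > 0 at which the
   continuation fails to be regular bounds the convergence of I: if the
   continuation were regular along the whole half-line of real t > 0, then I(t)
   would be finite there. This needs no bound on |f/g|, as the part of the
   integral where |f/g| > 1 converges for all t >= 0 and is analytic in t > 0.
   On the other hand I(t) is infinite for large t as soon as, along some line
   x0 + tau v, |f| is bounded by a multiple of |tau|^k1 and |g| is at least a
   multiple of |tau|^k2 with k2 < k1: a ball of radius comparable to a power of
   |tau| around x0 + tau v has measure at least a power of |tau|, and f and g do
   not vanish there.
   In (1) and (2) such a line exists because a nonzero analytic germ has finite
   order of vanishing along some line. In (3), f/g restricts to a nonconstant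
   rational function on some line, and this has a zero or a pole. *)
Require Import Defs.
From HB Require Import structures.
From mathcomp Require Import all_boot all_order all_algebra all_field.
From mathcomp Require Import finmap complex.
From mathcomp Require Import all_classical all_reals all_analysis.
From mathcomp.multinomials Require mpoly.
From mathcomp Require Import measurable_realfun.
From mathcomp Require Import ring lra zify.
Import (canonicals, coercions) mpoly.
Set Implicit Arguments.
Unset Strict Implicit.
Unset Printing Implicit Defensive.
Import Order.TTheory GRing.Theory Num.Theory.
Import numFieldNormedType.Exports.
Local Open Scope classical_set_scope.
Local Open Scope complex_scope.
Local Open Scope ring_scope.

(** * Landau's lemma for Laplace integrals *)

(** With w = Re Phi and u = e ln |f/g|_K, where e = -1 for negative and e = 1 for positive poles,
    the zeta function at the real point e t is the Laplace integral of w exp(t u), so Landau's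
    argument is carried out over an arbitrary measure space. The obstacle is the abscissa of
    convergence, where the integral is known from the left only. Nonnegative Taylor remainders of
    exp(-y) replace differentiation under the integral sign: their integrals are computed from the
    power series of the continuation, Fatou's lemma makes every moment of u finite at the abscissa,
    and the exponential series, whose terms are nonnegative where u >= 0, then carries the integral
    beyond. The fields are treated together through a root of the modulus that satisfies a triangle
    inequality up to a constant. The measure of a small ball is bounded below by covering the unit
    box with its translates, not by computing volumes. *)

Section RealIntegral.
Context d (T : measurableType d) (R : realType).
Variables (mu : {measure set T -> \bar R}) (D : set T) (mD : measurable D).

Definition rintegrable (f : T -> R) := mu.-integrable D (fun x => (f x)%:E).

Lemma rintegrable_measurable (f : T -> R) : rintegrable f -> measurable_fun D f.
Proof. by move=> /measurable_int /measurable_EFinP. Qed.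

Lemma le_rintegrable (f g : T -> R) : measurable_fun D f ->
  (forall x, D x -> `|f x| <= g x) -> rintegrable g -> rintegrable f.
Proof.
move=> mf fg; apply: le_integrable => //; first exact/measurable_EFinP.
by move=> x Dx; rewrite lee_fin (le_trans (fg x Dx))// ler_norm.
Qed.

Lemma real_dominated_convergence (f_ : nat -> T -> R) (f g : T -> R) :
  (forall n, measurable_fun D (f_ n)) -> measurable_fun D f ->
  rintegrable g ->
  (forall n x, D x -> `|f_ n x| <= g x) ->
  (forall x, D x -> f_ ^~ x @ \oo --> f x) ->
  rintegrable f /\
  (fun n => \int[mu]_(x in D) f_ n x) @ \oo --> \int[mu]_(x in D) f x.
Proof.
move=> mf_ mf ig fg ff.
have [|||||i1 _ i2] := @dominated_convergence _ T R mu D mD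
  (fun n x => (f_ n x)%:E) (fun x => (f x)%:E) (fun x => (g x)%:E).
- by move=> n; exact/measurable_EFinP.
- exact/measurable_EFinP.
- by apply/nearW => x Dx; apply: cvg_EFin; [exact: nearW|exact: ff].
- exact: ig.
- by apply/nearW => x n Dx; rewrite /= lee_fin fg.
split=> //; apply: fine_cvg; rewrite fineK; first exact: i2.
exact: integrable_fin_num.
Qed.

(** Fatou's lemma as a source of integrability: it is what produces convergence at the abscissa and
    beyond it. *)
Lemma real_fatou (f_ : nat -> T -> R) (f : T -> R) (B : R) :
  measurable_fun D f ->
  (forall n, rintegrable (f_ n)) ->
  (forall n x, D x -> 0 <= f_ n x) ->
  (forall x, D x -> f_ ^~ x @ \oo --> f x) ->
  (\forall n \near \oo, \int[mu]_(x in D) f_ n x <= B) ->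
  rintegrable f.
Proof.
move=> mf fi f0 ff fB.
have lim_eq x : D x -> limn_einf (fun n => (f_ n x)%:E) = (f x)%:E.
  move=> Dx; have cf : (fun n => (f_ n x)%:E) @ \oo --> (f x)%:E.
    by apply: cvg_EFin; [exact: nearW|exact: ff].
  by rewrite is_cvg_limn_einfE; [exact/cvg_lim|apply/cvg_ex; exists (f x)%:E].
have fge0 x : D x -> 0 <= f x.
  move=> Dx; rewrite -(cvg_lim _ (ff x Dx))//.
  by apply: limr_ge; [apply/cvg_ex; exists (f x); exact: ff|apply: nearW => n; exact: f0].
have mE n : measurable_fun D (fun x => (f_ n x)%:E).
  exact: measurable_int (fi n).
have := @fatou _ T R mu D mD (fun n x => (f_ n x)%:E) mE.
move=> /(_ (fun n x Dx => f0 n x Dx)).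
have -> : (\int[mu]_(x in D) limn_einf (fun n => (f_ n x)%:E) =
           \int[mu]_(x in D) (f x)%:E)%E.
  by apply: eq_integral => x /set_mem Dx; exact: lim_eq.
move=> fat; apply/integrableP; split; first exact/measurable_EFinP.
under eq_integral => x xD.
  rewrite gee0_abs; last by rewrite lee_fin fge0//; exact: set_mem.
  over.
apply: (le_lt_trans fat); apply: (@le_lt_trans _ _ B%:E); last exact: ltry.
rewrite limn_einf_lim; apply: lime_le; first exact: is_cvg_einfs.
near=> n; rewrite /einfs.
apply: (@le_trans _ _ (\int[mu]_(x in D) (f_ n x)%:E)%E).
  by apply: ereal_inf_lbound; exists n => /=.
have fin : (\int[mu]_(x in D) (f_ n x)%:E)%E \is a fin_num.
  exact: integrable_fin_num (fi n).
by rewrite -(fineK fin) lee_fin; near: n.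
Unshelve. all: by end_near. Qed.

Lemma rintegrableZl (k : R) (f : T -> R) :
  rintegrable f -> rintegrable (fun x => k * f x).
Proof.
move=> fi; rewrite /rintegrable.
by under eq_fun do rewrite EFinM; exact: integrableZl.
Qed.

Lemma rintegrableD (f g : T -> R) : rintegrable f -> rintegrable g ->
  rintegrable (fun x => f x + g x).
Proof. by move=> fi gi; exact: integrableD fi gi. Qed.

Lemma rintegrable_sum (F : nat -> T -> R) N :
  (forall j, (j < N)%N -> rintegrable (F j)) ->
  rintegrable (fun x => \sum_(j < N) F j x) /\
  \int[mu]_(x in D) (\sum_(j < N) F j x) = \sum_(j < N) \int[mu]_(x in D) F j x.
Proof.
elim: N => [|N IH] FN.
  rewrite big_ord0.
  have -> : (fun x => \sum_(j < 0) F j x) = cst 0.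
    by apply/funext => x; rewrite big_ord0.
  by split; [exact: integrable0|rewrite Rintegral_cst// mul0r].
have [i1 i2] := IH (fun j jN => FN j (ltnW jN)).
have iN := FN N (ltnSn N).
have -> : (fun x => \sum_(j < N.+1) F j x) = (fun x => \sum_(j < N) F j x + F N x).
  by apply/funext => x; rewrite big_ord_recr.
rewrite big_ord_recr /= -i2; split; first exact: integrableD i1 iN.
exact: RintegralD.
Qed.

End RealIntegral.

(** * Alternating Taylor bounds for exp(-y) *)

Section ExpRemainder.
Context {R : realType}.

(** Taylor remainder of [expR (- y)] after k terms, with the sign that makes it nonnegative for y >=
    0. *)
Definition exp_rem (k : nat) (y : R) : R :=
  (-1) ^+ k * (expR (- y) - \sum_(j < k) (- y) ^+ j / j`!%:R).

Lemma exp_remS k y : exp_rem k.+1 y = y ^+ k / k`!%:R - exp_rem k y.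
Proof.
rewrite /exp_rem big_ord_recr /= exprS.
have -> : (- y) ^+ k = (-1) ^+ k * y ^+ k by rewrite -exprMn mulN1r.
rewrite !mulrDr !mulrN !mulN1r !mulNr opprK.
rewrite (mulrDr ((-1) ^+ k)).
set a := (-1) ^+ k; set S := \sum_(_ < _) _.
have aa : a * a = 1 by rewrite -expr2 sqrr_sign.
rewrite -[in RHS](mul1r (y ^+ k / _)) -aa; ring.
Qed.

Lemma is_derive_exp_rem k (y : R) :
  is_derive y 1 (exp_rem k.+1) (exp_rem k y).
Proof.
elim: k => [|k IH].
  have -> : exp_rem 1 = (fun y : R => 1 - expR (- y)).
    apply/funext => z; rewrite exp_remS /exp_rem big_ord0 expr0 fact0 divr1.
    by rewrite mul1r subr0 -[in LHS](expr0 z) expr0.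
  rewrite /exp_rem big_ord0 expr0 subr0 mul1r.
  apply: is_derive_eq.
  by rewrite /GRing.scale /=; ring.
have -> : exp_rem k.+2 = (fun y : R => y ^+ k.+1 / k.+1`!%:R - exp_rem k.+1 y).
  by apply/funext => z; rewrite exp_remS.
have -> : (fun y : R => y ^+ k.+1 / k.+1`!%:R - exp_rem k.+1 y) =
    (k.+1`!%:R^-1 \*: (id ^+ k.+1) - exp_rem k.+1) :> (R -> R).
  by apply/funext => z; rewrite !fctE /GRing.scale /= mulrC.
apply: is_derive_eq.
rewrite exp_remS /GRing.scale /= mulr1 factS natrM.
have : k.+1%:R != 0 :> R by rewrite pnatr_eq0.
have : k`!%:R != 0 :> R by rewrite pnatr_eq0 -lt0n fact_gt0.
move=> h1 h2.
by field; rewrite h1 nat1r.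
Qed.

(** The remainder of order k + 1 vanishes at 0 and its derivative is the remainder of order k. *)
Lemma exp_rem_ge0 k y : 0 <= y -> 0 <= exp_rem k y.
Proof.
elim: k y => [|k IH] y y0.
  by rewrite /exp_rem big_ord0 expr0 subr0 mul1r expR_ge0.
have -> : 0 = exp_rem k.+1 0.
  rewrite /exp_rem big_ord_recl big1 ?oppr0 ?expR0 ?expr0 ?fact0; last first.
    by move=> i _; rewrite expr0n /= mul0r.
  by rewrite divr1 addr0 subrr mulr0.
have dx z : derivable (exp_rem k.+1) z 1 by have := is_derive_exp_rem k z.
apply: (@ger0_derive1_ndecry R _ 0) => //.
- move=> z; rewrite in_itv /= andbT => z0; rewrite derive1E.
  have dz := is_derive_exp_rem k z; rewrite derive_val.
  by rewrite IH// ltW.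
- apply: continuous_subspaceT => z.
  exact/differentiable_continuous/derivable1_diffP.
Qed.

(** By [exp_remS] the difference of the two sides is the next remainder. *)
Lemma exp_rem_le k y : 0 <= y -> exp_rem k y <= y ^+ k / k`!%:R.
Proof. by move=> y0; have := exp_rem_ge0 k.+1 y0; rewrite exp_remS subr_ge0. Qed.

Lemma exp_rem_sub_le k y : 0 <= y ->
  `|exp_rem k y - y ^+ k / k`!%:R| <= y ^+ k.+1 / k.+1`!%:R.
Proof.
move=> y0; have := exp_rem_le k.+1 y0; have := exp_rem_ge0 k.+1 y0.
by rewrite exp_remS distrC => h1 h2; rewrite ger0_norm.
Qed.

End ExpRemainder.

(** * Tails of power series and the exponential series *)

Section PowerSeries.
Context {R : realType}.

Lemma geometric_le (x : R) k N : 0 <= x -> x <= 2^-1 ->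
  \sum_(k <= j < N) x ^+ j <= 2 * x ^+ k.
Proof.
move=> x0 x2; case: (leqP N k) => [Nk|].
  by rewrite big_geq// mulr_ge0// exprn_ge0.
elim: N => // N IH; rewrite ltnS leq_eqVlt => /predU1P[->|kN].
  by rewrite big_nat1; have := exprn_ge0 N x0; lra.
(* Subtracting the last term makes the claim inductive, because 2 x^(n+1) <= x^n. *)
have E n : (k <= n)%N -> \sum_(k <= j < n.+1) x ^+ j <= 2 * x ^+ k - x ^+ n.
  elim: n => [|n IHn].
    rewrite leqn0 => /eqP ->; rewrite big_nat1; lra.
  rewrite leq_eqVlt => /predU1P[->|kn]; first by rewrite big_nat1; lra.
  rewrite big_nat_recr /=; last by apply: leqW.
  have := IHn kn; rewrite exprS.
  have := exprn_ge0 n x0; nra.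
by have := E _ (ltnW kN); have := exprn_ge0 N x0; lra.
Qed.

(** Convergence at s = r / 2 bounds the terms [b j * s ^+ j]; for |t| <= s / 2 the tail is then
    dominated by a geometric series of ratio at most 1/2. *)
Lemma power_series_tail (b : nat -> R) (h : R -> R) (r : R) : 0 < r ->
  (forall t, `|t| < r ->
     (fun N => \sum_(k < N) b k * t ^+ k) @ \oo --> h t) ->
  forall k, exists K d : R, [/\ 0 <= K, 0 < d, d < r &
    forall t, `|t| <= d ->
      `|h t - \sum_(j < k) b j * t ^+ j| <= K * `|t| ^+ k].
Proof.
move=> r0 hb k.
pose s := r / 2.
have s0 : 0 < s by rewrite divr_gt0.
have sr' : s < r by rewrite /s; lra.
clearbody s; have sr : `|s| < r by rewrite gtr0_norm.
have [M M0 bM] : exists2 M : R, 0 <= M & forall j, `|b j * s ^+ j| <= M.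
  have cv := hb _ sr.
  have : cvgn (fun N => \sum_(k < N) b k * s ^+ k) by apply/cvg_ex; exists (h s).
  move=> /cvg_seq_bounded/pinfty_ex_gt0[M /ltW M0 /= HM].
  (* Each term is the difference of two partial sums, both bounded by M. *)
  exists (M + M) => [|j]; first by rewrite addr_ge0.
  have := HM j.+1 I; have := HM j I; rewrite big_ord_recr /=.
  set S := \sum_(_ < _) _; rewrite !ler_norml.
  by move=> /andP[? ?] /andP[? ?]; apply/andP; split; lra.
exists (2 * M / s ^+ k), (s / 2); split.
- by rewrite divr_ge0 ?mulr_ge0 ?exprn_ge0// ltW.
- by rewrite divr_gt0.
- by lra.
move=> t ts.
have tr : `|t| < r by rewrite (le_lt_trans ts)//; lra.
have cv : (fun N => `|\sum_(j < N) b j * t ^+ j - \sum_(j < k) b j * t ^+ j|)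
    @ \oo --> `|h t - \sum_(j < k) b j * t ^+ j|.
  by apply: cvg_norm; apply: cvgB; [exact: hb|exact: cvg_cst].
rewrite -(cvg_lim _ cv)//; apply: limr_le.
  by apply/cvg_ex; exists (`|h t - \sum_(j < k) b j * t ^+ j|).
near=> N.
have kN : (k <= N)%N by near: N; exact: nbhs_infty_ge.
rewrite -!(big_mkord xpredT (fun j => b j * t ^+ j)) (@big_cat_nat _ _ _ k) //=.
rewrite (addrC (\sum_(0 <= j < k) _)) addrK (le_trans (ler_norm_sum _ _ _))//.
apply: (@le_trans _ _ (\sum_(k <= j < N) M * (`|t| / s) ^+ j)).
  apply: ler_sum => j _.
  have -> : b j * t ^+ j = (b j * s ^+ j) * (t / s) ^+ j.
    by rewrite -mulrA -exprMn (mulrC s) divfK// gt_eqF.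
  by rewrite normrM normrX normf_div (gtr0_norm s0) ler_wpM2r ?exprn_ge0// divr_ge0// ltW.
rewrite -mulr_sumr.
have -> : 2 * M / s ^+ k * `|t| ^+ k = M * (2 * (`|t| / s) ^+ k).
  by rewrite exprMn exprVn; ring.
rewrite ler_wpM2l// geometric_le ?divr_ge0// ?(ltW s0)//.
by rewrite ler_pdivrMr// mulrC.
Unshelve. all: by end_near. Qed.

End PowerSeries.

Section ExpSeries.
Context {R : realType}.

Lemma exp_partial_cvg (y : R) :
  (fun N => \sum_(k < N) y ^+ k / k`!%:R) @ \oo --> expR y.
Proof.
rewrite /expR.
have -> : (fun N => \sum_(k < N) y ^+ k / k`!%:R) = series (exp_coeff y).
  by apply/funext => N; rewrite /series /= big_mkord.
exact: is_cvg_series_exp_coeff.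
Qed.

Lemma exp_partial_le (y : R) N : 0 <= y ->
  \sum_(k < N) y ^+ k / k`!%:R <= expR y.
Proof.
move=> y0; rewrite -(cvg_lim _ (@exp_partial_cvg y))//.
apply: (@nondecreasing_cvgn_le _ (fun N => \sum_(k < N) y ^+ k / k`!%:R)).
- apply/nondecreasing_seqP => n; rewrite big_ord_recr /= lerDl.
  by rewrite divr_ge0// exprn_ge0.
- by apply/cvg_ex; exists (expR y); exact: (@exp_partial_cvg y).
Qed.

Lemma exp_term_le (y : R) k : 0 <= y -> y ^+ k / k`!%:R <= expR y.
Proof.
move=> y0; apply: le_trans (exp_partial_le k.+1 y0).
by rewrite big_ord_recr /= lerDr sumr_ge0// => i _; rewrite divr_ge0// exprn_ge0.
Qed.

Lemma exp_partial_norm_le (y : R) N :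
  `|\sum_(k < N) y ^+ k / k`!%:R| <= expR `|y|.
Proof.
apply: le_trans (exp_partial_le N (normr_ge0 y)).
apply: le_trans (ler_norm_sum _ _ _) _.
by apply: ler_sum => i _; rewrite normrM normrX normfV normr_nat.
Qed.

End ExpSeries.

(** * Laplace integrals, their moments and their Taylor expansions *)

Section Laplace.
Context d (T : measurableType d) (R : realType).
Variables (mu : {measure set T -> \bar R}) (w u : T -> R).

Definition laplace_fun (t : R) (x : T) : R := w x * expR (t * u x).
(** The k-th derivative of [laplace_fun] in t. *)
Definition moment_fun (t : R) (k : nat) (x : T) : R :=
  w x * u x ^+ k * expR (t * u x).

Section Domain.
Variables (D : set T) (mD : measurable D).
Hypotheses (mw : measurable_fun D w) (mu_ : measurable_fun D u).
Hypothesis w0 : forall x, D x -> 0 <= w x.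

Local Notation rint := (rintegrable mu D).
Definition laplace t := \int[mu]_(x in D) laplace_fun t x.
Definition moment t k := \int[mu]_(x in D) moment_fun t k x.

Lemma measurable_expu t : measurable_fun D (fun x => expR (t * u x)).
Proof.
apply: measurableT_comp; first exact: measurable_expR.
by apply: measurable_funM => //; exact: measurable_cst.
Qed.

Lemma measurable_laplace_fun t : measurable_fun D (laplace_fun t).
Proof. by apply: measurable_funM => //; exact: measurable_expu. Qed.

Lemma measurable_moment_fun t k : measurable_fun D (moment_fun t k).
Proof.
apply: measurable_funM; last exact: measurable_expu.
by apply: measurable_funM => //; exact: measurable_funX.
Qed.

Lemma laplace_funD t s x : laplace_fun (t + s) x = laplace_fun t x * expR (s * u x).
Proof. by rewrite /laplace_fun mulrDl expRD mulrA. Qed.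

Lemma laplace_fun_ge0 t x : D x -> 0 <= laplace_fun t x.
Proof. by move=> Dx; rewrite mulr_ge0 ?expR_ge0// w0. Qed.

(** Pointwise, exp(t u) is at most exp(b u) where u >= 0 and at most exp(a u) where u < 0. *)
Lemma laplace_between a b t : a <= t <= b ->
  rint (laplace_fun a) -> rint (laplace_fun b) -> rint (laplace_fun t).
Proof.
move=> /andP[at_ tb] ia ib.
apply: (@le_rintegrable _ _ _ _ _ mD _ (fun x => laplace_fun a x + laplace_fun b x)).
- exact: measurable_laplace_fun.
- move=> x Dx; rewrite ger0_norm ?laplace_fun_ge0// /laplace_fun -mulrDr.
  rewrite ler_wpM2l ?w0//; have [u0|u0] := leP 0 (u x).
    by apply: (@le_trans _ _ (expR (b * u x))); rewrite ?ler_expR ?ler_wpM2r// lerDr expR_ge0.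
  apply: (@le_trans _ _ (expR (a * u x))); last by rewrite lerDl expR_ge0.
  by rewrite ler_expR ler_wnM2r// ltW.
- exact: rintegrableD ia ib.
Qed.

(** The integrands at t + r and t - r together dominate [laplace_fun t x] times exp |s u|, hence all
    partial sums of the exponential series of s u; dominated convergence then integrates this series
    term by term. *)
Lemma moment_expansion t r : 0 < r ->
  rint (laplace_fun (t + r)) -> rint (laplace_fun (t - r)) ->
  (forall k, rint (moment_fun t k)) /\
  (forall s, `|s| <= r -> rint (laplace_fun (t + s)) /\
     (fun N => \sum_(k < N) moment t k / k`!%:R * s ^+ k) @ \oo -->
       laplace (t + s)).
Proof.
move=> r0 ip im.
pose g x := laplace_fun (t + r) x + laplace_fun (t - r) x.
have ig : rint g by exact: rintegrableD ip im.
have geg x s : D x -> `|s| <= r -> laplace_fun t x * expR (`|s * u x|) <= g x.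
  move=> Dx sr; rewrite /g !laplace_funD -mulrDr ler_wpM2l ?laplace_fun_ge0//.
  rewrite normrM; have [u0|u0] := leP 0 (u x).
    apply: (@le_trans _ _ (expR (r * u x))); last by rewrite lerDl expR_ge0.
    by rewrite ler_expR (ger0_norm u0) ler_wpM2r.
  apply: (@le_trans _ _ (expR (- r * u x))); last by rewrite lerDr expR_ge0.
  by rewrite ler_expR (ltr0_norm u0) mulrN mulNr lerN2 ler_wnM2r// ltW.
have im_ k : rint (moment_fun t k).
  apply: (@le_rintegrable _ _ _ _ _ mD _ (fun x => k`!%:R / r ^+ k * g x)).
  - exact: measurable_moment_fun.
  - move=> x Dx; have rr : `|r| <= r by rewrite gtr0_norm.
    apply: (@le_trans _ _ (k`!%:R / r ^+ k * (laplace_fun t x * expR (`|r * u x|)))); last first.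
      by rewrite ler_wpM2l ?geg// divr_ge0// exprn_ge0// ltW.
    have -> : moment_fun t k x = laplace_fun t x * u x ^+ k.
      by rewrite /moment_fun /laplace_fun; ring.
    rewrite normrM (ger0_norm (laplace_fun_ge0 _ Dx)) mulrCA.
    rewrite ler_wpM2l ?laplace_fun_ge0//.
    have := exp_term_le k (normr_ge0 (r * u x)).
    rewrite [X in X ^+ _]normrM exprMn (gtr0_norm r0) normrX => h.
    have rk : 0 < r ^+ k by rewrite exprn_gt0.
    have kf : 0 < k`!%:R :> R by rewrite ltr0n fact_gt0.
    apply: (@le_trans _ _ (k`!%:R / r ^+ k * (r ^+ k * `|u x| ^+ k / k`!%:R))).
      rewrite le_eqVlt; apply/orP; left; apply/eqP.
      by move: rk kf; move: (r ^+ k) k`!%:R => a b a0 b0; field; rewrite !gt_eqF.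
    by rewrite ler_wpM2l// divr_ge0// ltW.
  - exact: rintegrableZl.
split=> // s sr.
have := @real_dominated_convergence _ _ _ mu D mD
  (fun N x => laplace_fun t x * \sum_(k < N) (s * u x) ^+ k / k`!%:R)
  (laplace_fun (t + s)) g.
case.
- move=> n; apply: measurable_funM; first exact: measurable_laplace_fun.
  apply: measurable_sum => k.
  apply: measurable_funM; last exact: measurable_cst.
  by apply: measurable_funX; apply: measurable_funM => //; exact: measurable_cst.
- exact: measurable_laplace_fun.
- exact: ig.
- move=> n x Dx; rewrite normrM (ger0_norm (laplace_fun_ge0 _ Dx)).
  by apply: le_trans (geg _ s Dx sr); rewrite ler_wpM2l ?laplace_fun_ge0// exp_partial_norm_le.
- move=> x Dx; rewrite laplace_funD.
  by apply: cvgM; [exact: cvg_cst|exact: (@exp_partial_cvg _ (s * u x))].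
move=> i1 i2; split=> //.
have E N x : laplace_fun t x * (\sum_(k < N) (s * u x) ^+ k / k`!%:R) =
    \sum_(k < N) s ^+ k / k`!%:R * moment_fun t k x.
  rewrite mulr_sumr; apply: eq_bigr => k _.
  by rewrite exprMn /moment_fun /laplace_fun; ring.
rewrite (_ : (fun N => \sum_(k < N) _) = (fun N => \int[mu]_(x in D)
    (laplace_fun t x * (\sum_(k < N) (s * u x) ^+ k / k`!%:R)))) //.
apply/funext => N; under eq_Rintegral do rewrite E.
have [|_ ->] := @rintegrable_sum _ _ _ mu D mD
   (fun k x => s ^+ k / k`!%:R * moment_fun t k x) N.
  by move=> j _; exact: rintegrableZl.
apply: eq_bigr => k _; rewrite RintegralZl//; last exact: im_.
by rewrite /moment; ring.
Qed.

(** The heart of Landau's argument, by induction on k. The terms below k are subtracted and the rest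
    is divided by [s n ^+ k], up to sign: the integrands are nonnegative and tend to [laplace_fun t]
    times u^k / k!, while their integrals tend to b k. Fatou's lemma makes the limit integrable. By
    [exp_rem_le] the limit also dominates the sequence, so dominated convergence identifies its
    integral with b k. *)
Lemma moments_of_power_series (t r : R) (b : nat -> R) (h : R -> R)
    (s : nat -> R) : 0 < r ->
  (forall x, D x -> 0 <= u x) ->
  (forall a, `|a| < r -> (fun N => \sum_(k < N) b k * a ^+ k) @ \oo --> h a) ->
  (forall n, 0 < s n) -> s @ \oo --> 0 ->
  (forall n, rint (laplace_fun (t - s n)) /\ laplace (t - s n) = h (- s n)) ->
  forall k, rint (moment_fun t k) /\ b k = moment t k / k`!%:R.
Proof.
move=> r0 u0 hb s0 sc hs k; elim/ltn_ind: k => k IH.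
pose g n x := (s n) ^- k * (laplace_fun t x * exp_rem k (s n * u x)).
have exp_remE n x : laplace_fun t x * exp_rem k (s n * u x) =
    (-1) ^+ k * (laplace_fun (t - s n) x -
      \sum_(j < k) (- s n) ^+ j / j`!%:R * moment_fun t j x).
  rewrite laplace_funD /exp_rem mulrCA mulrBr mulNr; congr (_ * (_ - _)).
  rewrite mulr_sumr; apply: eq_bigr => j _.
  by rewrite -mulNr exprMn /laplace_fun /moment_fun; ring.
have sumi n := @rintegrable_sum _ _ _ mu D mD
  (fun j x => (- s n) ^+ j / j`!%:R * moment_fun t j x) k
  (fun j jk => rintegrableZl mD _ (IH j jk).1).
have intg n : rint (g n) /\ \int[mu]_(x in D) g n x =
    s n ^- k * ((-1) ^+ k * (h (- s n) - \sum_(j < k) b j * (- s n) ^+ j)).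
  have [hs1 hs2] := hs n; have [sumi1 sumi2] := sumi n.
  have i1 : rint (fun x => laplace_fun (t - s n) x -
      \sum_(j < k) (- s n) ^+ j / j`!%:R * moment_fun t j x).
    exact: integrableB hs1 sumi1.
  have i2 := rintegrableZl mD ((-1) ^+ k) i1.
  have gE : g n = fun x => s n ^- k * ((-1) ^+ k * (laplace_fun (t - s n) x -
      \sum_(j < k) (- s n) ^+ j / j`!%:R * moment_fun t j x)).
    by apply/funext => x; rewrite /g exp_remE.
  rewrite gE; split; first exact: rintegrableZl.
  rewrite RintegralZl// RintegralZl// RintegralB// sumi2 -hs2.
  congr (_ * (_ * (_ - _))); apply: eq_bigr => j _.
  have [im_ ->] := IH j (ltn_ord j).
  by rewrite RintegralZl// /moment; ring.
have g0 n x : D x -> 0 <= g n x.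
  move=> Dx; rewrite mulr_ge0 ?invr_ge0 ?exprn_ge0 ?(ltW (s0 n))//.
  by rewrite mulr_ge0 ?laplace_fun_ge0// exp_rem_ge0// mulr_ge0 ?u0// ltW.
pose f x := laplace_fun t x * (u x ^+ k / k`!%:R).
have fE x : f x = k`!%:R^-1 * moment_fun t k x.
  by rewrite /f /laplace_fun /moment_fun; ring.
have gf x : D x -> g ^~ x @ \oo --> f x.
  move=> Dx.
  have : (fun n => s n * (laplace_fun t x * (u x ^+ k.+1 / k.+1`!%:R))) @ \oo --> (0 : R).
    by rewrite -[X in _ --> X](mul0r (laplace_fun t x * (u x ^+ k.+1 / k.+1`!%:R))); apply: cvgMl.
  move=> cv; apply/cvgrPdistC_le => e e0.
  move/cvgrPdistC_le : cv => /(_ e e0); apply: filterS => n.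
  rewrite subr0 => hn; apply: le_trans hn; rewrite [leRHS]ger0_norm; last first.
    by rewrite mulr_ge0 ?(ltW (s0 n))// mulr_ge0 ?laplace_fun_ge0// divr_ge0// exprn_ge0// u0.
  have -> : g n x - f x = laplace_fun t x * (s n ^- k *
      (exp_rem k (s n * u x) - (s n * u x) ^+ k / k`!%:R)).
    rewrite /g /f exprMn.
    have : s n ^+ k != 0 by rewrite expf_neq0// gt_eqF.
    have : k`!%:R != 0 :> R by rewrite pnatr_eq0 -lt0n fact_gt0.
    move: (s n ^+ k) (k`!%:R) (u x ^+ k) (exp_rem _ _) => p q v e' q0 p0.
    by field; rewrite p0 q0.
  rewrite normrM (ger0_norm (laplace_fun_ge0 t Dx)) mulrCA ler_wpM2l ?laplace_fun_ge0//.
  have sk : 0 < s n ^+ k by rewrite exprn_gt0.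
  rewrite normrM gtr0_norm ?invr_gt0// ler_pdivrMl//.
  apply: le_trans (exp_rem_sub_le k _) _; first by rewrite mulr_ge0 ?u0// ltW.
  by rewrite exprMn exprS -!mulrA mulrCA.
have [K [dl [K0 dl0 dlr Kb]]] := power_series_tail r0 hb k.+1.
have near_s : \forall n \near \oo, s n <= dl.
  move/cvgrPdistC_le : sc => /(_ dl dl0); apply: filterS => n.
  by rewrite subr0 gtr0_norm.
(* The tail of order k + 1, divided by [s n ^+ k], leaves an error linear in [s n]. *)
have intgb : \forall n \near \oo, `|\int[mu]_(x in D) g n x - b k| <= K * s n.
  apply: filterS near_s => n sn; rewrite (intg n).2.
  have := Kb (- s n); rewrite normrN (gtr0_norm (s0 n)) => /(_ sn).
  rewrite big_ord_recr /= opprD addrA => h1.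
  have sk : 0 < s n ^+ k by rewrite exprn_gt0.
  have -> : s n ^- k * ((-1) ^+ k * (h (- s n) - \sum_(j < k) b j * (- s n) ^+ j)) - b k
    = s n ^- k * ((-1) ^+ k * (h (- s n) - \sum_(j < k) b j * (- s n) ^+ j - b k * (- s n) ^+ k)).
    have -> : (- s n) ^+ k = (-1) ^+ k * s n ^+ k by rewrite -exprMn mulN1r.
    have aa : (-1) ^+ k * (-1) ^+ k = 1 :> R by rewrite -expr2 sqrr_sign.
    set A := h _ - _; rewrite [in RHS]mulrBr [in RHS]mulrBr; congr (_ - _).
    move: sk aa; move: ((-1) ^+ k) (s n ^+ k) => p q q0 pp.
    rewrite -[LHS]mulr1 -pp; field; by rewrite gt_eqF.
  rewrite normrM normrM normrX normrN1 expr1n mul1r gtr0_norm ?invr_gt0//.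
  by rewrite ler_pdivrMl// mulrCA -exprSr.
have cvb : (fun n => \int[mu]_(x in D) g n x) @ \oo --> b k.
  have : (fun n => K * s n) @ \oo --> (0 : R).
    by rewrite -[X in _ --> X](mulr0 K); apply: cvgMr.
  move=> cv; apply/cvgrPdistC_le => e e0.
  move/cvgrPdistC_le : cv => /(_ e e0); apply: filterS2 intgb => n h1.
  by rewrite subr0 ger0_norm ?mulr_ge0 ?(ltW (s0 n))//; exact: le_trans.
have mf : measurable_fun D f.
  by rewrite (_ : f = fun x => k`!%:R^-1 * moment_fun t k x);
    [apply: measurable_funM; [exact: measurable_cst|exact: measurable_moment_fun]|apply/funext].
have fi : rint f.
  apply: (@real_fatou _ _ _ mu D mD g f (b k + 1)) => //.
  - by move=> n; exact: (intg n).1.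
  - move/cvgrPdistC_le : cvb => /(_ 1 ltr01); apply: filterS => n.
    by rewrite ler_norml => /andP[_]; rewrite lerBlDl.
have [|||||_ cvf] := @real_dominated_convergence _ _ _ mu D mD g f f.
- by move=> n; exact: rintegrable_measurable (intg n).1.
- by [].
- by [].
- move=> n x Dx; rewrite ger0_norm ?g0// /g /f mulrCA ler_wpM2l ?laplace_fun_ge0//.
  have sk : 0 < s n ^+ k by rewrite exprn_gt0.
  rewrite ler_pdivrMl// mulrA -exprMn exp_rem_le// mulr_ge0 ?u0// ltW//.
- exact: gf.
have kf : k`!%:R != 0 :> R by rewrite pnatr_eq0 -lt0n fact_gt0.
have mi : rint (moment_fun t k).
  rewrite (_ : moment_fun t k = fun x => k`!%:R * f x); first exact: rintegrableZl.
  by apply/funext => x; rewrite fE mulVKf.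
split=> //.
have -> : b k = \int[mu]_(x in D) f x by exact: cvg_unique cvb cvf.
under eq_Rintegral do rewrite fE.
by rewrite RintegralZl// mulrC.
Qed.
End Domain.
End Laplace.

(** * Crossing the abscissa of convergence *)

Section Landau.
Context d (T : measurableType d) (R : realType).
Variables (mu : {measure set T -> \bar R}) (w u : T -> R).
Variables (D : set T) (mD : measurable D).
Hypotheses (mw : measurable_fun D w) (mu_ : measurable_fun D u).
Hypothesis w0 : forall x, D x -> 0 <= w x.

Lemma laplace_fun_le (E : set T) (t s : R) (mE : measurable E) :
  E `<=` D -> (forall x, E x -> t * u x <= s * u x) ->
  rintegrable mu E (laplace_fun w u s) -> rintegrable mu E (laplace_fun w u t).
Proof.
move=> ED le; apply: le_rintegrable => //.
  apply: measurable_laplace_fun => //; exact: measurable_funS ED _.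
move=> x Ex; have Dx := ED _ Ex.
rewrite /laplace_fun ger0_norm ?mulr_ge0 ?w0 ?expR_ge0//.
by rewrite ler_wpM2l ?w0// ler_expR le.
Qed.

Lemma rintegrableS (E : set T) (f : T -> R) : measurable E ->
  E `<=` D -> rintegrable mu D f -> rintegrable mu E f.
Proof. by move=> mE ED; exact: integrableS. Qed.

Lemma rintegrable_setU (A B : set T) (f : T -> R) :
  measurable A -> measurable B -> [disjoint A & B] ->
  rintegrable mu A f -> rintegrable mu B f -> rintegrable mu (A `|` B) f.
Proof.
move=> mA mB AB /integrableP[mfA fA] /integrableP[mfB fB].
have mf : measurable_fun (A `|` B) (fun x => (f x)%:E).
  by apply/measurable_funU.
apply/integrableP; split=> //.
rewrite ge0_integral_setU//; first exact: lte_add_pinfty.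
exact: measurableT_comp.
Qed.

(** Where u < 0 the integral converges for all parameters >= 0 and has a power series at t, which is
    subtracted from h. What remains is the part where u >= 0: there the moments are nonnegative and
    equal the remaining coefficients up to factorials. *)
Lemma landau_step (t r : R) (b : nat -> R) (h : R -> R) : 0 < t -> 0 < r ->
  rintegrable mu D (laplace_fun w u 0) ->
  (forall a, `|a| < r -> (fun N => \sum_(k < N) b k * a ^+ k) @ \oo --> h a) ->
  (forall e, 0 < e -> exists s, [/\ 0 < s, s < e,
     rintegrable mu D (laplace_fun w u (t - s)) &
     laplace mu w u D (t - s) = h (- s)]) ->
  exists2 r', 0 < r' & forall s, `|s| < r' ->
    rintegrable mu D (laplace_fun w u (t + s)) /\
    laplace mu w u D (t + s) = h s.
Proof.
move=> t0 r0 i0 hb hs.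
pose P := D `&` u @^-1` [set y | 0 <= y].
pose M := D `&` u @^-1` [set y | y < 0].
have mP : measurable P.
  by rewrite /P (_ : [set y | 0 <= y] = `[0, +oo[%classic); [apply: mu_|apply/seteqP; split=> y /=; rewrite in_itv /= andbT].
have mM : measurable M.
  by rewrite /M (_ : [set y | y < 0] = `]-oo, 0[%classic); [apply: mu_|apply/seteqP; split=> y /=; rewrite in_itv].
have PD : P `<=` D by move=> x [].
have MD : M `<=` D by move=> x [].
have PM : D = P `|` M.
  apply/seteqP; split=> x; last by case=> -[].
  by move=> Dx; have [ux|ux] := leP 0 (u x); [left|right].
have disj : [disjoint P & M].
  by apply/eqP; rewrite -subset0 => x [[_ /= h1] [_ /= h2]]; move: h1; rewrite leNgt h2.
have splitD a : rintegrable mu P (laplace_fun w u a) ->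
    rintegrable mu M (laplace_fun w u a) ->
    rintegrable mu D (laplace_fun w u a) /\
    laplace mu w u D a = laplace mu w u P a + laplace mu w u M a.
  move=> h1 h2; have h3 : rintegrable mu D (laplace_fun w u a).
    by rewrite PM; exact: rintegrable_setU.
  split=> //; rewrite /laplace PM Rintegral_setU -?PM//.
have iM a : 0 <= a -> rintegrable mu M (laplace_fun w u a).
  move=> a0; apply: (@laplace_fun_le _ _ 0) => //; last exact: rintegrableS.
  by move=> x [_ /= /ltW ux]; rewrite mul0r mulr_ge0_le0.
have mwS E : E `<=` D -> measurable_fun E w by move=> ED; exact: measurable_funS ED _.
have muS E : E `<=` D -> measurable_fun E u by move=> ED; exact: measurable_funS ED _.
(* r1 < t keeps t - r1 positive, where the integral over M converges. *)
pose r1 := Num.min r t / 2.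
have m0 : 0 < Num.min r t by rewrite lt_min r0.
have r10 : 0 < r1 by rewrite divr_gt0.
have r1m : r1 < Num.min r t by rewrite /r1; lra.
have [r1r r1t] : r1 < r /\ r1 < t by move: r1m; rewrite lt_min => /andP[].
have [imM eM] := @moment_expansion _ _ _ mu w u M mM (mwS _ MD) (muS _ MD)
  (fun x Mx => w0 (MD _ Mx)) t r1 r10 (iM (t + r1) (ltW (addr_gt0 t0 r10)))
  (iM (t - r1) ltac:(lra)).
pose b' k := b k - moment mu w u M t k / k`!%:R.
pose h' a := h a - laplace mu w u M (t + a).
have hb' a : `|a| < r1 -> (fun N => \sum_(k < N) b' k * a ^+ k) @ \oo --> h' a.
  move=> ar.
  rewrite (_ : (fun N => _) = (fun N => \sum_(k < N) b k * a ^+ k -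
     \sum_(k < N) moment mu w u M t k / k`!%:R * a ^+ k)).
    by apply: cvgB; [apply: hb; exact: lt_trans r1r|exact: (eM a (ltW ar)).2].
  apply/funext => N; rewrite -sumrB; apply: eq_bigr => k _.
  by rewrite /b' mulrBl.
have /choice[s sP] : forall n : nat, exists s, [/\ 0 < s, s < Num.min r1 n.+1%:R^-1,
     rintegrable mu D (laplace_fun w u (t - s)) &
     laplace mu w u D (t - s) = h (- s)].
  by move=> n; apply: hs; rewrite lt_min r10 /= invr_gt0 ltr0n.
have s0 n : 0 < s n by case: (sP n).
have sr1 n : s n < r1 by case: (sP n) => _; rewrite lt_min => /andP[].
have s_cvg : s @ \oo --> 0.
  apply: (@squeeze_cvgr _ _ _ _ (cst 0) harmonic); last first.
  - exact: cvg_harmonic.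
  - exact: cvg_cst.
  - apply: nearW => n; rewrite /cst (ltW (s0 n)) /=.
    by case: (sP n) => _; rewrite lt_min => /andP[_ /ltW].
have iP a : a < t -> 0 <= a -> rintegrable mu P (laplace_fun w u a).
  move=> at_ a0; have [s1 [s10 s1lt is1 _]] := hs (t - a) ltac:(lra).
  apply: (@laplace_fun_le _ _ (t - s1)) => //; last exact: rintegrableS.
  by move=> x [_ /= ux]; rewrite ler_wpM2r//; lra.
have moms := @moments_of_power_series _ _ _ mu w u P mP (mwS _ PD) (muS _ PD)
  (fun x Mx => w0 (PD _ Mx)) t r1 b' h' s r10 (fun x Px => Px.2) hb' s0 s_cvg.
have {}moms : forall k, rintegrable mu P (moment_fun w u t k) /\
    b' k = moment mu w u P t k / k`!%:R.
  apply: moms => n; have [_ _ isn lsn] := sP n; have sn0 := s0 n; have snr := sr1 n.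
  have ip := rintegrableS mP PD isn; have im := rintegrableS mM MD isn.
  split=> //.
  by rewrite /h' -lsn (splitD _ ip im).2 addrK.
have iPt : rintegrable mu P (laplace_fun w u t).
  rewrite (_ : laplace_fun w u t = moment_fun w u t 0); first exact: (moms 0%N).1.
  by apply/funext => x; rewrite /moment_fun expr0 mulr1.
pose r2 := r1 / 2.
have r20 : 0 < r2 by rewrite divr_gt0.
have r2r1 : r2 < r1 by rewrite /r2; lra.
clearbody r2.
(* On P the exponential series of r2 u has nonnegative terms, and its integrated partial sums are
   those of the convergent series of h' at r2. Fatou's lemma thus gives convergence to the right of
   t. *)
have iPp : rintegrable mu P (laplace_fun w u (t + r2)).
  have cv := hb' r2 ltac:(rewrite gtr0_norm//).
  apply: (@real_fatou _ _ _ mu P mP (fun N x => \sum_(k < N)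
     r2 ^+ k / k`!%:R * moment_fun w u t k x) _ (h' r2 + 1)).
  - by apply: measurable_laplace_fun => //; [exact: mwS|exact: muS].
  - move=> N; apply: (@rintegrable_sum _ _ _ mu P mP
      (fun k x => r2 ^+ k / k`!%:R * moment_fun w u t k x) N _).1 => j _.
    by apply: rintegrableZl => //; exact: (moms j).1.
  - move=> N x [Dx ux]; apply: sumr_ge0 => k _.
    rewrite mulr_ge0// ?divr_ge0 ?exprn_ge0 ?(ltW r20)//.
    by rewrite !mulr_ge0 ?w0 ?exprn_ge0 ?expR_ge0.
  - move=> x Px; rewrite laplace_funD.
    rewrite (_ : (fun N => _) = (fun N => laplace_fun w u t x *
      \sum_(k < N) (r2 * u x) ^+ k / k`!%:R)).
      by apply: cvgM; [exact: cvg_cst|exact: (@exp_partial_cvg _ (r2 * u x))].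
    apply/funext => N; rewrite mulr_sumr; apply: eq_bigr => k _.
    by rewrite exprMn /moment_fun /laplace_fun; ring.
  - move/cvgrPdistC_le : cv => /(_ 1 ltr01); apply: filterS => N.
    rewrite ler_norml => /andP[_]; rewrite lerBlDl addrC; apply: le_trans.
    have [|_ ->] := @rintegrable_sum _ _ _ mu P mP
      (fun k x => r2 ^+ k / k`!%:R * moment_fun w u t k x) N.
      by move=> j _; apply: rintegrableZl => //; exact: (moms j).1.
    apply: ler_sum => k _; rewrite RintegralZl//; last exact: (moms k).1.
    by rewrite (moms k).2 -[X in _ * X <= _]/(moment mu w u P t k) le_eqVlt; apply/orP; left; apply/eqP; ring.
have [_ eP] := @moment_expansion _ _ _ mu w u P mP (mwS _ PD) (muS _ PD)
  (fun x Mx => w0 (PD _ Mx)) t r2 r20 iPp (iP (t - r2) ltac:(lra) ltac:(lra)).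
exists r2 => // a ar.
have [iPa cPa] := eP a (ltW ar).
have iMa : rintegrable mu M (laplace_fun w u (t + a)).
  by apply: iM; move: ar; rewrite ltr_norml => /andP[? ?]; lra.
have [iDa ->] := splitD _ iPa iMa; split=> //.
have <- : h' a = laplace mu w u P (t + a).
  apply: cvg_unique (hb' a (lt_trans ar r2r1)) _ => //.
  rewrite (_ : (fun N => _) = (fun N => \sum_(k < N) moment mu w u P t k / k`!%:R * a ^+ k))//.
  by apply/funext => N; apply: eq_bigr => k _; rewrite (moms k).2.
by rewrite /h' subrK.
Qed.

(* [Zr] is given near [t], but possibly not at [t], by a power series. *)
Definition removable (Zr : R -> R) (t : R) := exists (b : nat -> R) (r : R),
  0 < r /\ forall s, 0 < `|s| < r ->
    (fun N => \sum_(k < N) b k * s ^+ k) @ \oo --> Zr (t + s).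

(** If the integral diverged at some tmax, the points up to which it converges and agrees with Zr
    would have a supremum t, and [landau_step] at t would lead beyond it. *)
Lemma landau (Zr : R -> R) (t0 : R) : 0 < t0 ->
  (forall t, `|t| < t0 -> rintegrable mu D (laplace_fun w u t) /\
     Zr t = laplace mu w u D t) ->
  (forall t, 0 < t -> removable Zr t) ->
  forall t, 0 <= t -> rintegrable mu D (laplace_fun w u t).
Proof.
move=> t00 Z0 rem tmax tmax0; apply: contrapT => ndiv.
pose ok t := rintegrable mu D (laplace_fun w u t) /\ Zr t = laplace mu w u D t.
(* The neighbourhood is punctured because Zr may take an arbitrary value at a removable point. *)
pose good t := exists2 e, 0 < e & forall t', 0 < `|t' - t| < e -> ok t'.
have good_near t e : 0 < e -> (forall t', 0 < `|t' - t| < e -> ok t') ->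
    forall t', 0 < `|t' - t| < e -> good t'.
  move=> e0 te t' /andP[t'0 t'e].
  exists (Num.min `|t' - t| (e - `|t' - t|)).
    by rewrite lt_min t'0 subr_gt0.
  move=> t'' /andP[_]; rewrite lt_min => /andP[h1 h2]; apply: te; apply/andP; split.
    rewrite normr_gt0; apply/eqP => tt; move: h1.
    by rewrite (subr0_eq tt) distrC ltxx.
  rewrite (_ : t'' - t = (t'' - t') + (t' - t)); last by ring.
  by rewrite (le_lt_trans (ler_normD _ _))// -ltrBrDr.
pose S := [set t | 0 <= t /\ forall t', 0 <= t' <= t -> good t'].
have i0 : rintegrable mu D (laplace_fun w u 0) by apply: (Z0 0 _).1; rewrite normr0.
have ok0 t' : 0 < `|t' - 0| < t0 -> ok t'.
  by rewrite subr0 => /andP[_ /Z0].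
have good0 : good 0 by exists t0.
have S0 : S 0.
  by split=> // t' /andP[h1 h2]; have -> : t' = 0 by apply/eqP; rewrite eq_le h1 h2.
have Sub : ubound S tmax.
  move=> t [t_0 tg]; rewrite leNgt; apply/negP => tm.
  have [e e0 te] := tg t ltac:(rewrite t_0 lexx//).
  have [it _] := te (t + e / 2) ltac:(rewrite addrC addKr gtr0_norm; [apply/andP; split; lra|lra]).
  apply: ndiv; apply: (laplace_between mD mw mu_ w0 _ i0 it).
  by rewrite tmax0; lra.
have hS : has_sup S by split; [exists 0|exists tmax].
pose t := sup S.
have St a : 0 <= a -> a < t -> good a.
  move=> a0 at_; have [s Ss as_] := sup_adherent (ltac:(lra) : 0 < t - a) hS.
  have {}as_ : a < s by rewrite /t in as_ *; lra.
  by apply: Ss.2; rewrite a0 ltW.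
have t_gt0 : 0 < t.
  have : S (t0 / 2).
    split=> [|t' /andP[h1 h2]]; first by rewrite divr_ge0 ?ltW.
    have [->//|t'0] := eqVneq t' 0.
    by apply: (good_near _ _ t00 ok0); rewrite subr0 normr_gt0 t'0 ger0_norm//; lra.
  by move=> /(sup_upper_bound hS); rewrite -/t; lra.
have [b [r [r0 hb]]] := rem t t_gt0.
(* The possibly wrong value of Zr at t is replaced by the constant coefficient, so that the
   expansion also holds at 0. *)
pose h s := if s == 0 then b 0%N else Zr (t + s).
have hbh a : `|a| < r -> (fun N => \sum_(k < N) b k * a ^+ k) @ \oo --> h a.
  move=> ar; rewrite /h; case: eqVneq => [->|a0]; last by apply: hb; rewrite normr_gt0 a0.
  apply: cvg_near_cst; exists 1%N => // -[//|N] _ /=.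
  rewrite big_ord_recl big1 ?expr0 ?mulr1 ?addr0// => i _.
  by rewrite expr0n /= mulr0.
have [|r' r'0 step] := landau_step t_gt0 r0 i0 hbh.
  move=> e e0; pose e1 := Num.min e t.
  have [e10 e1e e1t] : [/\ 0 < e1, e1 <= e & e1 <= t].
    by rewrite /e1 lt_min e0 t_gt0 !ge_min !lexx orbT.
  have [e2 e20 ge2] := St (t - e1 / 2) ltac:(lra) ltac:(lra).
  pose e3 := Num.min e2 (e1 / 2) / 2.
  have m0 : 0 < Num.min e2 (e1 / 2) by rewrite lt_min e20; lra.
  have e30 : 0 < e3 by rewrite /e3; lra.
  have [e3e2 e3e1] : e3 < e2 /\ e3 < e1 / 2.
    have : e3 < Num.min e2 (e1 / 2) by rewrite /e3; lra.
    by rewrite lt_min => /andP[].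
  (* The extra shift e3 avoids the centre t - e1 / 2, about which [good] says nothing. *)
  exists (e1 / 2 + e3).
  have [i1 i2] : ok (t - (e1 / 2 + e3)).
    apply: ge2; rewrite (_ : _ - _ = - e3); last by ring.
    by rewrite normrN gtr0_norm// e30 e3e2.
  split=> //; [lra|lra|].
  rewrite -i2 /h; case: eqVneq => // /eqP; rewrite oppr_eq0 => /eqP; lra.
have okt t' : 0 < `|t' - t| < r' -> ok t'.
  move=> /andP[h1 /step]; rewrite (_ : t + (t' - t) = t'); last by ring.
  move=> [i1 i2]; split=> //; rewrite i2 /h -normr_eq0 gt_eqF//.
  by congr Zr; ring.
have : S (t + r' / 2).
  split=> [|t' /andP[h1 h2]]; first by lra.
  have [lt|gt|->] := ltrgtP t' t; [exact: St| |by exists r'].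
  by apply: (good_near _ _ r'0 okt); rewrite gtr0_norm ?subr_gt0//; lra.
by move=> /(sup_upper_bound hS); rewrite -/t; lra.
Qed.

End Landau.

(** * Poles of meromorphic functions on the real line *)

Section Cabs.
Context {R : realType}.
Implicit Types z : R[i].

Lemma cabsE z : (cabs z : R)%:C = `|z|.
Proof. by rewrite normc_def. Qed.

Lemma cabsM (x y : R[i]) : cabs (x * y) = cabs x * cabs y.
Proof. by apply: complexI; rewrite rmorphM /= !cabsE normrM. Qed.

Lemma cabsV z : @cabs R (z^-1) = (cabs z)^-1.
Proof. by apply: complexI; rewrite fmorphV /= !cabsE normfV. Qed.

Lemma cabsD (x y : R[i]) : cabs (x + y) <= cabs x + cabs y.
Proof. by rewrite -lecR rmorphD /= !cabsE ler_normD. Qed.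

Lemma cabs_ge0 z : 0 <= cabs z.
Proof. exact: sqrtr_ge0. Qed.

Lemma cabs0 : cabs (0 : R[i]) = 0.
Proof. by apply: complexI; rewrite cabsE normr0. Qed.

Lemma cabs_eq0 z : (cabs z == 0) = (z == 0).
Proof.
apply/eqP/eqP => [c0|->]; last exact: cabs0.
by apply/eqP; rewrite -normr_eq0 -cabsE c0 rmorph0.
Qed.

Lemma cabs_real (x : R) : cabs (x%:C : R[i]) = `|x|.
Proof. by rewrite /cabs /= expr0n /= addr0 sqrtr_sqr. Qed.

Lemma Re_le_cabs z : `|complex.Re z| <= cabs z.
Proof. by rewrite -lecR cabsE normc_ge_Re. Qed.

Lemma ReD x y : complex.Re (x + y) = complex.Re x + complex.Re y :> R.
Proof. by case: x; case: y. Qed.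

Lemma ReN x : complex.Re (- x) = - complex.Re x :> R.
Proof. by case: x. Qed.

Lemma Re_sum I (s : seq I) (F : I -> R[i]) :
  complex.Re (\sum_(i <- s) F i) = \sum_(i <- s) complex.Re (F i).
Proof.
elim: s => [|i s IH]; first by rewrite !big_nil.
by rewrite !big_cons ReD IH.
Qed.

Lemma ReMr (z : R[i]) (x : R) : complex.Re (z * x%:C) = complex.Re z * x.
Proof. by case: z => a b; simpc. Qed.

End Cabs.

Section Poles.
Context {R : realType}.
Implicit Types (Z h : R[i] -> R[i]) (s : R[i]).

(** When h vanishes at s its constant coefficient is 0, and h / (z - s), completed by [a 1%N] at s,
    is the sum of the shifted series. *)
Lemma laurent_reduce m Z h s : laurent_at m.+1 Z h s -> h s = 0 ->
  exists h', laurent_at m Z h' s.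
Proof.
move=> [[a [r [r0 ha]]] [r' r'0 hZ]] hs0.
have a0 : a 0%N = 0.
  have := ha s; rewrite subrr cabs0 => /(_ r0); rewrite -cvg_shiftS.
  have E N : cabs (\sum_(k < N.+1) a k * 0 ^+ k - h s) = cabs (a 0%N).
    rewrite hs0 subr0 big_ord_recl expr0 mulr1 big1 ?addr0// => i _.
    by rewrite expr0n /= mulr0.
  under eq_fun do rewrite E.
  move=> cv; apply/eqP; rewrite -cabs_eq0; apply/eqP.
  by apply: (cvg_unique _ (cvg_cst (cabs (a 0%N))) cv).
pose h' z := if z == s then a 1%N else h z / (z - s).
exists h'; split.
  exists (fun k => a k.+1), r; split=> // z zr; rewrite /h'.
  case: eqVneq => [->|zs].
    apply: cvg_near_cst; exists 1%N => // -[//|N] _ /=.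
    rewrite subrr big_ord_recl expr0 mulr1 big1 ?addr0 ?subrr ?cabs0//.
    by move=> i _; rewrite expr0n /= mulr0.
  have zs0 : z - s != 0 by rewrite subr_eq0.
  have := ha z zr; rewrite -cvg_shiftS => cv.
  have E N : cabs (\sum_(k < N) a k.+1 * (z - s) ^+ k - h z / (z - s)) =
    (cabs (z - s))^-1 * cabs (\sum_(k < N.+1) a k * (z - s) ^+ k - h z).
    rewrite big_ord_recl a0 mul0r add0r -cabsV -cabsM mulrBr mulr_sumr.
    congr (cabs (_ - _)); last by rewrite mulrC.
    apply: eq_bigr => i _; rewrite /= /bump add1n exprS.
    by rewrite mulrCA mulKf.
  rewrite -[X in _ --> X](mulr0 ((cabs (z - s))^-1)).
  by under eq_fun do rewrite E; exact: cvgMr.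
exists r' => // z zr; rewrite hZ// /h'.
have zs0 : z - s != 0 by rewrite -cabs_eq0 gt_eqF//; case/andP: zr.
by rewrite -subr_eq0 (negbTE zs0) exprS invfM mulrA.
Qed.

(** The order m given by [meromorphic] may be too large; it is lowered as long as h vanishes at
    s. *)
Lemma meromorphic_dichotomy Z s : meromorphic Z ->
  pole Z s \/ exists h, laurent_at 0 Z h s.
Proof.
move=> /(_ s) [m [h hZ]]; elim: m h hZ => [|m IH] h hZ; first by right; exists h.
have [hs|hs] := eqVneq (h s) 0; first by have [h' /IH] := laurent_reduce hZ hs.
by left; exists m.+1, h.
Qed.

(** The two values e = 1 and e = -1 cover both half-lines. Increments along the real axis are real,
    so real parts are taken coefficient by coefficient. *)
Lemma removable_Re Z (e t : R) : `|e| = 1 -> meromorphic Z ->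
  ~ pole Z (e * t)%:C -> removable (fun t => complex.Re (Z (e * t)%:C)) t.
Proof.
move=> e1 mZ np; case: (meromorphic_dichotomy (e * t)%:C mZ) => // -[h].
move=> [[a [r [r0 ha]]] [r' r'0 hZ]].
exists (fun k => complex.Re (a k) * e ^+ k), (Num.min r r').
split=> [|s /andP[s0]]; first by rewrite lt_min r0.
rewrite lt_min => /andP[sr sr'].
have zE : (e * (t + s))%:C - (e * t)%:C = (e * s)%:C :> R[i].
  by rewrite -rmorphB /= mulrDr addrC addKr.
have cE : cabs ((e * (t + s))%:C - (e * t)%:C) = `|s|.
  by rewrite zE cabs_real normrM e1 mul1r.
rewrite hZ ?cE ?s0// expr0 divr1.
have := ha (e * (t + s))%:C; rewrite cE => /(_ sr) cv.
apply/cvgrPdistC_le => d d0.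
move/cvgrPdistC_le : cv => /(_ d d0); apply: filterS => N.
rewrite subr0 ger0_norm ?cabs_ge0//; apply: le_trans.
apply: le_trans (Re_le_cabs _); rewrite ReD ReN Re_sum zE le_eqVlt.
apply/orP; left; apply/eqP; congr `| _ - _ |; apply: eq_bigr => k _.
by rewrite -rmorphXn /= ReMr exprMn mulrA.
Qed.

End Poles.

(** * Absolute values on local fields *)

(* [av] is multiplicative but satisfies the triangle inequality only up to the
   factor [av_cst], uniformly in the number of terms; this avoids proving that
   the p-adic modulus is ultrametric. *)
Record good_abs (R : realType) (K : local_field R) := GoodAbs {
  av : K -> R ;
  av_deg : nat ;
  av_cst : R ;
  av_pi : K ;
  av_deg_gt0 : (0 < av_deg)%N ;
  av_cst_ge1 : 1 <= av_cst ;
  av_ge0 : forall x, 0 <= av x ;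
  av_eq0 : forall x, av x = 0 -> x = 0 ;
  avM : forall x y, av (x * y) = av x * av y ;
  modulusE : forall x, modulus x = av x ^+ av_deg ;
  av_sum : forall (I : Type) (s : seq I) (F : I -> K),
    av (\sum_(i <- s) F i) <= av_cst * \sum_(i <- s) av (F i) ;
  av_pi_gt0 : 0 < av av_pi ;
  av_pi_lt1 : av av_pi < 1 ;
  av_cover : exists F : seq K, forall x, av x <= 1 ->
    exists2 y, y \in F & av (x - y) <= av av_pi ;
  unit_box_closed : forall n, modulus_open (~` @unit_box R K n) ;
  unit_box_bounded : exists M : R, forall n (x : affine K n),
    @unit_box R K n x -> forall i, av (x 0 i) <= M
}.

(** * The real and complex fields *)

Section RealComplex.
Context (R : realType).

Lemma good_abs_real : good_abs (@RealField R).
Proof.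
apply: (@GoodAbs R RealField (fun x : R => `|x|) 1 1 (2^-1 : R)) => //=.
- by move=> x /eqP; rewrite normr_eq0 => /eqP.
- by move=> x y; rewrite normrM.
- by move=> I s F; rewrite mul1r; exact: ler_norm_sum.
- by rewrite gtr0_norm ?invr_gt0.
- by rewrite gtr0_norm ?invr_gt0 ?ltr0n// invf_lt1 ?ltr1n.
- exists [:: 2^-1; - 2^-1 : R] => x; rewrite ler_norml => /andP[x1 x2].
  have [x0|x0] := leP 0 x; [exists 2^-1|exists (- 2^-1)]; rewrite ?inE ?eqxx ?orbT//.
    by rewrite (gtr0_norm (_ : 0 < 2^-1)) ?invr_gt0// ler_norml; apply/andP; split; lra.
  by rewrite (gtr0_norm (_ : 0 < 2^-1)) ?invr_gt0// ler_norml; apply/andP; split; lra.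
- move=> n x /= /existsNP[i /negP].
  rewrite negb_and -!ltNge => /orP[xi|xi].
    exists (- x 0 i : R); first by rewrite oppr_gt0.
    move=> y /(_ i) /=; rewrite ltr_norml => /andP[_ yx] /(_ i) /andP[y0 _].
    by move: yx y0; move: (y 0 i) (x 0 i) xi => /= a b xi yx y0; lra.
  exists (x 0 i - 1 : R); first by rewrite subr_gt0.
  move=> y /(_ i) /=; rewrite ltr_norml => /andP[yx _] /(_ i) /andP[_ y1].
  by move: yx y1; move: (y 0 i) (x 0 i) xi => /= a b xi yx y0; lra.
- exists 1 => n x xb i; have /andP[h1 h2] := xb i.
  by rewrite ger0_norm.
Qed.

Lemma Re_Im_lt (z : R[i]) (e : R) :
  complex.Re z ^+ 2 + complex.Im z ^+ 2 < e ^+ 2 -> 0 <= e ->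
  `|complex.Re z| < e /\ `|complex.Im z| < e.
Proof.
case: z => a b /= h e0; split; rewrite -(@ltr_pXn2r _ 2)// ?nnegrE// real_normK ?num_real//.
  by apply: le_lt_trans h; rewrite lerDl sqr_ge0.
by apply: le_lt_trans h; rewrite lerDr sqr_ge0.
Qed.

Lemma cabs_le_ReIm (z : R[i]) : cabs z <= `|complex.Re z| + `|complex.Im z|.
Proof.
case: z => a b; rewrite /cabs /= -(@ler_pXn2r _ 2)// ?nnegrE ?sqrtr_ge0 ?addr_ge0//.
rewrite sqr_sqrtr ?addr_ge0 ?sqr_ge0// sqrrD !real_normK ?num_real//.
by rewrite addrAC lerDl mulrn_wge0// mulr_ge0.
Qed.

(** An error of 1/4 in the real and in the imaginary part gives at most 1/2 for a complex number,
    and 1/2 is the [av_pi] chosen for the complex field. *)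
Lemma quarter_grid (x : R) : `|x| <= 1 ->
  exists2 y, y \in [:: - (3 / 4); - (1 / 4); 1 / 4; 3 / 4 : R] & `|x - y| <= 4^-1.
Proof.
rewrite ler_norml => /andP[x1 x2].
have [h1|h1] := leP x (- 2^-1).
  exists (- (3 / 4)); first by rewrite !inE eqxx.
  by rewrite ler_norml; apply/andP; split; lra.
have [h2|h2] := leP x 0.
  exists (- (1 / 4)); first by rewrite !inE eqxx orbT.
  by rewrite ler_norml; apply/andP; split; lra.
have [h3|h3] := leP x 2^-1.
  exists (1 / 4); first by rewrite !inE eqxx !orbT.
  by rewrite ler_norml; apply/andP; split; lra.
exists (3 / 4); first by rewrite !inE eqxx !orbT.
by rewrite ler_norml; apply/andP; split; lra.
Qed.

Lemma good_abs_complex : good_abs (@ComplexField R).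
Proof.
have half : cabs ((2^-1 : R)%:C : R[i]) = 2^-1 by rewrite cabs_real gtr0_norm ?invr_gt0.
have ReB (x y : R[i]) : complex.Re (x - y) = complex.Re x - complex.Re y.
  by case: x y => a b [].
have ImB (x y : R[i]) : complex.Im (x - y) = complex.Im x - complex.Im y.
  by case: x y => a b [].
have Im_le (z : R[i]) : `|complex.Im z| <= cabs z.
  case: z => a b; rewrite /cabs /= -(@ler_pXn2r _ 2)// ?nnegrE ?sqrtr_ge0//.
  by rewrite sqr_sqrtr ?addr_ge0 ?sqr_ge0// real_normK ?num_real// lerDr sqr_ge0.
apply: (@GoodAbs R ComplexField (@cabs R) 2 1 ((2^-1 : R)%:C : R[i])) => //=.
- exact: cabs_ge0.
- by move=> x /eqP; rewrite cabs_eq0 => /eqP.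
- exact: cabsM.
- by move=> x; rewrite /cabs sqr_sqrtr// addr_ge0// sqr_ge0.
- move=> I s F; rewrite mul1r; elim: s => [|i s IH].
    by rewrite !big_nil cabs0.
  by rewrite !big_cons; apply: le_trans (cabsD _ _) _; rewrite lerD2l.
- by rewrite half invr_gt0.
- by rewrite half invf_lt1 ?ltr1n.
- pose g : seq R := [:: - (3 / 4); - (1 / 4); 1 / 4; 3 / 4].
  exists [seq Complex a b | a <- g, b <- g] => x x1.
  have [a ag xa] := quarter_grid (le_trans (Re_le_cabs x) x1).
  have [b bg xb] := quarter_grid (le_trans (Im_le x) x1).
  exists (Complex a b); first exact: allpairs_f.
  rewrite half; apply: le_trans (cabs_le_ReIm _) _.
  by rewrite ReB ImB /=; move: xa xb; set p := `|_|; set q := `|_|; lra.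
- move=> n x /= /existsNP[j].
  have key (e : R) : 0 < e -> (forall z : R[i], `|complex.Re z - complex.Re (x 0 j)| < e ->
      `|complex.Im z - complex.Im (x 0 j)| < e ->
      ~ (0 <= complex.Re z <= 1 /\ 0 <= complex.Im z <= 1)) ->
      exists2 e : R, 0 < e & @polydisc R ComplexField n x e `<=` ~` @unit_box R ComplexField n.
    move=> e0 he; exists (e ^+ 2); first by rewrite exprn_gt0.
    move=> y /(_ j) /= /Re_Im_lt/(_ (ltW e0)); rewrite ReB ImB => -[h1 h2] /(_ j).
    exact: he.
  move=> /not_andP[/negP|/negP]; rewrite negb_and -!ltNge => /orP[xi|xi].
  + apply: (key (- complex.Re (x 0 j))); first by rewrite oppr_gt0.
    by move=> z; rewrite ltr_norml => /andP[_ h] _ [/andP[? _] _]; lra.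
  + apply: (key (complex.Re (x 0 j) - 1)); first by rewrite subr_gt0.
    by move=> z; rewrite ltr_norml => /andP[h _] _ [/andP[_ ?] _]; lra.
  + apply: (key (- complex.Im (x 0 j))); first by rewrite oppr_gt0.
    by move=> z _; rewrite ltr_norml => /andP[_ h] [_ /andP[? _]]; lra.
  + apply: (key (complex.Im (x 0 j) - 1)); first by rewrite subr_gt0.
    by move=> z _; rewrite ltr_norml => /andP[h _] [_ /andP[_ ?]]; lra.
- exists 2 => n x xb i; have [/andP[h1 h2] /andP[h3 h4]] := xb i.
  by apply: le_trans (cabs_le_ReIm _) _; rewrite !ger0_norm//; lra.
Qed.

End RealComplex.

Lemma expr_small (R : realType) (q e : R) : 0 <= q -> q < 1 -> 0 < e ->
  exists n, q ^+ n < e.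
Proof.
move=> q0 q1 e0; have : (fun n => q ^+ n) @ \oo --> (0 : R).
  by apply: cvg_expr; rewrite ger0_norm.
move=> /cvgrPdistC_lt/(_ e e0)[N _ /(_ N (leqnn N))] /=.
by rewrite subr0 ger0_norm ?exprn_ge0// => ?; exists N.
Qed.

(** * p-adic numbers: residues, finite nets, determinants *)

Section PadicNumbers.
Context {R : realType} {p : nat} {Qp : padic_numbers R p}.
Local Notation F := (padic_field Qp).
Local Notation pa := (@padic_abs R p Qp).
Implicit Types x y : F.
Local Notation q := (p%:R^-1 : R).

Lemma padic_q_gt0 : 0 < q.
Proof. by rewrite invr_gt0 ltr0n prime_gt0// (padic_prime Qp). Qed.

Lemma padic_q_lt1 : q < 1.
Proof.
by rewrite invf_lt1 ?ltr1n ?ltr0n ?prime_gt1 ?prime_gt0 ?(padic_prime Qp).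
Qed.

Lemma padic_abs0 : pa 0 = 0. Proof. exact/padic_abs_eq0. Qed.

Lemma padic_abs1 : pa 1 = 1.
Proof.
have h : pa 1 != 0.
  by apply/eqP => /padic_abs_eq0 /eqP; rewrite oner_eq0.
by apply: (mulfI h); rewrite -padic_absM !mulr1.
Qed.

Lemma padic_absX x n : pa (x ^+ n) = pa x ^+ n.
Proof.
by elim: n => [|n IH]; rewrite ?expr0 ?padic_abs1// !exprS padic_absM IH.
Qed.

Lemma padic_absN x : pa (- x) = pa x.
Proof.
rewrite -mulN1r padic_absM.
suff -> : pa (-1) = 1 by rewrite mul1r.
have : pa (-1) ^+ 2 = 1 by rewrite -padic_absX sqrrN expr1n padic_abs1.
by move/eqP; rewrite sqrp_eq1 ?padic_abs_ge0// => /eqP.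
Qed.

Lemma padic_absD_le x y (B : R) : pa x <= B -> pa y <= B -> pa (x + y) <= B.
Proof. by move=> xB yB; apply: le_trans (padic_absD _ _) _; rewrite ge_max xB. Qed.

Lemma padic_absB_le x y (B : R) : pa x <= B -> pa y <= B -> pa (x - y) <= B.
Proof. by move=> xB yB; apply: padic_absD_le; rewrite ?padic_absN. Qed.

Lemma padic_abs_sum I (s : seq I) (P : pred I) (G : I -> F) (B : R) : 0 <= B ->
  (forall i, P i -> pa (G i) <= B) -> pa (\sum_(i <- s | P i) G i) <= B.
Proof.
move=> B0 GB; apply: (big_ind (fun x => pa x <= B)) => //.
  by rewrite padic_abs0.
by move=> x y; exact: padic_absD_le.
Qed.

Lemma padic_abs_prod I (s : seq I) (G : I -> F) :
  pa (\prod_(i <- s) G i) = \prod_(i <- s) pa (G i).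
Proof.
by elim: s => [|i s IH]; rewrite ?big_nil ?padic_abs1// !big_cons padic_absM IH.
Qed.

Lemma padic_abs_nat n : pa n%:R <= 1.
Proof.
elim: n => [|n IH]; first by rewrite padic_abs0.
by rewrite -natr1; apply: padic_absD_le => //; rewrite padic_abs1.
Qed.

Lemma padic_abs_pX k : pa (p%:R ^+ k) = q ^+ k.
Proof. by rewrite padic_absX padic_abs_p. Qed.

(** If |n| < 1, a Bezout relation u n - v p = 1 would give |1| < 1. *)
Lemma padic_abs_coprime n : ~~ (p %| n)%N -> pa n%:R = 1.
Proof.
move=> pn; apply/eqP; rewrite eq_le padic_abs_nat /= leNgt; apply/negP => n1.
have n0 : (0 < n)%N by rewrite lt0n; apply: contra pn => /eqP ->; rewrite dvdn0.
have /eqP cop : coprime n p.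
  by rewrite coprime_sym prime_coprime// (padic_prime Qp).
case: (egcdnP p n0) => u v uv _.
have E : u%:R * n%:R - v%:R * p%:R = 1 :> F.
  by rewrite -!natrM uv cop natrD addrC addKr.
pose B := Num.max (pa n%:R) q.
have B1 : B < 1 by rewrite /B gt_max n1 padic_q_lt1.
have : pa 1 <= B.
  have c1 (m : nat) x : pa (m%:R * x) <= pa x.
    by rewrite padic_absM ler_piMl ?padic_abs_ge0 ?padic_abs_nat.
  rewrite -E; apply: padic_absB_le; apply: le_trans (c1 _ _) _.
    by rewrite le_max lexx.
  by rewrite padic_abs_p le_max lexx orbT.
by rewrite padic_abs1 leNgt B1.
Qed.

Lemma padic_abs_int (m : int) : pa m%:~R <= 1.
Proof.
by case: m => n; rewrite ?NegzE ?mulrNz ?padic_absN; exact: padic_abs_nat.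
Qed.

Lemma padic_absV x : pa x^-1 = (pa x)^-1.
Proof.
have [->|x0] := eqVneq x 0; first by rewrite invr0 padic_abs0 invr0.
have ax : pa x != 0 by apply: contra x0 => /eqP/padic_abs_eq0 ->.
by apply: (mulfI ax); rewrite -padic_absM !divff// padic_abs1.
Qed.

Lemma padic_abs_nat_gt0 n : (0 < n)%N -> 0 < pa n%:R.
Proof.
have pP := padic_prime Qp; move=> /(pfactor_coprime pP)[m cop ->].
rewrite natrM natrX padic_absM padic_abs_coprime; last by rewrite -prime_coprime.
by rewrite mul1r padic_abs_pX exprn_gt0// padic_q_gt0.
Qed.

(** A rational r close to x also satisfies |r| <= 1, so its denominator is prime to p; i is the
    numerator times the inverse of the denominator, reduced modulo p. *)
Lemma padic_unit_cover x : pa x <= 1 -> exists i : 'I_p, pa (x - i%:R) <= q.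
Proof.
move=> x1; have [r xr] := padic_dense x padic_q_gt0.
have r1 : pa (ratr r) <= 1.
  rewrite (_ : ratr r = x - (x - ratr r)); last by rewrite opprB addrC subrK.
  by apply: padic_absB_le => //; rewrite (le_trans (ltW xr))// ltW// padic_q_lt1.
have pP := padic_prime Qp.
pose d := `|denq r|%N.
have dE : (denq r)%:~R = d%:R :> F.
  by rewrite -[in LHS](gtz0_abs (denq_gt0 r)).
have dp : ~~ (p %| d)%N.
  apply/negP => pd.
  have nP : ~~ (p %| `|numq r|)%N.
    apply/negP => pn; have := coprime_num_den r; rewrite /coprime => /eqP g1.
    have : (p %| gcdn `|numq r| d)%N by rewrite dvdn_gcd pn.
    by rewrite g1 dvdn1 => /eqP pp; move: pP; rewrite pp.
  have n1 : pa (numq r)%:~R = 1.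
    by case: (numq r) nP => n /= nP; rewrite ?NegzE ?mulrNz ?padic_absN; exact: padic_abs_coprime.
  have d0 : 0 < pa d%:R.
    by apply: padic_abs_nat_gt0; rewrite absz_gt0 denq_eq0.
  move: r1; rewrite /ratr padic_absM n1 mul1r padic_absV dE invf_le1//.
  apply/negP; rewrite -ltNge; case/dvdnP: pd => k ->.
  rewrite natrM padic_absM padic_abs_p (le_lt_trans _ padic_q_lt1)//.
  by rewrite ler_piMl ?padic_abs_nat// ltW// padic_q_gt0.
have dn0 : (0 < d)%N by rewrite absz_gt0 denq_eq0.
have /eqP cop : coprime d p by rewrite coprime_sym prime_coprime.
case: (egcdnP p dn0) => u v uv _; rewrite cop in uv.
have p0 : (p%:Z != 0) by rewrite eqz_nat -lt0n prime_gt0.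
pose m := (numq r * u%:Z)%R.
have m0 : (0 <= (m %% p%:Z)%Z)%R by exact: modz_ge0.
have mp : (`|(m %% p%:Z)%Z| < p)%N.
  by rewrite -ltz_nat gez0_abs// ltz_pmod// ltz_nat prime_gt0.
exists (Ordinal mp) => /=.
set i := `|_|%N.
have iE : i%:R = (m %% p%:Z)%Z%:~R :> F by rewrite -[in RHS](gez0_abs m0).
have rE : ratr r = (numq r)%:~R / d%:R :> F by rewrite /ratr dE.
rewrite (_ : x - i%:R = (x - ratr r) + (ratr r - i%:R)); last by rewrite addrA subrK.
apply: padic_absD_le; first exact: ltW.
have d1 := padic_abs_coprime dp.
have d0 : d%:R != 0 :> F.
  by apply/eqP => d0; move: d1; rewrite d0 padic_abs0 => /eqP; rewrite eq_sym oner_eq0.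
have -> : ratr r - i%:R = ((numq r)%:~R - i%:R * d%:R) / d%:R :> F.
  by rewrite rE mulrBl mulfK.
rewrite padic_absM padic_absV d1 invr1 mulr1.
(* Substituting u d = v p + 1 into the division of [numq r * u] by p exhibits the multiple of p. *)
pose c : int := ((m %/ p%:Z)%Z * d%:Z - numq r * v%:Z)%R.
have -> : (numq r)%:~R - i%:R * d%:R = c%:~R * p%:R :> F.
  have mE : ((numq r)%:~R * u%:R : F) = (m %/ p%:Z)%Z%:~R * p%:R + i%:R.
    by rewrite iE -[u%:R]/(u%:Z%:~R) -intrM -/m {1}(divz_eq m p) intrD intrM.
  have uE : u%:R * d%:R = v%:R * p%:R + 1 :> F by rewrite -!natrM natr1 uv addn1.
  rewrite /c intrB !intrM.
  have nE : (numq r)%:~R = ((m %/ p%:Z)%Z%:~R * p%:R + i%:R) * d%:R -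
      (numq r)%:~R * (v%:R * p%:R) :> F.
    by rewrite -mE -mulrA -mulrBr uE addrC addKr mulr1.
  rewrite [in LHS]nE.
  have -> : d%:Z%:~R = d%:R :> F by [].
  have -> : v%:Z%:~R = v%:R :> F by [].
  ring.
by rewrite padic_absM padic_abs_p ler_piMl ?padic_abs_int// ltW// padic_q_gt0.
Qed.

Lemma padic_cover k x : pa x <= q ^+ k ->
  exists i : 'I_p, pa (x - p%:R ^+ k * i%:R) <= q ^+ k.+1.
Proof.
move=> xk; have p0 : p%:R ^+ k != 0 :> F.
  apply/eqP => pk; have := padic_abs_pX k; rewrite pk padic_abs0 => /eqP.
  by rewrite eq_sym expf_eq0 gt_eqF ?padic_q_gt0// andbF.
have qk : 0 < q ^+ k by rewrite exprn_gt0// padic_q_gt0.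
have [|i xi] := @padic_unit_cover (x / p%:R ^+ k).
  by rewrite padic_absM padic_absV padic_abs_pX ler_pdivrMr// mul1r.
exists i; rewrite exprSr.
rewrite (_ : x - _ = p%:R ^+ k * (x / p%:R ^+ k - i%:R)); last first.
  by rewrite mulrBr mulrCA divff ?mulr1.
by rewrite padic_absM padic_abs_pX ler_wpM2l// ltW.
Qed.

(** Multiplication by p^j moves the ball into the unit ball, where l + j successive digits give the
    required precision. *)
Lemma padic_net (j l : nat) : exists s : seq F, forall x, pa x <= q ^- j ->
  exists2 y, y \in s & pa (x - y) <= q ^+ l.
Proof.
have [s sP] : exists s : seq F, forall x, pa x <= 1 ->
    exists2 y, y \in s & pa (x - y) <= q ^+ (l + j).
  elim: (l + j)%N => [|n [s sP]].
    by exists [:: 0] => x x1; exists 0; rewrite ?inE// subr0 expr0.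
  exists [seq y + p%:R ^+ n * (val i)%:R | y <- s, i <- enum 'I_p] => x /sP[y ys xy].
  have [i xi] := padic_cover xy; exists (y + p%:R ^+ n * (val i)%:R).
    by apply/allpairsP; exists (y, i); rewrite mem_enum.
  by rewrite opprD addrA.
have qj : 0 < q ^+ j by rewrite exprn_gt0// padic_q_gt0.
have p0 : p%:R ^+ j != 0 :> F.
  by apply/eqP => pk; have := padic_abs_pX j; rewrite pk padic_abs0 => /eqP; rewrite lt_eqF.
exists [seq y / p%:R ^+ j | y <- s] => x xj.
have [|y ys xy] := sP (x * p%:R ^+ j).
  by rewrite padic_absM padic_abs_pX -ler_pdivlMr// div1r.
exists (y / p%:R ^+ j); first exact: map_f.
rewrite (_ : x - _ = (x * p%:R ^+ j - y) / p%:R ^+ j); last by rewrite mulrBl mulfK.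
by rewrite padic_absM padic_absV padic_abs_pX ler_pdivrMr// -exprD.
Qed.

(** Telescoping, one factor at a time. The bound e M^(n-1) is written e / M * M^n to make sense for
    n = 0. *)
Lemma padic_abs_prod_sub (n : nat) (x y : 'I_n -> F) (M e : R) : 0 < M -> 0 <= e ->
  (forall i, pa (x i) <= M) -> (forall i, pa (y i) <= M) ->
  (forall i, pa (x i - y i) <= e) ->
  pa (\prod_i x i - \prod_i y i) <= e / M * M ^+ n.
Proof.
move=> M0 e0; elim: n x y => [|n IH] x y xM yM xy.
  by rewrite !big_ord0 subrr padic_abs0 mulr_ge0// divr_ge0// ltW.
have yP : pa (\prod_(i < n) y (lift ord0 i)) <= M ^+ n.
  rewrite padic_abs_prod; apply: (@le_trans _ _ (\prod_(i < n) M)).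
    by apply: ler_prod => i _; rewrite padic_abs_ge0 yM.
  by rewrite prodr_const card_ord.
rewrite !big_ord_recl; set X := \prod_(i < n) x _; set Y := \prod_(i < n) y _.
rewrite (_ : _ - _ = x ord0 * (X - Y) + (x ord0 - y ord0) * Y); last by ring.
have E : e / M * M ^+ n.+1 = e * M ^+ n by rewrite exprS mulrA divfK// gt_eqF.
rewrite E; apply: padic_absD_le; rewrite padic_absM.
  rewrite -E exprS mulrCA; apply: ler_pM => //; rewrite ?padic_abs_ge0//.
  by apply: IH.
by apply: ler_pM; rewrite ?padic_abs_ge0.
Qed.

Lemma padic_abs_sign (b : bool) : pa ((-1) ^+ b) = 1.
Proof. by case: b; rewrite ?expr1 ?expr0 ?padic_absN padic_abs1. Qed.

Lemma padic_det_sub n (A B : 'M[F]_n) (M e : R) : 0 < M -> 0 <= e ->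
  (forall i j, pa (A i j) <= M) -> (forall i j, pa (B i j) <= M) ->
  (forall i j, pa (A i j - B i j) <= e) ->
  pa (\det A - \det B) <= e / M * M ^+ n.
Proof.
move=> M0 e0 AM BM AB; rewrite /determinant -sumrB.
apply: padic_abs_sum => [|s _].
  by rewrite mulr_ge0 ?divr_ge0 ?exprn_ge0// ltW.
rewrite -mulrBr padic_absM padic_abs_sign mul1r.
exact: padic_abs_prod_sub.
Qed.

Lemma padic_det_le n (A : 'M[F]_n) (M : R) : 0 <= M ->
  (forall i j, pa (A i j) <= M) -> pa (\det A) <= M ^+ n.
Proof.
move=> M0 AM; apply: padic_abs_sum => [|s _]; first exact: exprn_ge0.
rewrite padic_absM padic_abs_sign mul1r padic_abs_prod.
apply: (@le_trans _ _ (\prod_(i < n) M)).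
  by apply: ler_prod => i _; rewrite padic_abs_ge0 AM.
by rewrite prodr_const card_ord.
Qed.

End PadicNumbers.

Lemma ffun_seq (T : eqType) (d : nat) (s : seq T) :
  exists S : seq {ffun 'I_d -> T}, size S = (size s ^ d)%N /\
    forall c : 'I_d -> T, (forall k, c k \in s) -> finfun c \in S.
Proof.
exists [seq [ffun k => tnth (in_tuple s) (phi k)] | phi : {ffun 'I_d -> 'I_(size s)} <- enum {ffun 'I_d -> 'I_(size s)}].
split; first by rewrite size_map -cardT card_ffun !card_ord.
move=> c cs.
have idx k : (index (c k) s < size s)%N by rewrite index_mem.
apply/mapP; exists [ffun k => Ordinal (idx k)]; first by rewrite mem_enum.
apply/ffunP => k; rewrite !ffunE (tnth_nth (c k)) /=.
by rewrite nth_index.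
Qed.

(** * The norm of a finite extension *)

Section FieldNorm.
Context {F : fieldType} {L : fieldExtType F}.
Implicit Types x y : L.

Definition mul_mx x : 'M[F]_(\dim {:L}) :=
  \matrix_(i, j) coord (vbasis {:L}) j (x * (vbasis {:L})`_i).

Lemma field_normE x : field_norm x = \det (mul_mx x).
Proof. by []. Qed.

Lemma vbasis_sum x : x = \sum_i coord (vbasis {:L}) i x *: (vbasis {:L})`_i.
Proof. by apply: coord_vbasis; exact: memvf. Qed.

Lemma coord_sum (c : 'I_(\dim {:L}) -> F) i :
  coord (vbasis {:L}) i (\sum_j c j *: (vbasis {:L})`_j) = c i.
Proof. by rewrite coord_sum_free// (basis_free (vbasisP _)). Qed.

Lemma mul_mxM x y : mul_mx (x * y) = mul_mx x *m mul_mx y.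
Proof.
apply/matrixP => i j; rewrite !mxE (mulrC x y) -mulrA.
rewrite [in LHS](vbasis_sum (x * _)) mulr_sumr linear_sum /=.
apply: eq_bigr => k _; rewrite !mxE.
by rewrite -scalerAr linearZ.
Qed.

Lemma mul_mx1 : mul_mx 1 = 1%:M.
Proof.
apply/matrixP => i j; rewrite !mxE mul1r coord_free// (basis_free (vbasisP _))//.
Qed.

Lemma field_normM x y : field_norm (x * y) = field_norm x * field_norm y.
Proof. by rewrite !field_normE mul_mxM det_mulmx. Qed.

Lemma field_norm1 : field_norm (1 : L) = 1.
Proof. by rewrite field_normE mul_mx1 det1. Qed.

Lemma field_norm_neq0 x : x != 0 -> field_norm x != 0.
Proof.
move=> x0; apply/eqP => nx; have := field_normM x x^-1.
by rewrite divff// nx mul0r field_norm1 => /eqP; rewrite oner_eq0.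
Qed.

Lemma field_normZ (c : F) x : field_norm (c *: x) = c ^+ \dim {:L} * field_norm x.
Proof.
rewrite !field_normE (_ : mul_mx (c *: x) = c *: mul_mx x) ?detZ//.
by apply/matrixP => i j; rewrite !mxE -scalerAl linearZ.
Qed.

Lemma mul_mxE x i j : mul_mx x i j =
  \sum_k coord (vbasis {:L}) k x * coord (vbasis {:L}) j ((vbasis {:L})`_k * (vbasis {:L})`_i).
Proof.
rewrite mxE {1}(vbasis_sum x) mulr_suml linear_sum /=.
by apply: eq_bigr => k _; rewrite -scalerAl linearZ.
Qed.

End FieldNorm.

Section PadicExtension.
Context {R : realType} {p : nat} {Qp : padic_numbers R p}.
Variable L : fieldExtType (padic_field Qp).
Local Notation F := (padic_field Qp).
Local Notation pa := (@padic_abs R p Qp).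
Local Notation q := (p%:R^-1 : R).
Local Notation d := (\dim {:L}).
Local Notation co := (coord (vbasis {:L})).
Local Notation nm x := (pa (field_norm x)).
Implicit Types x y : L.

(** The entries of [mul_mx x] are linear in the coordinates of x, with the structure constants of
    the basis as coefficients. *)
Lemma mul_mx_bound : exists2 B : R, 1 <= B & forall x (m : R),
  0 <= m -> (forall k, pa (co k x) <= m) -> forall i j, pa (mul_mx x i j) <= B * m.
Proof.
pose B := 1 + \sum_(t : 'I_d * 'I_d * 'I_d) pa (co t.2 ((vbasis {:L})`_t.1.1 * (vbasis {:L})`_t.1.2)).
have B1 : 1 <= B by rewrite lerDl sumr_ge0// => t _; exact: padic_abs_ge0.
exists B => // x m m0 xm i j; rewrite mul_mxE.
apply: padic_abs_sum => [|k _]; first by rewrite mulr_ge0// (le_trans ler01).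
rewrite padic_absM mulrC; apply: ler_pM; rewrite ?padic_abs_ge0//.
apply: (@le_trans _ _ (\sum_(t : 'I_d * 'I_d * 'I_d) pa (co t.2 ((vbasis {:L})`_t.1.1 * (vbasis {:L})`_t.1.2)))); last by rewrite lerDr.
rewrite (bigD1 (k, i, j)) //= lerDl sumr_ge0// => t _; exact: padic_abs_ge0.
Qed.

Lemma field_norm_upper : exists2 C : R, 0 < C & forall x (m : R),
  0 <= m -> (forall k, pa (co k x) <= m) -> nm x <= C * m ^+ d.
Proof.
have [B B1 hB] := mul_mx_bound; have B0 : 0 < B by apply: lt_le_trans B1.
exists (B ^+ d); first exact: exprn_gt0.
move=> x m m0 xm; rewrite -exprMn; apply: padic_det_le; last exact: hB.
by rewrite mulr_ge0// ltW.
Qed.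

Lemma field_norm_sub (m : R) : 0 < m -> exists2 C : R, 0 < C & forall x y (e : R),
  0 <= e -> (forall k, pa (co k x) <= m) -> (forall k, pa (co k y) <= m) ->
  (forall k, pa (co k (x - y)) <= e) -> pa (field_norm x - field_norm y) <= C * e.
Proof.
move=> m0; have [B B1 hB] := mul_mx_bound; have B0 : 0 < B by apply: lt_le_trans B1.
exists (B / (B * m) * (B * m) ^+ d).
  by rewrite mulr_gt0 ?exprn_gt0 ?divr_gt0 ?mulr_gt0.
move=> x y e e0 xm ym xy.
rewrite mulrC mulrA mulrA (mulrC e B); apply: padic_det_sub.
- exact: mulr_gt0.
- by rewrite mulr_ge0// ltW.
- by apply: hB => //; exact: ltW.
- by apply: hB => //; exact: ltW.
- move=> i j; have := hB (x - y) e e0 xy i j.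
  by rewrite [mul_mx (x - y) i j]mxE mulrBl linearB /= !mxE.
Qed.

(* Compactness of the unit sphere of [L], by bisection into smaller and
   smaller cosets of [p^k O]. *)
Lemma field_norm_lower_sphere : exists2 c : R, 0 < c & forall x,
  (forall k, pa (co k x) <= 1) -> (exists k, pa (co k x) = 1) -> c <= nm x.
Proof.
apply: contrapT => nc.
pose sph x := (forall k, pa (co k x) <= 1) /\ (exists k, pa (co k x) = 1).
(* Near y, up to q^n in each coordinate, the sphere has points of arbitrarily small norm. *)
pose bad (n : nat) y := forall e : R, 0 < e ->
  exists x, [/\ sph x, forall k, pa (co k (x - y)) <= q ^+ n & nm x < e].
have q0 := @padic_q_gt0 R p Qp; have q1 := @padic_q_lt1 R p Qp.
have qn0 n : 0 < q ^+ n by exact: exprn_gt0.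
have bad0 : bad 0%N 0.
  move=> e e0; apply: contrapT => nx; apply: nc; exists e => // x x1 x2.
  rewrite leNgt; apply/negP => xe; apply: nx; exists x; split=> // k.
  by rewrite subr0 expr0.
have step n y : bad n y -> exists y', bad n.+1 y' /\ forall k, pa (co k (y' - y)) <= q ^+ n.
  move=> bn; pose Y (phi : {ffun 'I_d -> 'I_p}) :=
    y + \sum_k (p%:R ^+ n * (phi k)%:R : F) *: (vbasis {:L})`_k.
  have coY phi k : co k (Y phi) = co k y + p%:R ^+ n * (phi k)%:R.
    by rewrite linearD /= coord_sum.
  (* Otherwise each of the finitely many smaller cosets has a positive lower bound, and the least of
     these bounds contradicts [bad n y]. *)
  apply: contrapT => ny.
  have /choice[e eP] : forall phi, exists e : R, 0 < e /\ forall x,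
      sph x -> (forall k, pa (co k (x - Y phi)) <= q ^+ n.+1) -> e <= nm x.
    move=> phi; apply: contrapT => ne; apply: ny; exists (Y phi); split.
      move=> e e0; apply: contrapT => nx; apply: ne; exists e; split=> // x sx xY.
      by rewrite leNgt; apply/negP => xe; apply: nx; exists x.
    move=> k; rewrite linearB /= coY addrC addKr padic_absM padic_abs_pX.
    by rewrite ler_piMr ?padic_abs_nat// ltW.
  have [x [sx xy xe]] := bn (\big[Num.min/1]_phi e phi)
     ltac:(apply: lt_bigmin => // phi _; exact: (eP phi).1).
  have /choice[phi phiP] : forall k, exists i : 'I_p,
      pa (co k (x - y) - p%:R ^+ n * i%:R) <= q ^+ n.+1.
    by move=> k; exact: padic_cover.
  have : e (finfun phi) <= nm x.
    apply: (eP _).2 => // k; rewrite opprD addrA linearB /= coord_sum.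
    by rewrite ffunE; exact: phiP.
  apply/negP; rewrite -ltNge; apply: lt_le_trans xe _.
  exact: bigmin_le_cond.
have /choice[g gP] : forall ny : nat * L, exists y', bad ny.1 ny.2 ->
    bad ny.1.+1 y' /\ forall k, pa (co k (y' - ny.2)) <= q ^+ ny.1.
  move=> [n y] /=; have [/step[y' h]|h] := pselect (bad n y); first by exists y'.
  by exists 0.
pose Y := nat_rect (fun=> L) 0 (fun n y => g (n, y)).
have badY n : bad n (Y n) by elim: n => [//|n IH]; exact: (gP (n, Y n) IH).1.
have Y_S n k : pa (co k (Y n.+1 - Y n)) <= q ^+ n by exact: (gP (n, Y n) (badY n)).2.
have qle n m : (n <= m)%N -> q ^+ m <= q ^+ n.
  by move=> nm; rewrite ler_wiXn2l// ltW.
have Y_D n m k : (n <= m)%N -> pa (co k (Y m - Y n)) <= q ^+ n.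
  elim: m => [|m IH]; first by rewrite leqn0 => /eqP ->; rewrite subrr linear0 padic_abs0 ltW.
  rewrite leq_eqVlt => /predU1P[->|nm]; first by rewrite subrr linear0 padic_abs0 ltW.
  rewrite (_ : Y m.+1 - Y n = (Y m.+1 - Y m) + (Y m - Y n)); last by rewrite addrA subrK.
  rewrite linearD; apply: padic_absD_le; last exact: IH.
  by apply: le_trans (Y_S _ _) _; exact: qle.
have /choice[l lP] : forall k, exists l, (fun n => pa (co k (Y n) - l)) @ \oo --> (0 : R).
  move=> k; apply: padic_complete => e e0; have [N qN] := expr_small (ltW q0) q1 e0.
  exists N => i j Ni Nj; apply: le_lt_trans qN.
  rewrite -linearB (_ : Y i - Y j = (Y i - Y N) - (Y j - Y N)); last by rewrite opprB addrA subrK.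
  by rewrite linearB; apply: padic_absB_le; apply: Y_D.
pose y := \sum_k l k *: (vbasis {:L})`_k.
have Yy n k : pa (co k (Y n - y)) <= q ^+ n.
  rewrite linearB /= coord_sum.
  have /cvgrPdistC_lt/(_ _ (qn0 n))[N _ hN] := lP k.
  have := hN (maxn N n) (leq_maxl _ _); rewrite /= subr0 ger0_norm ?padic_abs_ge0// => h.
  rewrite (_ : _ - _ = (co k (Y (maxn N n)) - l k) - co k (Y (maxn N n) - Y n)); last first.
    by rewrite linearB /=; ring.
  by apply: padic_absB_le; [exact: ltW|apply: Y_D; exact: leq_maxr].
have near_y n : exists x, [/\ sph x, forall k, pa (co k (x - y)) <= q ^+ n & nm x < q ^+ n].
  have [x [sx xY xn]] := badY n _ (qn0 n); exists x; split=> // k.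
  rewrite (_ : x - y = (x - Y n) + (Y n - y)); last by rewrite addrA subrK.
  by rewrite linearD; apply: padic_absD_le; [exact: xY|exact: Yy].
have y1 k : pa (co k y) <= 1.
  have [x [[x1 _] xy _]] := near_y 0%N.
  rewrite (_ : y = x - (x - y)); last by rewrite opprB addrC subrK.
  by rewrite linearB; apply: padic_absB_le; [exact: x1|rewrite -(expr0 q); exact: xy].
have y0 : y != 0.
  apply/eqP => y0; have [x [[_ [k xk]] xy _]] := near_y 1%N.
  have := xy k; rewrite y0 subr0 xk expr1 leNgt.
  by rewrite q1.
have ny0 : 0 < nm y.
  rewrite lt0r padic_abs_ge0 andbT; apply/eqP => /padic_abs_eq0/eqP.
  by apply/negP; exact: field_norm_neq0.
(* The norm is Lipschitz on the unit ball and takes values below q^n within q^n of y, so |N(y)| <=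
   (C + 1) q^n for all n, although y is nonzero. *)
have [C C0 hC] := field_norm_sub ltr01.
have C1 : 0 < C + 1 by rewrite addr_gt0.
have [n qn] := expr_small (ltW q0) q1 (divr_gt0 ny0 C1).
have [x [[x1 _] xy xn]] := near_y n.
have h1 := hC _ _ _ (ltW (qn0 n)) x1 y1 xy.
have : nm y <= (C + 1) * q ^+ n.
  rewrite (_ : field_norm y = field_norm x - (field_norm x - field_norm y)); last by rewrite opprB addrC subrK.
  apply: padic_absB_le.
    by apply: le_trans (ltW xn) _; rewrite ler_peMl ?ltW// ltrDr.
  by apply: le_trans h1 _; rewrite ler_wpM2r ?lerDl// ltW.
by apply/negP; rewrite -ltNge mulrC -ltr_pdivlMr// addr_gt0.
Qed.

(** By homogeneity: division by the coordinate of largest absolute value puts x on the unit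
    sphere. *)
Lemma field_norm_lower : exists2 C : R, 0 < C & forall x k,
  pa (co k x) ^+ d <= C * nm x.
Proof.
have [c c0 hc] := field_norm_lower_sphere; exists c^-1; first by rewrite invr_gt0.
move=> x k; have [m _ hm] := arg_maxP (fun i => pa (co i x)) (isT : xpredT k).
have [xm|xm] := eqVneq (co m x) 0.
  have xk : pa (co k x) <= 0 by have := hm k isT; rewrite xm padic_abs0.
  have -> : pa (co k x) = 0 by apply/eqP; rewrite eq_le xk padic_abs_ge0.
  by rewrite expr0n gtn_eqF ?adim_gt0// mulr_ge0 ?padic_abs_ge0// invr_ge0 ltW//.
have am0 : 0 < pa (co m x).
  by rewrite lt0r padic_abs_ge0 andbT; apply: contra xm => /eqP/padic_abs_eq0 ->.
apply: (@le_trans _ _ (pa (co m x) ^+ d)).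
  by apply: lerXn2r; rewrite ?nnegrE ?padic_abs_ge0//; exact: hm.
have xE : x = co m x *: ((co m x)^-1 *: x) by rewrite scalerA divff// scale1r.
have : c <= nm ((co m x)^-1 *: x).
  apply: hc => [i|]; last exists m; rewrite linearZ /= padic_absM padic_absV ?mulVf ?gt_eqF//.
  by rewrite ler_pdivrMl// mulr1; exact: hm.
have nE : nm x = pa (co m x) ^+ d * nm ((co m x)^-1 *: x).
  by rewrite {1}xE field_normZ padic_absM padic_absX.
by move=> h; rewrite nE mulrCA ler_peMr ?exprn_ge0 ?padic_abs_ge0// ler_pdivlMl// mulr1.
Qed.

(** The absolute value is the d-th root v of |N(x)|_p. It is multiplicative and, up to the constants
    D1 and D2, comparable with the largest absolute value of a coordinate, which is ultrametric;
    hence the constant D1 D2 for sums of any length. The constants come from existence statements in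
    [Prop], whence [inhabited]. *)
Lemma good_abs_padic : inhabited (good_abs (PadicField Qp L)).
Proof.
have [C1 C10 upper] := field_norm_upper; have [C2 C20 lower] := field_norm_lower.
have q0 := @padic_q_gt0 R p Qp; have q1 := @padic_q_lt1 R p Qp.
have d0 : (0 < d)%N := adim_gt0 _.
have dN0 : d%:R != 0 :> R by rewrite pnatr_eq0 -lt0n.
pose v (x : L) : R := nm x `^ (d%:R^-1).
have v_ge0 x : 0 <= v x by exact: powR_ge0.
have vX x : v x ^+ d = nm x.
  by rewrite -powR_mulrn// -powRrM mulVf// powRr1// padic_abs_ge0.
have vM x y : v (x * y) = v x * v y.
  by rewrite /v field_normM padic_absM powRM// padic_abs_ge0.
have v_eq0 x : v x = 0 -> x = 0.
  move=> vx; apply/eqP; apply: contraT => x0.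
  have := vX x; rewrite vx expr0n gtn_eqF// => /esym/padic_abs_eq0/eqP.
  by rewrite (negbTE (field_norm_neq0 x0)).
pose D1 := C1 `^ (d%:R^-1); pose D2 := C2 `^ (d%:R^-1).
have D1X : D1 ^+ d = C1 by rewrite -powR_mulrn ?powR_ge0// -powRrM mulVf// powRr1// ltW.
have D2X : D2 ^+ d = C2 by rewrite -powR_mulrn ?powR_ge0// -powRrM mulVf// powRr1// ltW.
have D1_ge0 : 0 <= D1 by exact: powR_ge0.
have D2_ge0 : 0 <= D2 by exact: powR_ge0.
have coord_le x k : pa (co k x) <= D2 * v x.
  rewrite -(@ler_pXn2r _ d)// ?nnegrE ?padic_abs_ge0 ?mulr_ge0//.
  by rewrite exprMn D2X vX.
have v_le x (m : R) : 0 <= m -> (forall k, pa (co k x) <= m) -> v x <= D1 * m.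
  move=> m0 xm; rewrite -(@ler_pXn2r _ d)// ?nnegrE ?mulr_ge0//.
  by rewrite exprMn D1X vX; exact: upper.
have cst1 : 1 <= Num.max 1 (D1 * D2) by rewrite le_max lexx.
pose pi : L := (p%:R : padic_field Qp)%:A.
have v_pi : v pi = q.
  apply/eqP; rewrite -(@eqrXn2 _ d)// ?(ltW q0)//.
  by rewrite vX field_normZ field_norm1 mulr1 padic_absX padic_abs_p.
(* An element whose coordinates are at most q^K satisfies v <= q. *)
have [K qK] : exists K : nat, D1 * q ^+ K <= q.
  have [|K h] := @expr_small R q (q / (D1 + 1)) (ltW q0) q1.
    by rewrite divr_gt0// ltr_wpDl.
  exists K; move: h; rewrite ltr_pdivlMr ?ltr_wpDl// mulrDr mulr1 mulrC => h.
  by apply: le_trans (ltW h); rewrite lerDl exprn_ge0// ltW.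
have net (j l : nat) : exists s : seq (padic_field Qp),
    forall x : padic_field Qp, pa x <= q ^- j -> exists2 y, y \in s & pa (x - y) <= q ^+ l.
  exact: padic_net.
have net_vec (s : seq (padic_field Qp)) : exists S : seq L,
    forall c : 'I_d -> padic_field Qp, (forall k, c k \in s) ->
      \sum_k c k *: (vbasis {:L})`_k \in S.
  have [S [_ SP]] := ffun_seq d s.
  exists [seq \sum_k f k *: (vbasis {:L})`_k | f : {ffun 'I_d -> padic_field Qp} <- S].
  move=> c cs; apply/mapP; exists (finfun c); first exact: SP.
  by apply: eq_bigr => k _; rewrite ffunE.
constructor.
apply: (@GoodAbs R (PadicField Qp L) v d (Num.max 1 (D1 * D2)) pi) => //.
- move=> I s G; apply: (@le_trans _ _ (D1 * (D2 * \sum_(i <- s) v (G i)))); last first.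
    by rewrite mulrA ler_wpM2r ?sumr_ge0// le_max lexx orbT.
  have S0 : 0 <= \sum_(i <- s) v (G i) by exact: sumr_ge0.
  apply: v_le => [|k]; first exact: mulr_ge0.
  rewrite linear_sum /=; elim: s S0 => [|i s IH] S0.
    by rewrite !big_nil padic_abs0 mulr0.
  rewrite !big_cons mulrDr; apply: padic_absD_le.
    by apply: le_trans (coord_le _ _) _; rewrite lerDl mulr_ge0// sumr_ge0.
  by apply: le_trans (IH _) _; rewrite ?sumr_ge0// lerDr mulr_ge0.
- by rewrite v_pi.
- by rewrite v_pi.
- have [j D2j] : exists j, D2 <= q ^- j.
    have [|j h] := @expr_small R q (D2 + 1)^-1 (ltW q0) q1.
      by rewrite invr_gt0 ltr_wpDl.
    exists j; apply: (@le_trans _ _ (D2 + 1)); first by rewrite lerDl.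
    by rewrite -[leLHS]invrK lef_pV2 ?posrE ?invr_gt0 ?exprn_gt0 ?ltr_wpDl// ltW.
  have [s sP] := net j K; have [S SP] := net_vec s.
  exists S; change (forall x : L, v x <= 1 -> exists2 y : L, y \in S & v (x - y) <= v pi) => x x1.
  have /choice[c cP] : forall k, exists y : padic_field Qp, y \in s /\ pa (co k x - y) <= q ^+ K.
    move=> k; have [|y ys yx] := sP (co k x); last by exists y.
    by apply: le_trans (coord_le _ _) _; apply: le_trans D2j; rewrite ler_piMr.
  exists (\sum_k c k *: (vbasis {:L})`_k); first by apply: SP => k; exact: (cP k).1.
  rewrite v_pi; apply: le_trans qK; apply: v_le => [|k]; first by rewrite exprn_ge0// ltW.
  by rewrite linearB /= coord_sum (cP k).2.
- move=> n x /= /existsNP[i0 /negP]; rewrite -ltNge /= => xi.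
  set z := x 0 i0 in xi; pose m := 1 + \sum_k pa (co k z).
  have S0 : 0 <= \sum_k pa (co k z) by apply: sumr_ge0 => k _; exact: padic_abs_ge0.
  have m0 : 0 < m by rewrite ltr_pwDl.
  have zm k : pa (co k z) <= m.
    rewrite /m (bigD1 k) //= ler_wpDl// lerDl.
    by apply: sumr_ge0 => l _; exact: padic_abs_ge0.
  have [C C0 hC] := field_norm_sub m0.
  (* Since C e <= 1, the ultrametric inequality carries |N(t)| <= 1 over to |N(z)| <= 1 for t this
     close to z. *)
  pose e : R := Num.min 1 C^-1.
  have e0 : 0 < e by rewrite lt_min ltr01 invr_gt0.
  exists (e ^+ d / C2); first by rewrite divr_gt0// exprn_gt0.
  move=> y /(_ i0); rewrite /= -/z ltr_pdivlMr// mulrC => yz /(_ i0) /=.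
  set t := y 0 i0 in yz * => ty; move: xi; apply/negP; rewrite -leNgt.
  have tz k : pa (co k (t - z)) <= e.
    rewrite -(@ler_pXn2r _ d)// ?nnegrE ?padic_abs_ge0 ?(ltW e0)//.
    by apply: le_trans (lower _ _) _; exact: ltW.
  have e1 : e <= 1 by rewrite ge_min lexx.
  have tm k : pa (co k t) <= m.
    rewrite (_ : t = (t - z) + z); last by rewrite subrK.
    rewrite linearD; apply: padic_absD_le; last exact: zm.
    by apply: le_trans (tz k) _; rewrite (le_trans e1)// lerDl.
  change (pa (field_norm (z : L)) <= 1).
  rewrite (_ : field_norm (z : L) = field_norm (t : L) - (field_norm (t : L) - field_norm (z : L))); last by rewrite opprB addrC subrK.
  apply: padic_absB_le => //; apply: le_trans (hC _ _ _ (ltW e0) tm zm tz) _.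
  by rewrite -ler_pdivlMl// mulr1 ge_min lexx orbT.
- exists 1 => n x xb i; have := xb i; rewrite /= -vX => h.
  by rewrite -(@ler_pXn2r _ d)// ?nnegrE// expr1n.
Qed.

End PadicExtension.

(** * Balls and locally Lipschitz functions *)

Section AbsTheory.
Context {R : realType} {K : local_field R} (A : good_abs K).
Local Notation a := (av A).
Local Notation C := (av_cst A).
Implicit Types x y : K.

Lemma av_cst_gt0 : 0 < C. Proof. by apply: lt_le_trans (av_cst_ge1 A). Qed.

(** Otherwise a 0 = 1, and multiplicativity makes [a] constant equal to 1, against [av_pi_lt1]. *)
Lemma av0 : a 0 = 0.
Proof.
have /eqP := avM A 0 0; rewrite mulr0 -[X in X == _]mulr1 -subr_eq0 -mulrBr mulf_eq0.
case/orP => /eqP // h; have h1 : a 0 = 1 by lra.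
have h2 x : a x = 1 by rewrite -[LHS]mulr1 -h1 -avM mulr0.
have := h2 (av_pi A) => h3; have := av_pi_lt1 A; by rewrite h3 ltxx.
Qed.

Lemma av_gt0 x : x != 0 -> 0 < a x.
Proof. by move=> x0; rewrite lt0r av_ge0 andbT; apply: contra x0 => /eqP/av_eq0 ->. Qed.

Lemma av1 : a 1 = 1.
Proof.
have h : a 1 != 0 by rewrite gt_eqF// av_gt0// oner_eq0.
by apply: (mulfI h); rewrite -avM !mulr1.
Qed.

Lemma avN x : a (- x) = a x.
Proof.
rewrite -mulN1r avM; have : a (-1) ^+ 2 = 1.
  by rewrite expr2 -avM mulrNN mulr1 av1.
by move/eqP; rewrite sqrp_eq1 ?av_ge0// => /eqP ->; rewrite mul1r.
Qed.

Lemma avX x k : a (x ^+ k) = a x ^+ k.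
Proof. by elim: k => [|k IH]; rewrite ?expr0 ?av1// !exprS avM IH. Qed.

Lemma avV x : a x^-1 = (a x)^-1.
Proof.
have [->|x0] := eqVneq x 0; first by rewrite invr0 av0 invr0.
have ax : a x != 0 by rewrite gt_eqF// av_gt0.
by apply: (mulfI ax); rewrite -avM !divff// av1.
Qed.

Lemma avD x y : a (x + y) <= C * (a x + a y).
Proof.
have := av_sum A [:: true; false] (fun b : bool => if b then x else y).
by rewrite !big_cons !big_nil !addr0.
Qed.

Lemma avBC x y : a (x - y) = a (y - x).
Proof. by rewrite -avN opprB. Qed.

End AbsTheory.

Section Balls.
Context {R : realType} {K : local_field R} (A : good_abs K) {n : nat}.
Local Notation a := (av A).
Local Notation C := (av_cst A).
Implicit Types x y z : affine K n.

Definition cball x (e : R) : set (affine K n) :=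
  [set y | forall i, a (y 0 i - x 0 i) <= e].

Lemma cball_center x e : 0 <= e -> cball x e x.
Proof. by move=> e0 i; rewrite subrr av0. Qed.

Lemma le_cball x e e' : e <= e' -> cball x e `<=` cball x e'.
Proof. by move=> ee y xy i; apply: le_trans (xy i) ee. Qed.

Lemma cball_trans x y z e e' : cball x e y -> cball y e' z -> cball x (C * (e + e')) z.
Proof.
move=> xy yz i; rewrite (_ : _ - _ = (y 0 i - x 0 i) + (z 0 i - y 0 i)); last first.
  by rewrite [RHS]addrC addrA subrK.
apply: le_trans (avD _ _ _) _; rewrite ler_wpM2l ?(ltW (av_cst_gt0 A))//.
by apply: lerD; [exact: xy|exact: yz].
Qed.

Lemma polydisc_cball (d : R) x : 0 < d -> polydisc x (d ^+ av_deg A) `<=` cball x d.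
Proof.
move=> d0 y xy i; have := xy i; rewrite (modulusE A) ltr_pXn2r ?nnegrE ?av_ge0 ?(ltW d0)//.
  exact: ltW.
exact: av_deg_gt0.
Qed.

Lemma cball_polydisc (e : R) : 0 < e -> exists2 d, 0 < d & forall x, cball x d `<=` polydisc x e.
Proof.
(* Below 1 the power [av_deg] can only decrease the radius. *)
move=> e0; exists (Num.min 1 e / 2); first by rewrite divr_gt0// lt_min ltr01.
set m := Num.min 1 e; have m0 : 0 < m by rewrite lt_min ltr01.
have [m1 me] : m <= 1 /\ m <= e by rewrite !ge_min !lexx orbT.
move=> x y xy i; rewrite (modulusE A); apply: (@le_lt_trans _ _ ((m / 2) ^+ av_deg A)).
  by apply: lerXn2r; rewrite ?nnegrE ?av_ge0// ?divr_ge0// ltW.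
apply: (@le_lt_trans _ _ (m / 2)); last lra.
rewrite -[leRHS]expr1; apply: ler_wiXn2l; [lra|lra|exact: av_deg_gt0].
Qed.

(** The points having a ball inside S form an open set: halving the radius and dividing it by C pays
    for the weak triangle inequality. *)
Lemma nbhs_cball x (S : set (affine K n)) :
  nbhs x S <-> exists2 e, 0 < e & cball x e `<=` S.
Proof.
split=> [[B [oB Bx BS]]|[e e0 eS]].
  have [e e0 eB] := oB x Bx; have [d d0 dE] := cball_polydisc e0.
  by exists d => // y /dE/eB/BS.
exists [set y | exists2 e, 0 < e & cball y e `<=` S]; split.
- move=> y [d d0 dS]; have C0 := av_cst_gt0 A.
  pose d' := d / (2 * C); have d'0 : 0 < d' by rewrite divr_gt0// mulr_gt0.
  exists (d' ^+ av_deg A); first exact: exprn_gt0.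
  move=> z /(polydisc_cball d'0) yz; exists d' => // t zt; apply: dS.
  apply: le_cball (cball_trans yz zt); rewrite /d'.
  by rewrite le_eqVlt; apply/orP; left; apply/eqP; field; rewrite gt_eqF.
- by exists e.
- by move=> y [d d0 dS]; apply: dS; exact: cball_center (ltW d0).
Qed.

Lemma open_cball (S : set (affine K n)) :
  open S <-> forall x, S x -> exists2 e, 0 < e & cball x e `<=` S.
Proof.
rewrite openE; split=> oS x Sx; first exact/nbhs_cball/oS.
by apply/nbhs_cball; exact: oS.
Qed.

(** Lipschitz near x for the maximum of the absolute values of the coordinates; any upper bound e
    stands for this maximum. *)
Definition lip_at (f : affine K n -> K) x := exists d l : R,
  [/\ 0 < d, 0 <= l & forall y y' e, cball x d y -> cball x d y' -> 0 <= e ->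
    cball y' e y -> a (f y - f y') <= l * e].

Lemma lip_at_near f x e : lip_at f x -> 0 < e ->
  exists2 d, 0 < d & forall y, cball x d y -> a (f y - f x) <= e.
Proof.
move=> [d [l [d0 l0 fl]]] e0; exists (Num.min d (e / (l + 1))).
  by rewrite lt_min d0 divr_gt0// ltr_wpDl.
set m := Num.min _ _; have [md me] : m <= d /\ m <= e / (l + 1) by rewrite !ge_min !lexx orbT.
have m0 : 0 <= m by rewrite le_min (ltW d0) divr_ge0 ?ltW// ltr_wpDl.
move=> y xy; apply: le_trans (fl y x m (le_cball md xy) (cball_center _ (ltW d0)) m0 xy) _.
apply: (@le_trans _ _ ((l + 1) * m)); first by rewrite ler_wpM2r// lerDl.
by rewrite -ler_pdivlMl ?ltr_wpDl// mulrC.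
Qed.

Lemma lip_at_neq0 f x : lip_at f x -> f x != 0 ->
  exists d c, [/\ 0 < d, 0 < c & forall y, cball x d y -> c <= a (f y)].
Proof.
move=> lf fx; have C0 := av_cst_gt0 A; have afx := av_gt0 A fx.
(* The weak triangle inequality leaves a (f x) / C = 2 e, of which the variation of f takes one
   e. *)
pose e := a (f x) / (2 * C); have e0 : 0 < e by rewrite divr_gt0// mulr_gt0.
have [d d0 fd] := lip_at_near lf e0; exists d, e; split=> // y /fd fyx.
have : a (f x) <= C * (a (f y) + e).
  rewrite (_ : f x = f y + (f x - f y)); last by rewrite addrC subrK.
  apply: le_trans (avD _ _ _) _; rewrite ler_wpM2l ?(ltW C0)// lerD2l.
  by rewrite avBC.
rewrite -ler_pdivrMl// => h; rewrite -(lerD2r e); apply: le_trans h.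
rewrite /e le_eqVlt; apply/orP; left; apply/eqP; field; by rewrite gt_eqF.
Qed.

Lemma lip_at_cst c x : lip_at (fun=> c) x.
Proof.
by exists 1, 0; split=> // y y' e _ _ _ _; rewrite subrr av0 mul0r.
Qed.

Lemma lip_at_coord i x : lip_at (fun y => y 0 i) x.
Proof. by exists 1, 1; split=> // y y' e _ _ _ /(_ i); rewrite mul1r. Qed.

Lemma lip_atD f g x : lip_at f x -> lip_at g x -> lip_at (fun y => f y + g y) x.
Proof.
move=> [d [l [d0 l0 fl]]] [d' [l' [d'0 l'0 gl]]].
have C0 := av_cst_gt0 A.
exists (Num.min d d'), (C * (l + l')); split.
- by rewrite lt_min d0.
- by rewrite mulr_ge0 ?addr_ge0// ltW.
move=> y y' e xy xy' e0 yy'.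
have [md md'] : Num.min d d' <= d /\ Num.min d d' <= d' by rewrite !ge_min !lexx orbT.
rewrite (_ : _ - _ = (f y - f y') + (g y - g y')); last by rewrite opprD addrACA.
apply: le_trans (avD _ _ _) _; rewrite -mulrA ler_wpM2l ?(ltW C0)// mulrDl.
by apply: lerD; [apply: fl|apply: gl] => //; exact: le_cball xy || exact: le_cball xy'.
Qed.

Lemma lip_at_bounded f x : lip_at f x -> exists d M, [/\ 0 < d, 0 <= M &
  forall y, cball x d y -> a (f y) <= M].
Proof.
move=> lf; have [d d0 fd] := lip_at_near lf ltr01.
exists d, (C * (a (f x) + 1)); split=> //.
  by rewrite mulr_ge0 ?addr_ge0 ?av_ge0// ltW// av_cst_gt0.
move=> y /fd h; rewrite (_ : f y = f x + (f y - f x)); last by rewrite addrC subrK.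
by apply: le_trans (avD _ _ _) _; rewrite ler_wpM2l ?lerD2l// ltW// av_cst_gt0.
Qed.

Lemma lip_atM f g x : lip_at f x -> lip_at g x -> lip_at (fun y => f y * g y) x.
Proof.
move=> lf lg; have [r [M [r0 M0 fM]]] := lip_at_bounded lf.
have [r' [M' [r'0 M'0 gM']]] := lip_at_bounded lg.
case: lf => [d [l [d0 l0 fl]]]; case: lg => [d' [l' [d'0 l'0 gl]]].
have C0 := av_cst_gt0 A.
pose m := Num.min (Num.min d d') (Num.min r r').
exists m, (C * (M * l' + l * M')); split.
- by rewrite !lt_min d0 d'0 r0.
- by rewrite mulr_ge0 ?addr_ge0 ?mulr_ge0// ltW.
have [md md' mr mr'] : [/\ m <= d, m <= d', m <= r & m <= r'].
  by rewrite !ge_min !lexx !orbT.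
move=> y y' e xy xy' e0 yy'.
rewrite (_ : _ - _ = f y * (g y - g y') + (f y - f y') * g y'); last by ring.
apply: le_trans (avD _ _ _) _; rewrite -mulrA ler_wpM2l ?(ltW C0)// (mulrDl (M * l')) !avM.
apply: lerD.
  rewrite -mulrA ler_pM ?av_ge0//; first exact: fM (le_cball mr xy).
  by apply: gl => //; [exact: le_cball xy|exact: le_cball xy'].
rewrite mulrAC ler_pM ?av_ge0//; last exact: gM' (le_cball mr' xy').
by apply: fl => //; [exact: le_cball xy|exact: le_cball xy'].
Qed.

End Balls.

(** * Analytic functions *)

Lemma ler_sum_subset (R : realType) (I : eqType) (r s : seq I) (F : I -> R) :
  uniq r -> uniq s -> {subset r <= s} -> (forall i, 0 <= F i) ->
  \sum_(i <- r) F i <= \sum_(i <- s) F i.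
Proof.
move=> ur us rs F0.
have pr : perm_eq r [seq i <- s | i \in r].
  apply: uniq_perm => // [|i]; first exact: filter_uniq.
  by rewrite mem_filter; case: (boolP (i \in r)) => //= /rs ->.
rewrite (perm_big _ pr) big_filter [leRHS](bigID (mem r)) /= lerDl.
by apply: sumr_ge0.
Qed.

Section MultiIndex.
Context {R : realType} {n : nat}.
Local Notation mi := {ffun 'I_n -> nat}.

Definition mdegree (m : mi) : nat := \sum_i m i.

Definition mbox N : seq mi :=
  [seq [ffun i => val (phi i)] | phi : {ffun 'I_n -> 'I_N} <- enum {ffun 'I_n -> 'I_N}].

Lemma mbox_uniq N : uniq (mbox N).
Proof.
rewrite map_inj_uniq ?enum_uniq// => f g /ffunP fg; apply/ffunP => i.
by apply: val_inj; have := fg i; rewrite !ffunE.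
Qed.

Lemma mem_mbox N (m : mi) : (forall i, (m i < N)%N) -> m \in mbox N.
Proof.
move=> mN; apply/mapP; exists [ffun i => Ordinal (mN i)]; first by rewrite mem_enum.
by apply/ffunP => i; rewrite !ffunE.
Qed.

Lemma mem_mbox_degree N (m : mi) : (mdegree m < N)%N -> m \in mbox N.
Proof.
move=> mN; apply: mem_mbox => i; apply: leq_ltn_trans mN.
by rewrite /mdegree (bigD1 i)//= leq_addr.
Qed.

(** The family lies in a box, over which the sum factors into n geometric sums, each at most 2. *)
Lemma sum_geometric_le (q : R) (r : seq mi) : uniq r -> 0 <= q -> q <= 2^-1 ->
  \sum_(m <- r) q ^+ mdegree m <= 2 ^+ n.
Proof.
move=> ur q0 q1.
have [N rN] : exists N, {subset r <= mbox N}.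
  exists (\sum_(m <- r) mdegree m).+1 => m mr; apply: mem_mbox_degree.
  by rewrite ltnS (big_rem m)//= leq_addr.
apply: le_trans (ler_sum_subset ur (mbox_uniq N) rN _) _ => [m|].
  exact: exprn_ge0.
rewrite big_map enumT -/(index_enum _).
have E (phi : {ffun 'I_n -> 'I_N}) :
    q ^+ mdegree [ffun i => val (phi i)] = \prod_i q ^+ (phi i).
  by rewrite /mdegree -expr_sum; under eq_bigr do rewrite ffunE.
under eq_bigr do rewrite E.
rewrite -(bigA_distr_bigA (fun (i : 'I_n) (k : 'I_N) => q ^+ k)) /=.
apply: (@le_trans _ _ (\prod_(i < n) 2)); last by rewrite prodr_const card_ord.
apply: ler_prod => i _; rewrite sumr_ge0 => [|k _]; last exact: exprn_ge0.
have := @geometric_le R q 0 N q0 q1; rewrite expr0 mulr1 => h; apply: le_trans h.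
by rewrite big_mkord.
Qed.

End MultiIndex.

Section Sums.
Context {R : realType} {K : local_field R} (A : good_abs K).
Local Notation a := (av A).
Local Notation C := (av_cst A).

Lemma has_sum_av (I : choiceType) (u : I -> K) l : has_sum u l ->
  forall e : R, 0 < e -> exists B : {fset I}, forall B' : {fset I},
    fsubset B B' -> a (\sum_(i <- B') u i - l) <= e.
Proof.
move=> ul e e0; have [B hB] := ul (e ^+ av_deg A) (exprn_gt0 _ e0).
exists B => B' /hB; rewrite (modulusE A) ltr_pXn2r ?nnegrE ?av_ge0 ?(ltW e0)//.
  exact: ltW.
exact: av_deg_gt0.
Qed.

(** One factor C comes from passing through the partial sums, the other from the sum of the
    differences. *)
Lemma has_sum_sub_le (I : choiceType) (u u' : I -> K) l l' (S : R) :
  has_sum u l -> has_sum u' l' ->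
  (forall B : {fset I}, \sum_(i <- B) a (u i - u' i) <= S) ->
  a (l - l') <= C ^+ 2 * S.
Proof.
move=> ul ul' uS; have C0 := av_cst_gt0 A.
apply/ler_addgt0Pr => e e0.
have e'0 : 0 < e / (2 * C) by rewrite divr_gt0// mulr_gt0.
have [B hB] := has_sum_av ul e'0; have [B' hB'] := has_sum_av ul' e'0.
have {}hB := hB _ (fsubsetUl B B'); have {}hB' := hB' _ (fsubsetUr B B').
set D := (B `|` B')%fset in hB hB'.
have := av_sum A [:: \sum_(i <- D) u' i - l'; \sum_(i <- D) (u i - u' i); l - \sum_(i <- D) u i] id.
rewrite !big_cons !big_nil !addr0 /=.
rewrite (_ : _ + (_ + _) = l - l'); last by rewrite sumrB; ring.
move=> h; apply: le_trans h _.
rewrite [X in _ + (_ + X)]avBC.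
have h3 : a (\sum_(i <- D) (u i - u' i)) <= C * S.
  by apply: le_trans (av_sum _ _ _) _; rewrite ler_wpM2l ?(ltW C0).
apply: (@le_trans _ _ (C * (e / (2 * C) + (C * S + e / (2 * C))))).
  by rewrite ler_wpM2l ?(ltW C0)// !lerD.
rewrite le_eqVlt; apply/orP; left; apply/eqP; field; by rewrite gt_eqF.
Qed.

Lemma has_sum_finite (I : choiceType) (u : I -> K) (r : seq I) : uniq r ->
  (forall i, i \notin r -> u i = 0) -> has_sum u (\sum_(i <- r) u i).
Proof.
move=> ur u0 e e0; exists (seq_fset tt r) => B rB.
suff -> : \sum_(i <- B) u i = \sum_(i <- r) u i.
  by rewrite subrr (modulusE A) av0 expr0n gtn_eqF ?av_deg_gt0.
have rB' : {subset r <= B}.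
  by move=> i ir; move/fsubsetP : rB; apply; rewrite seq_fsetE.
have pr : perm_eq r [seq i <- B | i \in r].
  apply: uniq_perm => // [|i]; first by rewrite filter_uniq.
  by rewrite mem_filter; case: (boolP (i \in r)) => //= /rB' ->.
rewrite [RHS](perm_big _ pr) big_filter [LHS](bigID (mem r)) /=.
by rewrite [X in _ + X = _]big1 ?addr0// => i /u0.
Qed.

End Sums.

Section Analytic.
Context {R : realType} {K : local_field R} (A : good_abs K) {n : nat}.
Local Notation a := (av A).
Local Notation C := (av_cst A).
Local Notation mi := {ffun 'I_n -> nat}.
Local Notation mon z m := (\prod_i (z i) ^+ (m : mi) i).

Lemma av_prod I (s : seq I) (F : I -> K) : a (\prod_(i <- s) F i) = \prod_(i <- s) a (F i).
Proof. by elim: s => [|i s IH]; rewrite ?big_nil ?av1// !big_cons avM IH. Qed.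

Lemma av_mon_le (z : 'I_n -> K) m (d : R) : 0 <= d -> (forall i, a (z i) <= d) ->
  a (mon z m) <= d ^+ mdegree m.
Proof.
move=> d0 zd; rewrite av_prod /mdegree expr_sum; apply: ler_prod => i _.
by rewrite avX exprn_ge0 ?av_ge0// lerXn2r ?nnegrE ?av_ge0.
Qed.

(** Coefficient bounds from convergence at a single point, displaced from x by z in every
    coordinate; a power of [av_pi] provides a small nonzero z in every field. Outside a finite set
    B, a term is the difference of two partial sums close to f y, so it is at most 2 C. *)
Lemma analytic_coef (f : affine K n -> K) x : analytic_at f x ->
  exists (c : mi -> K) (r M : R), [/\ 0 < r, 0 <= M,
    forall m, a (c m) * r ^+ mdegree m <= M &
    forall y, cball A x r y ->
      has_sum (fun m => c m * mon (fun i => y 0 i - x 0 i) m) (f y)].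
Proof.
move=> [c [e [e0 fs]]]; have [d d0 dE] := cball_polydisc A (n := n) e0.
have [j pj] := expr_small (ltW (av_pi_gt0 A)) (av_pi_lt1 A) d0.
pose z := av_pi A ^+ j; have zd : a z <= d by rewrite avX ltW.
have z0 : 0 < a z by rewrite avX exprn_gt0// av_pi_gt0.
pose y : affine K n := \row_i (x 0 i + z).
have yz i : y 0 i - x 0 i = z by rewrite mxE addrC addKr.
have C0 := av_cst_gt0 A.
have ysum := fs y (dE x y ltac:(by move=> i; rewrite yz)).
have [B hB] := has_sum_av A ysum ltr01.
pose u m := c m * mon (fun i => y 0 i - x 0 i) m.
have au m : a (u m) = a (c m) * a z ^+ mdegree m.
  rewrite avM av_prod /mdegree expr_sum; congr (_ * _); apply: eq_bigr => i _.
  by rewrite yz avX.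
have SB : 0 <= \sum_(m <- B) a (u m) by apply: sumr_ge0 => m _; exact: av_ge0.
exists c, (a z), (C * 2 + \sum_(m <- B) a (u m)); split=> //.
- by rewrite addr_ge0// mulr_ge0// ltW.
- move=> m; rewrite -au; case: (boolP (m \in B)) => mB.
    rewrite (big_rem m)//= addrCA lerDl addr_ge0 ?mulr_ge0 ?(ltW C0)//.
    by apply: sumr_ge0 => k _; exact: av_ge0.
  have h1 := hB _ (fsubset_refl B); have h2 := hB _ (fsubsetU1 m B).
  rewrite big_fsetU1//= in h2.
  have -> : u m = (u m + \sum_(i <- B) u i - f y) - (\sum_(i <- B) u i - f y) by ring.
  apply: le_trans (avD _ _ _) _; rewrite ler_wpDr// ler_wpM2l ?(ltW C0)//.
  by rewrite avN -[2]/(1 + 1) lerD.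
- by move=> y' xy'; apply: fs; apply: dE; exact: le_cball xy'.
Qed.

(** The factor d on the left avoids the exponent k - 1. Each step of the induction adds two equal
    bounds and costs one C, whence the base 2 C d. *)
Lemma av_pow_sub (z z' : K) (d e : R) k : 0 <= d -> 0 <= e ->
  a z <= d -> a z' <= d -> a (z - z') <= e ->
  d * a (z ^+ k - z' ^+ k) <= e * (2 * C * d) ^+ k.
Proof.
move=> d0 e0 zd zd' zz; have C1 := av_cst_ge1 A; have C0 := av_cst_gt0 A.
elim: k => [|k IH]; first by rewrite !expr0 subrr av0 mulr0 mulr1.
rewrite !exprS (_ : _ - _ = z * (z ^+ k - z' ^+ k) + (z - z') * z' ^+ k); last by ring.
have dk : d ^+ k <= (2 * C * d) ^+ k.
  by rewrite lerXn2r ?nnegrE ?mulr_ge0 ?ler_peMl ?(ltW C0)//; lra.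
apply: (@le_trans _ _ (d * (C * (d * a (z ^+ k - z' ^+ k) + e * (2 * C * d) ^+ k)))).
  rewrite ler_wpM2l//; apply: le_trans (avD _ _ _) _; rewrite ler_wpM2l ?(ltW C0)//.
  rewrite !avM avX lerD// ler_pM ?av_ge0 ?exprn_ge0 ?av_ge0//.
  by apply: le_trans dk; rewrite lerXn2r ?nnegrE ?av_ge0.
apply: (@le_trans _ _ (d * (C * (e * (2 * C * d) ^+ k + e * (2 * C * d) ^+ k)))).
  by rewrite ler_wpM2l// ler_wpM2l ?(ltW C0)// lerD2r.
by rewrite le_eqVlt; apply/orP; left; apply/eqP; ring.
Qed.

(** Telescoping over the variables, at the cost of a factor 2 C for each. *)
Lemma av_mon_sub (z z' : 'I_n -> K) (d e : R) m : 0 <= d -> 0 <= e ->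
  (forall i, a (z i) <= d) -> (forall i, a (z' i) <= d) ->
  (forall i, a (z i - z' i) <= e) ->
  d * a (mon z m - mon z' m) <= e * (2 * C) ^+ n * (2 * C * d) ^+ mdegree m.
Proof.
move=> d0 e0 zd zd' zz; have C1 := av_cst_ge1 A; have C0 := av_cst_gt0 A.
have d2 : d <= 2 * C * d by rewrite ler_peMl//; lra.
have d20 : 0 <= 2 * C * d by exact: le_trans d2.
suff : forall s : seq 'I_n, d * a (\prod_(i <- s) z i ^+ m i - \prod_(i <- s) z' i ^+ m i) <=
    e * (2 * C) ^+ size s * \prod_(i <- s) (2 * C * d) ^+ m i.
  move=> /(_ (index_enum _)); rewrite expr_sum.
  by rewrite (_ : size _ = n)// -[RHS]card_ord cardT enumT.
elim=> [|i s IH]; first by rewrite !big_nil subrr av0 mulr0 !mulr1.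
rewrite !big_cons.
set X := \prod_(j <- s) z j ^+ _; set X' := \prod_(j <- s) z' j ^+ _.
rewrite (_ : _ - _ = z i ^+ m i * (X - X') + (z i ^+ m i - z' i ^+ m i) * X'); last by ring.
rewrite -/X -/X' in IH.
set Q := \prod_(j <- s) _ in IH *; set P := (2 * C * d) ^+ m i.
have Q0 : 0 <= Q by apply: prodr_ge0 => j _; exact: exprn_ge0.
have P0 : 0 <= P by exact: exprn_ge0.
have XQ : a X' <= Q.
  rewrite av_prod; apply: ler_prod => j _; rewrite av_ge0 avX lerXn2r ?nnegrE ?av_ge0//.
  exact: le_trans (zd' j) d2.
have zP : a (z i ^+ m i) <= P.
  by rewrite avX lerXn2r ?nnegrE ?av_ge0//; exact: le_trans (zd i) d2.
have zzP := av_pow_sub (m i) d0 e0 (zd i) (zd' i) (zz i).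
rewrite -/P in zzP.
have W1 : 1 <= (2 * C) ^+ size s by rewrite exprn_ege1//; lra.
have h : d * a (z i ^+ m i * (X - X') + (z i ^+ m i - z' i ^+ m i) * X') <=
    C * (P * (e * (2 * C) ^+ size s * Q) + e * P * Q).
  apply: (@le_trans _ _ (C * (P * (d * a (X - X')) + d * a (z i ^+ m i - z' i ^+ m i) * Q))).
    rewrite (_ : C * _ = d * (C * (P * a (X - X') + a (z i ^+ m i - z' i ^+ m i) * Q))); last by ring.
    rewrite ler_wpM2l//; apply: le_trans (avD _ _ _) _; rewrite ler_wpM2l ?(ltW C0)// !avM.
    by rewrite lerD ?ler_wpM2r ?ler_wpM2l ?av_ge0.
  by rewrite ler_wpM2l ?(ltW C0)// lerD ?ler_wpM2l ?ler_wpM2r.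
apply: le_trans h _; rewrite exprS -subr_ge0.
rewrite (_ : _ - _ = C * P * Q * e * ((2 * C) ^+ size s - 1)); last by rewrite /=; ring.
by rewrite !mulr_ge0 ?subr_ge0 ?(ltW C0).
Qed.

Lemma analytic_lip (f : affine K n -> K) x : analytic_at f x -> lip_at A f x.
Proof.
move=> /analytic_coef[c [r [M [r0 M0 cM fs]]]]; have C1 := av_cst_ge1 A.
have C0 := av_cst_gt0 A.
(* 2 C d = r / 2, so [av_mon_sub] and the coefficient bound leave the geometric series of 2^-|m|. *)
pose d := r / (4 * C); have d0 : 0 < d by rewrite divr_gt0// mulr_gt0.
have dr : d <= r by rewrite ler_pdivrMr ?mulr_gt0// ler_peMr ?(ltW r0)//; lra.
exists d, (C ^+ 2 * (M * (2 * C) ^+ n / d * 2 ^+ n)); split=> //.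
  by rewrite !mulr_ge0 ?exprn_ge0 ?mulr_ge0 ?invr_ge0 ?(ltW C0) ?(ltW d0).
move=> y y' e xy xy' e0 yy'.
rewrite -mulrA; apply: (has_sum_sub_le (fs y (le_cball dr xy)) (fs y' (le_cball dr xy'))).
move=> B.
apply: (@le_trans _ _ (\sum_(m <- B) M * (2 * C) ^+ n / d * e * 2^-1 ^+ mdegree m)).
  apply: ler_sum => m _; rewrite -mulrBr avM.
  have := @av_mon_sub (fun i => y 0 i - x 0 i) (fun i => y' 0 i - x 0 i) d e m (ltW d0) e0 xy xy'.
  have yyi i : a (y 0 i - x 0 i - (y' 0 i - x 0 i)) <= e.
    by rewrite opprB addrA subrK; exact: yy'.
  move=> /(_ yyi); set t := a (_ - _) => ht.
  have E : 2 * C * d = r * 2^-1 by rewrite /d; field; rewrite gt_eqF.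
  rewrite E (exprMn (mdegree m)) in ht.
  have h1 : t <= e * (2 * C) ^+ n * (r ^+ mdegree m * 2^-1 ^+ mdegree m) / d.
    by rewrite ler_pdivlMr// (mulrC t).
  apply: le_trans (ler_wpM2l (av_ge0 A _) h1) _.
  rewrite (_ : a (c m) * _ = (a (c m) * r ^+ mdegree m) *
     ((2 * C) ^+ n / d * e * 2^-1 ^+ mdegree m)); last by ring.
  rewrite [leRHS](_ : _ = M * ((2 * C) ^+ n / d * e * 2^-1 ^+ mdegree m)); last by ring.
  by rewrite ler_wpM2r ?cM// !mulr_ge0 ?exprn_ge0 ?mulr_ge0 ?invr_ge0 ?(ltW C0) ?(ltW d0).
rewrite -mulr_sumr -[leRHS]mulrA (mulrC (2 ^+ n)) mulrA.
rewrite ler_wpM2l ?sum_geometric_le ?invr_ge0 ?fset_uniq//.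
by rewrite !mulr_ge0 ?exprn_ge0 ?mulr_ge0 ?invr_ge0 ?(ltW C0) ?(ltW d0).
Qed.

Lemma horner_bounded (p : {poly K}) : exists2 M : R, 0 <= M &
  forall t, a t <= 1 -> a p.[t] <= M.
Proof.
have C0 := av_cst_gt0 A.
exists (C * \sum_(i < size p) a p`_i).
  by rewrite mulr_ge0 ?(ltW C0)// sumr_ge0// => i _; exact: av_ge0.
move=> t t1; rewrite horner_coef; apply: le_trans (av_sum _ _ _) _.
rewrite ler_wpM2l ?(ltW C0)//; apply: ler_sum => i _.
by rewrite avM avX ler_piMr ?av_ge0// exprn_ile1 ?av_ge0.
Qed.

(** p - p(0) is X times a polynomial bounded on the unit ball, hence small near 0. *)
Lemma horner_near0 (p : {poly K}) : p.[0] != 0 -> exists c d : R, [/\ 0 < c, 0 < d &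
  forall t, a t <= d -> c <= a p.[t]].
Proof.
move=> p0; have C0 := av_cst_gt0 A; have ap0 := av_gt0 A p0.
have [q qE] : exists q, p = q * 'X + p.[0]%:P.
  have : root (p - p.[0]%:P) 0 by rewrite rootE hornerD hornerN hornerC subrr.
  by move=> /factor_theorem[q]; rewrite subr0 => qE; exists q; rewrite -qE subrK.
have [M M0 qM] := horner_bounded q.
pose c := a p.[0] / (2 * C); have c0 : 0 < c by rewrite divr_gt0// mulr_gt0.
exists c, (Num.min 1 (c / (M + 1))); split=> //.
  by rewrite lt_min ltr01 divr_gt0// ltr_wpDl.
move=> t; rewrite le_min => /andP[t1 td].
have pt : p.[0] = p.[t] - q.[t] * t.
  have -> : p.[t] = q.[t] * t + p.[0].
    by rewrite {1}qE hornerD hornerM hornerX hornerC.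
  by rewrite [X in X - _]addrC addrK.
have qt : a (q.[t] * t) <= c.
  rewrite avM; apply: (@le_trans _ _ (M * (c / (M + 1)))).
    by rewrite ler_pM ?av_ge0 ?qM.
  rewrite mulrCA ler_piMr ?(ltW c0)// ler_pdivrMr ?ltr_wpDl// mul1r lerDl//.
have : a p.[0] <= C * (a p.[t] + c).
  rewrite pt; apply: le_trans (avD _ _ _) _.
  by rewrite ler_wpM2l ?(ltW C0)// lerD2l avN.
rewrite -ler_pdivrMl// => h; rewrite -(lerD2r c); apply: le_trans h.
rewrite /c le_eqVlt; apply/orP; left; apply/eqP; field; by rewrite gt_eqF.
Qed.

Lemma poly_xfactor (p : {poly K}) : p != 0 -> exists (k : nat) (q : {poly K}),
  [/\ p = q * 'X^k, q.[0] != 0 & (k < size p)%N].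
Proof.
move=> p0; have [k [q]] := multiplicity_XsubC p 0; rewrite p0 subr0 /= => q0 pE.
have qn0 : q != 0 by apply: contraNneq p0 => q00; rewrite pE q00 mul0r.
exists k, q; split=> //.
by rewrite pE size_Mmonic ?monicXn// size_polyXn addnS /= -[X in (X < _)%N]add0n ltn_add2r lt0n size_poly_eq0.
Qed.

(** The line joins x to a nearby y with f y != 0. The multiple series is not rearranged into powers
    of t: f on the line is compared with the polynomial [p J] of its terms of degree below J, up to
    an error of order |t|^J. A nonzero [p J] vanishes at 0 to an order k < J, so near 0 the error is
    absorbed. *)
Lemma analytic_line_lower (f : affine K n -> K) x : analytic_at f x ->
  (forall e, 0 < e -> exists2 y, cball A x e y & f y != 0) ->
  exists (v : affine K n) (k : nat) (c d : R), [/\ 0 < c, 0 < d &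
    forall t, a t <= d -> c * a t ^+ k <= a (f (x + t *: (v : 'rV[K]_n)))].
Proof.
move=> /analytic_coef[c [r [M [r0 M0 cM fs]]]] fn0; have C0 := av_cst_gt0 A.
(* Radius r / 4 gives 4^-|m|: one factor 2^-|m| for the summation over m, the other for the 2^-J of
   [approx]. *)
have [y xy fy] := fn0 (r / 4) ltac:(by rewrite divr_gt0).
pose v : 'rV[K]_n := \row_i (y 0 i - x 0 i).
pose mv m := mon (fun i => v 0 i) m.
have mvM m : a (c m) * a (mv m) <= M * 4^-1 ^+ mdegree m.
  apply: (@le_trans _ _ (a (c m) * (r * 4^-1) ^+ mdegree m)).
    rewrite ler_wpM2l ?av_ge0//; apply: av_mon_le; first by rewrite mulr_ge0 ?(ltW r0).
    by move=> i; rewrite mxE; exact: xy.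
  by rewrite exprMn mulrA ler_wpM2r ?exprn_ge0.
pose p J : {poly K} := \sum_(m <- mbox J | (mdegree m < J)%N) (c m * mv m) *: 'X^(mdegree m).
have sp J : (size (p J) <= J)%N.
  apply: (leq_trans (size_sum _ _ _)); apply/bigmax_leqP_seq => m _ mJ.
  by apply: leq_trans (size_scale_leq _ _) _; rewrite size_polyXn.
pose B := C ^+ 2 * (M * 2 ^+ n).
have B0 : 0 <= B by rewrite !mulr_ge0 ?exprn_ge0 ?(ltW C0).
have approx J t : a t <= 1 -> a (f (x + t *: v) - (p J).[t]) <= B * (a t / 2) ^+ J.
  move=> t1; set yt : affine K n := x + t *: v.
  have ytE i : yt 0 i - x 0 i = t * v 0 i.
    by rewrite !mxE [X in X - _]addrC addrK.
  have xyt : cball A x r yt.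
    move=> i; rewrite ytE avM mxE; apply: le_trans (ler_wpM2r (av_ge0 A _) t1) _.
    rewrite mul1r; apply: le_trans (xy i) _; rewrite ler_pdivrMr// ler_peMr ?(ltW r0)//; lra.
  have monE m : mon (fun i => yt 0 i - x 0 i) m = t ^+ mdegree m * mv m.
    rewrite /mdegree expr_sum /mv -big_split /=; apply: eq_bigr => i _.
    by rewrite ytE exprMn.
  pose u' (m : mi) := if (mdegree m < J)%N then c m * (t ^+ mdegree m * mv m) else 0.
  have pJE : (p J).[t] = \sum_(m <- mbox J) u' m.
    rewrite horner_sum /= big_mkcond; apply: eq_bigr => m _; rewrite /u'.
    by case: ifP => // _; rewrite hornerZ hornerXn; ring.
  have u'0 (m : mi) : m \notin mbox J -> u' m = 0.
    by rewrite /u'; case: ifP => // /mem_mbox_degree ->.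
  have := has_sum_finite A (mbox_uniq J) u'0; rewrite -pJE => su'.
  rewrite /B -mulrA; apply: (has_sum_sub_le (fs yt xyt) su') => D.
  apply: (@le_trans _ _ (\sum_(m <- D) M * (a t / 2) ^+ J * 2^-1 ^+ mdegree m)).
    apply: ler_sum => m _; rewrite monE /u'; case: (ltnP (mdegree m) J) => mJ.
      by rewrite subrr av0 !mulr_ge0 ?exprn_ge0 ?divr_ge0 ?av_ge0.
    rewrite subr0 !avM avX mulrCA.
    apply: (@le_trans _ _ (a t ^+ J * (M * 4^-1 ^+ mdegree m))).
      by rewrite ler_pM ?exprn_ge0 ?av_ge0 ?mulr_ge0 ?av_ge0 ?ler_wiXn2l ?av_ge0.
    have -> : (4^-1 : R) = 2^-1 * 2^-1 by field.
    rewrite !exprMn mulrCA -!mulrA ler_wpM2l// ler_wpM2l ?exprn_ge0 ?av_ge0//.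
    by rewrite ler_wpM2r ?exprn_ge0// ?ler_wiXn2l ?invr_ge0//; lra.
  rewrite -mulr_sumr -[leRHS]mulrA (mulrC (2 ^+ n)) mulrA.
  by rewrite ler_wpM2l ?sum_geometric_le ?invr_ge0 ?fset_uniq// mulr_ge0 ?exprn_ge0 ?divr_ge0 ?av_ge0.
(* If every [p J] were 0, [approx] at t = 1 would bound f y by B 2^-J for all J. *)
have [J pJ] : exists J, p J != 0.
  apply: contrapT => p0; move/negP : fy; apply; apply/eqP/(av_eq0 (g := A)).
  apply/eqP; rewrite eq_le av_ge0 andbT; apply/ler_addgt0Pr => e e0.
  have [J hJ] : exists J, 2^-1 ^+ J < e / (B + 1).
    by apply: expr_small; rewrite ?divr_gt0 ?ltr_wpDl//; lra.
  have := approx J 1; rewrite av1 => /(_ (lexx _)).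
  have -> : p J = 0 by apply/eqP; apply: contrapT => /negP pJ; apply: p0; exists J.
  rewrite horner0 subr0 scale1r (_ : x + v = y); last first.
    by apply/rowP => i; rewrite !mxE addrC subrK.
  rewrite add0r div1r => h; apply: le_trans h _.
  apply: (@le_trans _ _ ((B + 1) * 2^-1 ^+ J)); first by rewrite ler_wpM2r ?exprn_ge0// lerDl.
  by rewrite -ler_pdivlMl ?ltr_wpDl// mulrC ltW.
have [k [q [pE q0 kp]]] := poly_xfactor pJ.
have [c1 [d [c10 d0 qd]]] := horner_near0 q0.
exists v, k, (c1 / (2 * C)).
exists (Num.min 1 (Num.min d (c1 / (2 * C) / (B + 1)))).
have c2 : 0 < c1 / (2 * C) by rewrite divr_gt0// mulr_gt0.
have B1 : 0 < B + 1 by rewrite ltr_wpDl.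
split=> //; first by rewrite !lt_min ltr01 d0 divr_gt0.
move=> t; rewrite !le_min => /and3P[t1 td tB].
have h1 : c1 * a t ^+ k <= a (p J).[t].
  by rewrite pE hornerM hornerXn avM avX ler_wpM2r ?exprn_ge0 ?av_ge0 ?qd.
have h2 : B * (a t / 2) ^+ J <= c1 / (2 * C) * a t ^+ k.
  apply: (@le_trans _ _ (B * a t ^+ k.+1)).
    rewrite ler_wpM2l//; apply: (@le_trans _ _ (a t ^+ J)).
      by rewrite lerXn2r ?nnegrE ?divr_ge0 ?av_ge0//; have := av_ge0 A t; lra.
    by rewrite ler_wiXn2l ?av_ge0// (leq_trans kp (sp J)).
  rewrite exprS mulrA ler_wpM2r ?exprn_ge0 ?av_ge0//.
  apply: (@le_trans _ _ ((B + 1) * a t)); first by rewrite ler_wpM2r ?av_ge0// lerDl.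
  by rewrite -ler_pdivlMl// mulrC.
have h3 : c1 * a t ^+ k <= C * (a (f (x + t *: v)) + c1 / (2 * C) * a t ^+ k).
  apply: le_trans h1 _.
  rewrite (_ : (p J).[t] = f (x + t *: v) - (f (x + t *: v) - (p J).[t])); last by rewrite opprB addrC subrK.
  apply: le_trans (avD _ _ _) _; rewrite ler_wpM2l ?(ltW C0)// lerD2l avN.
  exact: le_trans (approx J t t1) h2.
rewrite -ler_pdivrMl// in h3; rewrite -(lerD2r (c1 / (2 * C) * a t ^+ k)).
apply: le_trans h3; rewrite le_eqVlt; apply/orP; left; apply/eqP.
by field; rewrite gt_eqF.
Qed.

End Analytic.

(** * Divergence of the zeta integral *)

Section BallMeasure.
Context {R : realType} {K : local_field R} (A : good_abs K) {n : nat}.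
Local Notation a := (av A).
Local Notation C := (av_cst A).
Local Notation w := (av A (av_pi A)).
Variable mu : {measure set (borel K n) -> \bar R}.
Hypothesis haar : normalized_haar mu.

Lemma open_measurable_borel (S : set (affine K n)) : open S ->
  measurable (S : set (borel K n)).
Proof. exact: sub_sigma_algebra. Qed.

(** The covering [av_cover] is iterated k times, rescaled by powers of [av_pi]; each round
    multiplies the number of points by M. *)
Lemma av_net : exists M : nat, (0 < M)%N /\ forall k, exists s : seq K,
  (size s <= M ^ k)%N /\ forall x, a x <= 1 -> exists2 y, y \in s & a (x - y) <= w ^+ k.
Proof.
have [F FP] := av_cover A; exists (size F); split.
  have [y yF _] := FP 0 ltac:(by rewrite av0).
  by case: (F) yF.
elim=> [|k [s [ss sP]]].
  by exists [:: 0]; split=> // x x1; exists 0; rewrite ?inE// subr0 expr0.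
exists [seq y + av_pi A ^+ k * f | y <- s, f <- F]; split.
  by rewrite size_allpairs expnSr leq_mul2r ss orbT.
have wk : 0 < w ^+ k by rewrite exprn_gt0// av_pi_gt0.
have p0 : av_pi A ^+ k != 0.
  by apply/eqP => pk; have := avX A (av_pi A) k; rewrite pk av0 => /eqP; rewrite lt_eqF.
move=> x /sP[y ys xy]; have [|f fF xf] := FP ((x - y) / av_pi A ^+ k).
  by rewrite avM avV avX ler_pdivrMr// mul1r.
exists (y + av_pi A ^+ k * f); first by apply/allpairsP; exists (y, f).
rewrite opprD addrA (_ : _ - _ = av_pi A ^+ k * ((x - y) / av_pi A ^+ k - f)); last first.
  by rewrite mulrBr mulrCA divff ?mulr1.
by rewrite avM avX exprSr ler_wpM2l// ltW.
Qed.

(** The interior of the ball: open sets are measurable by the definition of [borel]. *)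
Definition oball (z : affine K n) j : set (affine K n) :=
  [set y | exists2 e : R, 0 < e & cball A y e `<=` cball A z (w ^+ j)].

Lemma oball_open z j : open (oball z j).
Proof.
apply/(open_cball A) => y [e e0 ye]; have C0 := av_cst_gt0 A.
exists (e / (2 * C)); first by rewrite divr_gt0// mulr_gt0.
move=> t yt; exists (e / (2 * C)); first by rewrite divr_gt0// mulr_gt0.
move=> s ts; apply: ye; apply: le_cball (cball_trans yt ts).
by rewrite le_eqVlt; apply/orP; left; apply/eqP; field; rewrite gt_eqF.
Qed.

Lemma oball_sub z j : oball z j `<=` cball A z (w ^+ j).
Proof. by move=> y [e e0]; apply; exact: cball_center (ltW e0). Qed.

Lemma oball_translate z j : oball z j = [set x + z | x in oball 0 j].
Proof.
have sh (y t : affine K n) : (forall e, cball A y e t <-> cball A (y - z) e (t - z)).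
  by move=> e; split=> h i; have := h i; rewrite !mxE opprB addrA subrK.
apply/seteqP; split=> [y [e e0 ye]|_ [y [e e0 ye] <-]].
  exists (y - z); last by rewrite subrK.
  exists e => // t yt i; have := ye (t + z); move=> /(_ _ i).
  rewrite !mxE subr0 addrK; apply; apply/sh; by rewrite addrK.
exists e => // t yt i; have := ye (t - z); move=> /(_ _ i); rewrite !mxE subr0; apply.
by move/sh: yt; rewrite addrK.
Qed.

Lemma oball_mu z j : mu (oball z j) = mu (oball 0 j).
Proof.
rewrite oball_translate; apply: haar.1; apply: open_measurable_borel; exact: oball_open.
Qed.

(** The unit box has measure 1 and is covered by at most q^-(l + l' + j) translates of one ball, all
    of the same measure. *)
Lemma ball_measure : exists c q : R, [/\ 0 < c, 0 < q & forall z j,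
  exists S : set (affine K n), [/\ open S, S `<=` cball A z (w ^+ j) &
    ((c * q ^+ j)%:E <= mu S)%E]].
Proof.
have C0 := av_cst_gt0 A; have w0 := av_pi_gt0 A; have w1 := av_pi_lt1 A.
have [M [M0 net]] := av_net; have [B Bbox] := unit_box_bounded A.
(* Net points of precision w^(j+l) leave room for the constant 2 C inside balls of radius w^j; l'
   below rescales the unit box into the unit ball. *)
have [l wl] := expr_small (ltW w0) w1 (ltac:(by rewrite invr_gt0 mulr_gt0) : 0 < (2 * C)^-1).
have B1 : 0 < `|B| + 1 by rewrite ltr_wpDl.
have [l' wl'] := expr_small (ltW w0) w1 (ltac:(by rewrite invr_gt0) : 0 < (`|B| + 1)^-1).
have Bl : B <= w ^- l'.
  apply: (@le_trans _ _ (`|B| + 1)); first by rewrite ler_wpDr// ler_norm.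
  by rewrite -[leLHS]invrK lef_pV2 ?posrE ?invr_gt0 ?exprn_gt0 ?ltW.
pose q : R := ((M ^ n)%N%:R)^-1.
have Mn0 : 0 < (M ^ n)%N%:R :> R by rewrite ltr0n expn_gt0 M0.
exists (q ^+ (l + l')), q; rewrite exprn_gt0 ?invr_gt0//; split=> // z j.
exists (oball z j); split; [exact: oball_open|exact: oball_sub|].
rewrite oball_mu -exprD.
have [s [ss sP]] := net (l' + (j + l))%N.
pose s' := [seq y / av_pi A ^+ l' | y <- s].
have [S [Ssize SP]] := ffun_seq n s'.
pose P k : set (borel K n) := oball (\row_i nth [ffun=> 0] S k i) j.
have cov : @unit_box R K n `<=` \big[setU/set0]_(k < size S) P k.
  move=> x xbox; rewrite -bigcup_mkord.
  have /choice[y yP] : forall i, exists y, y \in s' /\ a (x 0 i - y) <= w ^+ (j + l).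
    move=> i; have wl0 : 0 < w ^+ l' by rewrite exprn_gt0.
    have p0 : av_pi A ^+ l' != 0.
      by apply/eqP => pk; have := avX A (av_pi A) l'; rewrite pk av0 => /eqP; rewrite lt_eqF.
    have [|y ys xy] := sP (x 0 i * av_pi A ^+ l').
      rewrite avM avX -ler_pdivlMr// div1r; apply: le_trans Bl; exact: Bbox.
    exists (y / av_pi A ^+ l'); split; first exact: map_f.
    rewrite (_ : x 0 i - _ = (x 0 i * av_pi A ^+ l' - y) / av_pi A ^+ l'); last by rewrite mulrBl mulfK.
    by rewrite avM avV avX ler_pdivrMr// -exprD addnC.
  have yS : finfun y \in S by apply: SP => i; exact: (yP i).1.
  exists (index (finfun y) S); first by rewrite /= index_mem.
  rewrite /P nth_index//.
  have wjl : 0 < w ^+ (j + l) by rewrite exprn_gt0.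
  exists (w ^+ (j + l)) => // t xt.
  have yx : cball A (\row_i (finfun y) i) (w ^+ (j + l)) x.
    by move=> i; rewrite mxE ffunE; exact: (yP i).2.
  apply: le_cball (cball_trans yx xt).
  rewrite exprD (_ : C * _ = w ^+ j * (2 * C * w ^+ l)); last by ring.
  rewrite ler_piMr ?exprn_ge0 ?(ltW w0)//.
  by rewrite -ler_pdivlMl ?mulr_gt0// mulr1 ltW.
have mbox : measurable (@unit_box R K n : set (borel K n)).
  rewrite -[X in measurable X]setCK; apply: measurableC.
  by apply: open_measurable_borel; exact: unit_box_closed.
have mP k : (k < size S)%N -> measurable (P k).
  by move=> _; apply: open_measurable_borel; exact: oball_open.
have h1 : (mu (@unit_box R K n) <= \sum_(k < size S) mu (P k))%E.
  exact: content_subadditive.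
rewrite haar.2 in h1.
have {}h1 : (1 <= (size S)%:R%:E * mu (oball (0%R : affine K n) j))%E.
  apply: le_trans h1 _; move: (size S) => N; elim: N => [|N IH].
    by rewrite big_ord0 mul0e.
  rewrite big_ord_recr /= -natr1 EFinD ge0_muleDl ?lee_fin// mul1e.
  by rewrite leeD// /P oball_mu.
have NS : ((size S)%:R <= q ^- (l + l' + j) :> R).
  rewrite Ssize size_map -exprVn invrK !natrX -exprM mulnC exprM.
  rewrite lerXn2r ?nnegrE// -natrX ler_nat; apply: leq_trans ss _.
  by rewrite (_ : l + l' + j = l' + (j + l))%N//; lia.
have q0 : 0 < q by rewrite invr_gt0.
have qk0 : 0 < q ^+ (l + l' + j) by rewrite exprn_gt0.
rewrite -[leRHS]mul1e -(divff (lt0r_neq0 qk0)) EFinM -muleA -[leLHS]mule1.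
rewrite lee_pmul2l// ?lte_fin//; apply: le_trans h1 _.
by apply: lee_wpmul2r; rewrite ?measure_ge0// lee_fin.
Qed.

End BallMeasure.

(** * From divergence to a pole *)

Section PoleOfDivergence.
Context {R : realType} {K : local_field R} {n : nat}.
Variables (mu : {measure set (borel K n) -> \bar R}) (U : set (affine K n)).
Variables (f g : affine K n -> K) (Phi : affine K n -> R[i]).
Local Notation D := (zeta_domain U f g : set (borel K n)).
Local Notation w := (fun x : borel K n => complex.Re (Phi x)).

Lemma eq_rintegrable (F G : borel K n -> R) : (forall x, D x -> F x = G x) ->
  measurable D -> rintegrable mu D F -> rintegrable mu D G.
Proof.
by move=> FG mD; apply: eq_integrable => // x /set_mem Dx; rewrite FG.
Qed.

Lemma modulus_gt0 (A : good_abs K) (x : K) : x != 0 -> 0 < modulus x.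
Proof. by move=> x0; rewrite (modulusE A) exprn_gt0// av_gt0. Qed.

Lemma zeta_integrand_real (A : good_abs K) (e t : R) x : positive Phi -> D x ->
  zeta_integrand f g Phi (e * t)%:C x =
  (laplace_fun w (fun x => e * ln (modulus (f x / g x))) t x)%:C.
Proof.
move=> [_ Phi0] [_ /not_orP[/eqP fx /eqP gx]].
have m0 : 0 < modulus (f x / g x) by rewrite (modulus_gt0 A)// mulf_neq0// invr_eq0.
rewrite /zeta_integrand /cpow /= mul0r cos0 sin0 /laplace_fun.
have := Phi0 x; rewrite lecE /= => /andP[/eqP + _].
case: (Phi x) => a b /= ->; rewrite /powR gt_eqF//.
rewrite (_ : t * (e * _) = e * t * ln (modulus (f x / g x))); last by ring.
by simpc.
Qed.

Lemma ereal_strip (b a : \bar R) : (b < 0)%E -> (0 < a)%E ->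
  exists2 t0 : R, 0 < t0 & forall t : R, `|t| < t0 -> (b < t%:E)%E /\ (t%:E < a)%E.
Proof.
move=> b0 a0.
have [tb tb0 hb] : exists2 t0 : R, 0 < t0 & forall t : R, `|t| < t0 -> (b < t%:E)%E.
  case: b b0 => [r| |]//; last by exists 1 => // t _; rewrite ltNyr.
  rewrite lte_fin => r0; exists (- r); first by rewrite oppr_gt0.
  by move=> t; rewrite ltr_norml opprK lte_fin => /andP[].
have [ta ta0 ha] : exists2 t0 : R, 0 < t0 & forall t : R, `|t| < t0 -> (t%:E < a)%E.
  case: a a0 => [r| |]//; last by exists 1 => // t _; rewrite ltry.
  rewrite lte_fin => r0; exists r => // t.
  by rewrite ltr_norml lte_fin => /andP[].
exists (Num.min tb ta); first by rewrite lt_min tb0.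
by move=> t; rewrite lt_min => /andP[/hb ? /ha].
Qed.

(** Without a pole on the half-line, the real part of Z(e t) is removable at every t > 0, and
    [landau] contradicts the divergence at t1. *)
Lemma pole_of_divergence (A : good_abs K) (e t1 : R) Z :
  `|e| = 1 -> measurable D -> positive Phi -> zeta_continuation mu U f g Phi Z ->
  0 <= t1 ->
  ~ rintegrable mu D (laplace_fun w (fun x => e * ln (modulus (f x / g x))) t1) ->
  exists2 t, 0 < t & zeta_pole mu U f g Phi (e * t)%:C.
Proof.
move=> e1 mD pPhi cZ t10 ndiv; have [mZ [b [a [b0 a0 strip]]]] := cZ.
apply: contrapT => np; apply: ndiv.
set u0 := fun x => e * ln (modulus (f x / g x)).
have w0 x : 0 <= w x.
  by have := pPhi.2 x; rewrite lecE => /andP[_].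
have [t0 t00 ht0] := ereal_strip b0 a0.
have near0 t : `|t| < t0 -> rintegrable mu D (laplace_fun w u0 t) /\
    complex.Re (Z (e * t)%:C) = laplace mu w u0 D t.
  move=> tt0; have [|h1 h2] := ht0 (e * t); first by rewrite normrM e1 mul1r.
  have [[i1 _] ->] := strip (e * t)%:C h1 h2; split.
    apply: eq_rintegrable i1 => // x Dx; by rewrite (zeta_integrand_real A).
  rewrite /= /laplace; apply: eq_Rintegral => x /set_mem Dx.
  by rewrite (zeta_integrand_real A).
have [i0 _] := near0 0 ltac:(by rewrite normr0).
pose s := t0 / 2; have s0 : 0 < s by rewrite divr_gt0.
have [is_ _] := near0 s ltac:(by rewrite gtr0_norm// /s; lra).
have mw : measurable_fun D w.
  apply: eq_measurable_fun (rintegrable_measurable i0) => x _.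
  by rewrite /laplace_fun mul0r expR0 mulr1.
(* Measurability is extracted from integrability at 0 and at s by taking logarithms. u can differ
   from u0 only where w = 0, and there both Laplace integrands vanish. *)
pose u x := (ln (laplace_fun w u0 s x) - ln (w x)) / s.
have mu_ : measurable_fun D u.
  apply: measurable_funM; last exact: measurable_cst.
  apply: measurable_funB; apply: measurableT_comp => //; try exact: measurable_ln.
  exact: rintegrable_measurable is_.
have uE t x : laplace_fun w u t x = laplace_fun w u0 t x.
  rewrite /laplace_fun; have [wx|wx] := eqVneq (w x) 0; first by rewrite wx !mul0r.
  have wx0 : 0 < w x by rewrite lt0r wx w0.
  rewrite /u /laplace_fun lnM ?posrE ?expR_gt0// expRK addrC addKr.
  by rewrite (mulrC s) mulfK ?gt_eqF.
have lE : laplace_fun w u = laplace_fun w u0 by apply/funext => t; apply/funext => x; exact: uE.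
have := @landau _ _ _ mu w u D mD mw mu_ (fun x _ => w0 x)
  (fun t => complex.Re (Z (e * t)%:C)) t0 t00.
rewrite lE; apply => //.
- by move=> t tt0; have := near0 t tt0; rewrite /laplace lE.
- move=> t tpos; apply: removable_Re => // pZ; apply: np.
  by exists t => //; exists Z.
Qed.

End PoleOfDivergence.

Section Divergence.
Context {R : realType} {K : local_field R} (A : good_abs K) {n : nat}.
Variable mu : {measure set (borel K n) -> \bar R}.
Hypothesis haar : normalized_haar mu.
Local Notation a := (av A).
Local Notation C := (av_cst A).
Local Notation w := (av A (av_pi A)).

(** The weak triangle inequality leaves d / C; a variation of at most d / (2 C) costs half of it. *)
Lemma lip_ball_bounds (f : affine K n -> K) (z : affine K n) (l d e : R) :
  0 <= l * e -> (forall y, cball A z e y -> a (f y - f z) <= l * e) ->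
  l * e <= d / (2 * C) ->
  (d <= a (f z) -> forall y, cball A z e y -> d / (2 * C) <= a (f y)) /\
  (forall M, a (f z) <= M -> forall y, cball A z e y -> a (f y) <= C * (M + l * e)).
Proof.
move=> le0 fz led; have C0 := av_cst_gt0 A; split=> [dz|M fM] y zy.
  have : d <= C * (a (f y) + d / (2 * C)).
    apply: le_trans dz _; rewrite (_ : f z = f y - (f y - f z)); last by rewrite opprB addrC subrK.
    apply: le_trans (avD _ _ _) _; rewrite ler_wpM2l ?(ltW C0)// lerD2l avN.
    exact: le_trans (fz y zy) led.
  rewrite -ler_pdivrMl// => h; rewrite -(lerD2r (d / (2 * C))); apply: le_trans h.
  by rewrite le_eqVlt; apply/orP; left; apply/eqP; field; rewrite gt_eqF.
rewrite (_ : f y = f z + (f y - f z)); last by rewrite addrC subrK.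
by apply: le_trans (avD _ _ _) _; rewrite ler_wpM2l ?(ltW C0)// lerD// fz.
Qed.

(* Around the point [x0 + t v] of the curve, on a ball of radius comparable to
   a power of [|t|], the quotient is nonzero and [O(|t|)]; the measure of this
   ball is bounded below by a power of [|t|], so large negative powers of
   [|f / g|] are not integrable. *)
Lemma divergence (D : set (borel K n)) (U : set (affine K n)) (f g : affine K n -> K)
    (h : borel K n -> R) (x0 v : affine K n) (k k1 k2 : nat) (c M d0 r h0 : R) :
  measurable D -> (forall y, U y -> f y != 0 -> g y != 0 -> D y) ->
  0 < r -> cball A x0 r `<=` U -> lip_at A f x0 -> lip_at A g x0 ->
  0 < c -> 0 <= M -> 0 < d0 -> (k2 < k1)%N ->
  (forall t, a t <= d0 -> [/\ c * a t ^+ k <= a (f (x0 + t *: (v : 'rV[K]_n))),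
     a (f (x0 + t *: (v : 'rV[K]_n))) <= M * a t ^+ k1 &
     c * a t ^+ k2 <= a (g (x0 + t *: (v : 'rV[K]_n)))]) ->
  (forall x, D x -> 0 <= h x) -> 0 < h0 -> (forall y, cball A x0 r y -> h0 <= h y) ->
  exists N : nat,
    ~ rintegrable mu D (laplace_fun h (fun x => - ln (modulus (f x / g x))) N%:R).
Proof.
move=> mD UD r0 rU [df [lf [df0 lf0 flip]]] [dg [lg [dg0 lg0 glip]]] c0 M0 d00 k21 fg h_ge0 h00 hh.
have C0 := av_cst_gt0 A; have C1 := av_cst_ge1 A.
have w0 := av_pi_gt0 A; have w1 := av_pi_lt1 A; have w01 := ltW w1.
have [cm [q [cm0 q0 balls]]] := ball_measure A haar.
pose L := lf + lg + 1; have L0 : 0 < L by rewrite /L ltr_wpDl ?addr_ge0.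
pose V := 1 + \sum_i a (v 0 i).
have V1 : 1 <= V by rewrite lerDl sumr_ge0// => i _; exact: av_ge0.
have vV i : a (v 0 i) <= V.
  rewrite /V (bigD1 i)//= ler_wpDl// lerDl sumr_ge0// => j _; exact: av_ge0.
have V0 : 0 < V + 1 by lra.
have cCL : 0 < c / (2 * C) / L by rewrite !divr_gt0// mulr_gt0.
(* l and e make the variation of f and g on a ball of radius |t|^e w^l at most c |t|^m / (2 C) for m
   = k, k1 and k2. *)
have [l wl] := expr_small (ltW w0) w1 cCL.
pose e := (k + k1 + k2)%N.
have ke : (k <= e)%N by rewrite /e -addnA leq_addr.
have k1e : (k1 <= e)%N by rewrite /e addnAC leq_addl.
have k2e : (k2 <= e)%N by rewrite /e leq_addl.
have e_gt0 : (0 < e)%N by apply: leq_trans k1e; apply: leq_ltn_trans k21.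
have lfL : lf <= L by rewrite /L -addrA ler_wpDr// addr_ge0.
have lgL : lg <= L by rewrite /L addrAC ler_wpDl// addr_ge0.
pose R0 := Num.min r (Num.min df dg).
have R00 : 0 < R0 by rewrite !lt_min r0 df0.
(* The bound C (M + c) |t|^k1 for f, over the lower bound c |t|^k2 / (2 C) for g. *)
pose M2 := C * (M + c) / (c / (2 * C)).
have Mc : 0 < M + c by rewrite ltr_wpDl.
have cC : 0 < c / (2 * C) by rewrite divr_gt0// mulr_gt0.
have M20 : 0 < M2 by rewrite /M2 divr_gt0// mulr_gt0.
have M2E : M2 * (c / (2 * C)) = C * (M + c) by rewrite divfK// gt_eqF.
clearbody M2.
have min0 : 0 < Num.min d0 (Num.min (R0 / (C * (V + 1))) M2^-1).
  by rewrite !lt_min d00 invr_gt0 M20 andbT /= divr_gt0// mulr_gt0.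
have [j0 wj0] := expr_small (ltW w0) w1 min0.
(* As 2 w^N < q^e, at t = [av_pi]^j the growth (w^j)^-N of the integrand outweighs the decay q^(j e)
   of the measure by a factor 2^j. *)
have [N wN] := expr_small (ltW w0) w1 (divr_gt0 (exprn_gt0 e q0) (ltr0Sn R 1)).
exists N => iN.
set F := laplace_fun _ _ _ in iN.
have mF := rintegrable_measurable iN.
pose I0 := \int[mu]_(x in D) F x.
have key j : (j0 <= j)%N ->
    h0 * (M2 * w ^+ j) ^- N * (cm * q ^+ (j * e + l)) <= I0.
  move=> j0j; pose t := av_pi A ^+ j; have tE : a t = w ^+ j by rewrite avX.
  have : w ^+ j < Num.min d0 (Num.min (R0 / (C * (V + 1))) M2^-1).
    by apply: le_lt_trans wj0; rewrite ler_wiXn2l// ltW.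
  rewrite !lt_min => /and3P[jd jR jM].
  have tpos : 0 < a t by rewrite tE exprn_gt0.
  have t1 : a t <= 1 by rewrite tE exprn_ile1// ltW.
  have td : a t <= d0 by rewrite tE ltW.
  pose z : affine K n := x0 + t *: (v : 'rV[K]_n).
  have [f1 f2 g1] := fg t td; rewrite -/z in f1 f2 g1.
  pose rho := w ^+ (j * e + l).
  have rhoE : rho = a t ^+ e * w ^+ l by rewrite /rho exprD exprM tE.
  have rho0 : 0 <= rho by rewrite exprn_ge0// ltW.
  have rhot m : (m <= e)%N -> L * rho <= c / (2 * C) * a t ^+ m.
    move=> me; rewrite rhoE (_ : L * _ = L * w ^+ l * a t ^+ e); last by ring.
    apply: ler_pM; rewrite ?exprn_ge0 ?mulr_ge0 ?exprn_ge0 ?av_ge0 ?(ltW L0)//.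
      by rewrite mulrC -ler_pdivlMr// ltW.
    by rewrite ler_wiXn2l ?av_ge0.
  have zR y : cball A z rho y -> cball A x0 R0 y.
    move=> zy; have x0z : cball A x0 (a t * V) z.
      by move=> i; rewrite !mxE [X in X - _]addrC addrK avM ler_wpM2l ?av_ge0.
    apply: le_cball (cball_trans x0z zy).
    apply: (@le_trans _ _ (C * (a t * V + a t))).
      rewrite ler_wpM2l ?(ltW C0)// lerD2l rhoE.
      apply: (@le_trans _ _ (a t ^+ e)).
        by rewrite ler_piMr ?exprn_ge0 ?av_ge0// exprn_ile1// ltW.
      by rewrite -[leRHS]expr1 ler_wiXn2l ?av_ge0.
    rewrite (_ : C * _ = w ^+ j * (C * (V + 1))); last by rewrite tE; ring.
    by rewrite -ler_pdivlMr ?mulr_gt0// ltW.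
  have zz : cball A z rho z by exact: cball_center.
  have Rr : R0 <= r by rewrite ge_min lexx.
  have Rf : R0 <= df by rewrite !ge_min lexx orbT.
  have Rg : R0 <= dg by rewrite !ge_min lexx !orbT.
  have fz y : cball A z rho y -> a (f y - f z) <= lf * rho.
    move=> zy; apply: flip => //; exact: le_cball (zR _ _).
  have gz y : cball A z rho y -> a (g y - g z) <= lg * rho.
    move=> zy; apply: glip => //; exact: le_cball (zR _ _).
  have lfr m : (m <= e)%N -> lf * rho <= c * a t ^+ m / (2 * C).
    move=> me; rewrite mulrAC; apply: le_trans (rhot m me).
    by rewrite ler_wpM2r.
  have lgr m : (m <= e)%N -> lg * rho <= c * a t ^+ m / (2 * C).
    move=> me; rewrite mulrAC; apply: le_trans (rhot m me).
    by rewrite ler_wpM2r.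
  have [flow _] := lip_ball_bounds (mulr_ge0 lf0 rho0) fz (lfr k ke).
  have [_ fup] := lip_ball_bounds (mulr_ge0 lf0 rho0) fz (lfr k1 k1e).
  have [glow _] := lip_ball_bounds (mulr_ge0 lg0 rho0) gz (lgr k2 k2e).
  have [S [oS SB mS]] := balls z (j * e + l)%N.
  have Sf y : S y -> f y != 0.
    move=> /SB/(flow f1) h1; apply: contraTneq h1 => ->; rewrite av0 -ltNge.
    by rewrite divr_gt0 ?mulr_gt0 ?exprn_gt0.
  have Sg y : S y -> g y != 0.
    move=> /SB/(glow g1) h1; apply: contraTneq h1 => ->; rewrite av0 -ltNge.
    by rewrite divr_gt0 ?mulr_gt0 ?exprn_gt0.
  have SD : S `<=` D.
    by move=> y Sy; apply: UD; [apply: rU; apply: le_cball Rr _ _; apply: zR; exact: SB|exact: Sf|exact: Sg].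
  have quot y : S y -> modulus (f y / g y) <= M2 * w ^+ j.
    move=> Sy; have fy := fup _ f2 y (SB _ Sy); have gy := glow g1 y (SB _ Sy).
    have fg1 : a (f y / g y) <= M2 * w ^+ j.
      rewrite avM avV ler_pdivrMr ?av_gt0 ?Sg//.
      apply: (@le_trans _ _ (M2 * w ^+ j * (c * a t ^+ k2 / (2 * C)))); last first.
        by rewrite ler_wpM2l// mulr_ge0 ?(ltW M20)// exprn_ge0// ltW.
      apply: le_trans fy _.
      have -> : M2 * w ^+ j * (c * a t ^+ k2 / (2 * C)) = C * (M + c) * (a t ^+ k2.+1).
        by rewrite -M2E -tE exprS; ring.
      rewrite -mulrA ler_wpM2l ?(ltW C0)// mulrDl.
      apply: (@le_trans _ _ (M * a t ^+ k1 + c * a t ^+ k1)).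
        rewrite lerD2l; apply: le_trans (lfr k1 k1e) _.
        rewrite ler_pdivrMr ?mulr_gt0// ler_peMr ?mulr_ge0 ?exprn_ge0 ?av_ge0 ?(ltW c0)//.
        by rewrite mulr_ege1// ler1n.
      by rewrite lerD// ler_wpM2l ?(ltW c0)// ler_wiXn2l ?av_ge0.
    have fg2 : a (f y / g y) <= 1.
      by apply: le_trans fg1 _; rewrite -ler_pdivlMl// mulr1 ltW.
    (* The absolute value of the quotient is at most 1, so its power [av_deg], the modulus, is no
       larger. *)
    rewrite (modulusE A); apply: le_trans fg1.
    by rewrite -[leRHS]expr1 ler_wiXn2l ?av_ge0// av_deg_gt0.
  pose b := h0 * (M2 * w ^+ j) ^- N.
  have b0 : 0 <= b by rewrite mulr_ge0 ?(ltW h00)// invr_ge0 exprn_ge0// mulr_ge0 ?(ltW M20)// exprn_ge0// ltW.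
  have SF y : S y -> b <= F y.
    move=> Sy; have m0 : 0 < modulus (f y / g y).
      by rewrite (modulus_gt0 A)// mulf_neq0 ?invr_eq0 ?Sf ?Sg.
    rewrite /F /laplace_fun expRM_natl expRN lnK ?posrE//.
    apply: ler_pM; first exact: ltW.
    - by rewrite invr_ge0 exprn_ge0// mulr_ge0 ?(ltW M20)// exprn_ge0// ltW.
    - by apply: hh; apply: le_cball Rr _ _; apply: zR; exact: SB.
    - rewrite exprVn lef_pV2 ?posrE ?exprn_gt0// ?mulr_gt0 ?exprn_gt0//.
      by rewrite lerXn2r ?nnegrE ?(ltW m0) ?quot// mulr_ge0 ?(ltW M20)// exprn_ge0// ltW.
  have mSS : measurable (S : set (borel K n)) by exact: open_measurable_borel.
  have F0 x : D x -> 0 <= F x by move=> Dx; rewrite mulr_ge0 ?expR_ge0 ?h_ge0.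
  have I0E : (I0%:E = \int[mu]_(x in D) (F x)%:E)%E.
    by rewrite fineK//; exact: integrable_fin_num iN.
  suff : ((b * (cm * q ^+ (j * e + l)))%:E <= I0%:E)%E by rewrite lee_fin; exact: id.
  rewrite I0E.
  apply: (@le_trans _ _ (\int[mu]_(x in S) (F x)%:E)%E); last first.
    apply: ge0_subset_integral => //; first exact/measurable_EFinP.
  apply: (@le_trans _ _ (\int[mu]_(x in S) b%:E)%E); last first.
    apply: ge0_le_integral => //.
    by apply/measurable_EFinP; exact: (measurable_funS mD SD mF).
  have -> : (\int[mu]_(x in S) b%:E)%E = (b%:E * mu S)%E by exact: integral_cst.
  by rewrite EFinM lee_wpmul2l// lee_fin.
pose A0 := h0 * cm * q ^+ l * M2 ^- N.
have A00 : 0 < A0 by rewrite !mulr_gt0 ?invr_gt0 ?exprn_gt0.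
have grow j : (j0 <= j)%N -> A0 * 2 ^+ j <= I0.
  move=> /key; apply: le_trans.
  have -> : h0 * (M2 * w ^+ j) ^- N * (cm * q ^+ (j * e + l)) = A0 * (q ^+ e / w ^+ N) ^+ j.
    rewrite /A0 exprMn exprD [(j * e)%N]mulnC (exprM q) expr_div_n -(exprM w) mulnC exprM.
    have := exprn_gt0 j (exprn_gt0 N w0); have := exprn_gt0 N M20.
    move: (M2 ^+ N) ((w ^+ N) ^+ j) ((q ^+ e) ^+ j) (q ^+ l) => a1 a2 a3 a4 a10 a20.
    by field; rewrite !gt_eqF.
  rewrite ler_wpM2l ?(ltW A00)// lerXn2r ?nnegrE ?divr_ge0 ?exprn_ge0 ?(ltW q0) ?(ltW w0)//.
  by rewrite ler_pdivlMr ?exprn_gt0//; move: wN; rewrite ltr_pdivlMr// mulrC => /ltW.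
have I0j : I0 / A0 < (Num.bound (I0 / A0))%:R.
  apply: archi_boundP; rewrite divr_ge0 ?(ltW A00)//.
  by apply: le_trans (grow j0 (leqnn _)); rewrite mulr_ge0 ?exprn_ge0 ?(ltW A00).
set m := Num.bound _ in I0j.
have := grow (maxn j0 m) (leq_maxl _ _).
apply/negP; rewrite -ltNge -ltr_pdivrMl// mulrC; apply: lt_le_trans I0j _.
rewrite -natrX ler_nat; apply: leq_trans (leq_maxr j0 m) _.
by apply: ltnW; exact: ltn_expl.
Qed.

End Divergence.

Section PoleOnCurve.
Context {R : realType} {K : local_field R} (A : good_abs K) {n : nat}.
Local Notation a := (av A).

Lemma test_near (Phi : affine K n -> R[i]) x (e : R) : test_regularity Phi -> 0 < e ->
  \forall y \near x, `|complex.Re (Phi y) - complex.Re (Phi x)| < e.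
Proof.
move=> + e0; clear A; case: K Phi x => [||p Qp L] Phi x /=.
- by move=> /(_ 0%N)[[cPhi _] _]; move/cvgrPdistC_lt: (cPhi x); apply.
- by move=> /(_ 0%N)[[cPhi _] _]; move/cvgrPdistC_lt: (cPhi x); apply.
- by move=> /(_ x); apply: filterS => y ->; rewrite subrr normr0.
Qed.

Lemma test_positive_near (U : set (affine K n)) (Phi : affine K n -> R[i]) x :
  test_function U Phi -> positive Phi -> Phi x != 0 ->
  exists r h : R, [/\ 0 < r, 0 < h & forall y, cball A x r y -> h <= complex.Re (Phi y)].
Proof.
move=> [tPhi _ _] [_ Phi0] Phix.
have Px : 0 < complex.Re (Phi x).
  by have := Phi0 x; rewrite le_eqVlt eq_sym (negbTE Phix) /= ltcE => /andP[].
have h0 : 0 < complex.Re (Phi x) / 2 by rewrite divr_gt0.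
have [r r0 rP] := (nbhs_cball A _ _).1 (test_near x tPhi h0).
exists r, (complex.Re (Phi x) / 2); split=> // y /rP /=.
by rewrite ltr_norml => /andP[+ _]; lra.
Qed.

Variables (mu : {measure set (borel K n) -> \bar R}) (U : set (affine K n)).
Variables (f g : affine K n -> K).
Hypothesis haar : normalized_haar mu.
Hypothesis oU : open U.
Hypotheses (lf : forall x, U x -> lip_at A f x) (lg : forall x, U x -> lip_at A g x).

(** The domain is open, because f and g stay nonzero near a point where they are nonzero. *)
Lemma zeta_domain_measurable : measurable (zeta_domain U f g : set (borel K n)).
Proof.
apply: open_measurable_borel; apply/(open_cball A) => x [Ux /not_orP[/eqP fx /eqP gx]].
have [r r0 rU] := (open_cball A U).1 oU x Ux.
have [d [c [d0 c0 fd]]] := lip_at_neq0 (lf Ux) fx.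
have [d' [c' [d'0 c'0 gd]]] := lip_at_neq0 (lg Ux) gx.
exists (Num.min r (Num.min d d')); first by rewrite !lt_min r0 d0.
move=> y xy; split; first by apply: rU; apply: le_cball xy; rewrite ge_min lexx.
have xyd : cball A x d y by apply: le_cball xy; rewrite !ge_min lexx orbT.
have xyd' : cball A x d' y by apply: le_cball xy; rewrite !ge_min lexx !orbT.
case=> y0.
  by have := fd y xyd; rewrite y0 av0 leNgt c0.
by have := gd y xyd'; rewrite y0 av0 leNgt c'0.
Qed.

(** The exponents k and k1 may differ: the lower bound keeps f away from 0 on small balls around the
    line, while k2 < k1 makes the quotient tend to 0. *)
Definition curve_bounds (f g : affine K n -> K) (x0 v : affine K n) :=
  exists (k k1 k2 : nat) (c M d : R), [/\ 0 < c, 0 <= M, 0 < d, (k2 < k1)%N &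
  forall t, a t <= d -> [/\ c * a t ^+ k <= a (f (x0 + t *: (v : 'rV[K]_n))),
     a (f (x0 + t *: (v : 'rV[K]_n))) <= M * a t ^+ k1 &
     c * a t ^+ k2 <= a (g (x0 + t *: (v : 'rV[K]_n)))]].

Variables (Phi : affine K n -> R[i]) (x0 v : affine K n) (Z : R[i] -> R[i]).
Hypotheses (tPhi : test_function U Phi) (pPhi : positive Phi).
Hypotheses (Ux0 : U x0) (Phix0 : Phi x0 != 0).
Hypothesis cZ : zeta_continuation mu U f g Phi Z.

Lemma curve_setup : exists r h : R, [/\ 0 < r, 0 < h, cball A x0 r `<=` U &
  forall y, cball A x0 r y -> h <= complex.Re (Phi y)].
Proof.
have [r [h [r0 h0 hP]]] := test_positive_near tPhi pPhi Phix0.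
have [r' r'0 rU] := (open_cball A U).1 oU x0 Ux0.
exists (Num.min r r'), h; split=> //; first by rewrite lt_min r0.
  by move=> y xy; apply: rU; apply: le_cball xy; rewrite ge_min lexx orbT.
by move=> y xy; apply: hP; apply: le_cball xy; rewrite ge_min lexx.
Qed.

Lemma Re_positive_ge0 x : 0 <= complex.Re (Phi x).
Proof. by have := pPhi.2 x; rewrite lecE => /andP[_]. Qed.

Lemma negative_pole : curve_bounds f g x0 v ->
  exists2 s : R, s < 0 & zeta_pole mu U f g Phi s%:C.
Proof.
move=> [k [k1 [k2 [c [M [d [c0 M0 d0 k21 fg]]]]]]].
have [r [h [r0 h0 rU hP]]] := curve_setup.
have mD := zeta_domain_measurable.
have [||N ndiv] := @divergence _ _ A _ mu haar _ U f g (fun x => complex.Re (Phi x)) x0 v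
  k k1 k2 c M d r h mD _ r0 rU (lf Ux0) (lg Ux0) c0 M0 d0 k21 fg _ h0 hP.
- by move=> y Uy fy gy; split=> //; case=> /eqP; [rewrite (negbTE fy)|rewrite (negbTE gy)].
- by move=> x _; exact: Re_positive_ge0.
have [|||t t0 pt] := @pole_of_divergence _ _ _ mu U f g Phi A (-1) N%:R Z _ mD pPhi cZ _ _.
- by rewrite normrN1.
- by [].
- by under [X in laplace_fun _ X]eq_fun do rewrite mulN1r.
by exists (- t); [rewrite oppr_lt0|rewrite -mulN1r].
Qed.

Lemma positive_pole : curve_bounds g f x0 v ->
  exists2 s : R, 0 < s & zeta_pole mu U f g Phi s%:C.
Proof.
move=> [k [k1 [k2 [c [M [d [c0 M0 d0 k21 fg]]]]]]].
have [r [h [r0 h0 rU hP]]] := curve_setup.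
have mD := zeta_domain_measurable.
have [||N ndiv] := @divergence _ _ A _ mu haar (zeta_domain U f g) U g f (fun x => complex.Re (Phi x)) x0 v
  k k1 k2 c M d r h mD _ r0 rU (lg Ux0) (lf Ux0) c0 M0 d0 k21 fg _ h0 hP.
- by move=> y Uy fy gy; split=> //; case=> /eqP; [rewrite (negbTE gy)|rewrite (negbTE fy)].
- by move=> x _; exact: Re_positive_ge0.
have [|||t t0 pt] := @pole_of_divergence _ _ _ mu U f g Phi A 1 N%:R Z _ mD pPhi cZ _ _.
- by rewrite normr1.
- by [].
(* The divergence was obtained for the swapped pair, and - ln |g/f|_K = ln |f/g|_K. *)
- move=> iN; apply: ndiv; apply: eq_rintegrable iN => // x [_ /not_orP[/eqP fx /eqP gx]].
  rewrite /laplace_fun mul1r -lnV ?posrE; last first.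
    by rewrite (modulus_gt0 A)// mulf_neq0// invr_eq0.
  by rewrite -[g x / f x]invf_div !(modulusE A) avV exprVn invrK.
by exists t => //; rewrite -[t]mul1r.
Qed.

End PoleOnCurve.

Section AnalyticCurve.
Context {R : realType} {K : local_field R} (A : good_abs K) {n : nat}.
Local Notation a := (av A).

Lemma analytic_curve_bounds (U : set (affine K n)) (f g : affine K n -> K) x0 :
  open U -> U x0 -> analytic_at f x0 -> analytic_at g x0 -> nowhere_zero_germ U f ->
  f x0 = 0 -> g x0 != 0 -> exists v, curve_bounds A f g x0 v.
Proof.
move=> oU Ux0 af ag nf fx0 gx0.
have [|v [k [c [d [c0 d0 fv]]]]] := analytic_line_lower (A := A) af.
  move=> e e0; have nb : nbhs x0 (U `&` cball A x0 e).
    apply: filterI; first exact: open_nbhs_nbhs.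
    by apply/(nbhs_cball A); exists e.
  have [||y] := nf ((U `&` cball A x0 e)^°) (@open_interior _ _).
  - by move=> y /interior_subset[].
  - by exists x0.
  - by move=> /interior_subset[_ xy] fy; exists y.
have [df [l [df0 l0 flip]]] := analytic_lip A af.
have [dg [c' [dg0 c'0 gc]]] := lip_at_neq0 (analytic_lip A ag) gx0.
pose V := 1 + \sum_i a (v 0 i).
have V0 : 0 < V by rewrite ltr_pwDl// sumr_ge0// => i _; exact: av_ge0.
have vV i : a (v 0 i) <= V.
  rewrite /V (bigD1 i)//= ler_wpDl// lerDl sumr_ge0// => j _; exact: av_ge0.
have ball t (e : R) : a t <= e / V -> cball A x0 e (x0 + t *: (v : 'rV[K]_n)).
  move=> te i; rewrite !mxE [X in X - _]addrC addrK avM.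
  apply: (@le_trans _ _ (a t * V)); first by rewrite ler_wpM2l ?av_ge0.
  by rewrite -ler_pdivlMr.
have ball' t : cball A x0 (a t * V) (x0 + t *: (v : 'rV[K]_n)).
  by apply: ball; rewrite mulfK// gt_eqF.
(* The Lipschitz bound and f x0 = 0 give k1 = 1; g x0 != 0 gives k2 = 0. *)
exists v, k, 1%N, 0%N, (Num.min c c'), (l * V), (Num.min d (Num.min (df / V) (dg / V))); split=> //.
- by rewrite lt_min c0.
- by rewrite mulr_ge0// ltW.
- by rewrite !lt_min d0 !divr_gt0.
move=> t; rewrite !le_min => /and3P[td tf tg]; split.
- apply: le_trans (fv t td); rewrite ler_wpM2r ?exprn_ge0 ?av_ge0//.
  by rewrite ge_min lexx.
- rewrite expr1 -mulrA (mulrC V) -[f _]subr0 -fx0.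
  apply: flip; [exact: ball|exact: cball_center (ltW df0)|by rewrite mulr_ge0 ?av_ge0 ?ltW|exact: ball'].
- rewrite expr0 mulr1; apply: le_trans (gc _ (ball _ _ tg)).
  by rewrite ge_min lexx orbT.
Qed.

End AnalyticCurve.

Lemma good_abs_inhabited (R : realType) (K : local_field R) : inhabited (good_abs K).
Proof.
case: K => [||p Qp L]; [constructor; exact: good_abs_real|constructor; exact: good_abs_complex|].
exact: good_abs_padic.
Qed.

(** * Quotients of polynomials *)

Section PolyCurve.

(** After division by the gcd, one of the two polynomials is nonconstant, as the quotient takes two
    values. Its root z is not a root of the other one, so the orders of p and q at z differ even
    when the gcd vanishes there. *)
Lemma common_factor_orders (F : closedFieldType) (p q : {poly F}) :
  q.[0] != 0 -> q.[1] != 0 -> p.[0] / q.[0] != p.[1] / q.[1] ->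
  exists (z : F) (i j : nat) (p1 q1 : {poly F}),
    [/\ i != j, p = p1 * ('X - z%:P) ^+ i, q = q1 * ('X - z%:P) ^+ j,
        p1.[z] != 0 & q1.[z] != 0].
Proof.
move=> q0 q1 pq.
have qn0 : q != 0 by apply: contraNneq q0 => ->; rewrite horner0.
have pn0 : p != 0.
  by apply: contraNneq pq => ->; rewrite !horner0 !mul0r.
pose d := gcdp p q.
have dn0 : d != 0 by rewrite gcdp_eq0 negb_and pn0.
have pE : p = p %/ d * d by rewrite divpK// dvdp_gcdl.
have qE : q = q %/ d * d by rewrite divpK// dvdp_gcdr.
have cop : coprimep (p %/ d) (q %/ d).
  by apply: coprimep_div_gcd; rewrite pn0.
set p' := p %/ d in pE cop; set q' := q %/ d in qE cop.
have p'n0 : p' != 0 by apply: contraNneq pn0 => h; rewrite pE h mul0r.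
have q'n0 : q' != 0 by apply: contraNneq qn0 => h; rewrite qE h mul0r.
have root_case (a b : {poly F}) : a != 0 -> b != 0 -> coprimep a b -> size a != 1%N ->
    exists (z : F) (i j : nat) (a1 b1 : {poly F}),
    [/\ (j < i)%N, a * d = a1 * ('X - z%:P) ^+ i, b * d = b1 * ('X - z%:P) ^+ j,
        a1.[z] != 0 & b1.[z] != 0].
  move=> a0 b0 ab sa; have /closed_rootP[z az] := sa.
  have bz : b.[z] != 0 by exact: coprimep_root ab az.
  have [i [a1 + aE]] := multiplicity_XsubC a z; rewrite a0 rootE /= => a1z.
  have [j [d1 + dE]] := multiplicity_XsubC d z; rewrite dn0 rootE /= => d1z.
  have i0 : (0 < i)%N.
    rewrite lt0n; apply/eqP => i0; move: az; rewrite aE i0 expr0 mulr1 rootE.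
    by rewrite (negbTE a1z).
  exists z, (i + j)%N, j, (a1 * d1), (b * d1); split.
  - by rewrite -[X in (X < _)%N]add0n ltn_add2r.
  - by rewrite {1}aE {1}dE exprD; ring.
  - by rewrite {1}dE mulrA.
  - by rewrite hornerM mulf_neq0.
  - by rewrite hornerM mulf_neq0.
have [sp|sp] := eqVneq (size p') 1%N; last first.
  have [z [i [j [a1 [b1 [ij h1 h2 h3 h4]]]]]] := root_case p' q' p'n0 q'n0 cop sp.
  by exists z, i, j, a1, b1; rewrite -h1 -h2; split; rewrite // gtn_eqF.
have [sq|sq] := eqVneq (size q') 1%N; last first.
  rewrite coprimep_sym in cop.
  have [z [i [j [a1 [b1 [ij h1 h2 h3 h4]]]]]] := root_case q' p' q'n0 p'n0 cop sq.
  by exists z, j, i, b1, a1; rewrite -h1 -h2; split; rewrite // ltn_eqF.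
have /size_poly1P[a a0 aE] : size p' == 1%N by rewrite sp.
have /size_poly1P[b b0 bE] : size q' == 1%N by rewrite sq.
case/negP: pq; move: q0 q1; rewrite qE pE aE bE !hornerM !hornerC.
rewrite !mulf_eq0 !negb_or => /andP[_ d0] /andP[_ d1].
by rewrite -!mulf_div !divff ?mulr1.
Qed.

Context {R : realType} {K : local_field R} (A : good_abs K) {n : nat}.
Local Notation a := (av A).

Lemma factored_bounds (p p1 : {poly K}) z i : p = p1 * ('X - z%:P) ^+ i -> p1.[z] != 0 ->
  exists c M d : R, [/\ 0 < c, 0 <= M, 0 < d & forall t, a t <= d ->
    c * a t ^+ i <= a p.[z + t] /\ a p.[z + t] <= M * a t ^+ i].
Proof.
move=> pE pz; pose r := p1 \Po ('X + z%:P).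
have rE t : r.[t] = p1.[z + t] by rewrite horner_comp !hornerE addrC.
have r0 : r.[0] != 0 by rewrite rE addr0.
have [c [d [c0 d0 rd]]] := horner_near0 A r0.
have [M M0 rM] := horner_bounded A r.
exists c, M, (Num.min 1 d); split=> //; first by rewrite lt_min ltr01.
move=> t; rewrite le_min => /andP[t1 td].
have pt : a p.[z + t] = a r.[t] * a t ^+ i.
  by rewrite pE hornerM horner_exp hornerXsubC [z + t]addrC addrK avM avX rE addrC.
by rewrite pt; split; rewrite ler_wpM2r ?exprn_ge0 ?av_ge0 ?rd ?rM.
Qed.

Lemma polynomial_curve_bounds (f g : affine K n -> K) (p q p1 q1 : {poly K})
    (x v : affine K n) z i j : (j < i)%N ->
  (forall t, f (x + t *: (v : 'rV[K]_n)) = p.[t]) ->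
  (forall t, g (x + t *: (v : 'rV[K]_n)) = q.[t]) ->
  p = p1 * ('X - z%:P) ^+ i -> q = q1 * ('X - z%:P) ^+ j -> p1.[z] != 0 -> q1.[z] != 0 ->
  curve_bounds A f g (x + z *: (v : 'rV[K]_n)) v.
Proof.
move=> ji fp gq pE qE p1z q1z.
have [c [M [d [c0 M0 d0 pb]]]] := factored_bounds pE p1z.
have [c' [M' [d' [c'0 M'0 d'0 qb]]]] := factored_bounds qE q1z.
exists i, i, j, (Num.min c c'), M, (Num.min d d'); split=> //; rewrite ?lt_min ?c0 ?d0//.
move=> t; rewrite le_min => /andP[td td'].
have [h1 h2] := pb t td; have [h3 _] := qb t td'.
rewrite -!addrA -!scalerDl fp gq; split=> //.
  by apply: le_trans h1; rewrite ler_wpM2r ?exprn_ge0 ?av_ge0// ge_min lexx.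
by apply: le_trans h3; rewrite ler_wpM2r ?exprn_ge0 ?av_ge0// ge_min lexx orbT.
Qed.

Lemma lip_at_sum I (s : seq I) (F : I -> affine K n -> K) x :
  (forall i, lip_at A (F i) x) -> lip_at A (fun y => \sum_(i <- s) F i y) x.
Proof.
move=> lF; elim: s => [|i s IH].
  by under eq_fun do rewrite big_nil; exact: lip_at_cst.
by under eq_fun do rewrite big_cons; exact: lip_atD.
Qed.

Lemma lip_at_prod I (s : seq I) (F : I -> affine K n -> K) x :
  (forall i, lip_at A (F i) x) -> lip_at A (fun y => \prod_(i <- s) F i y) x.
Proof.
move=> lF; elim: s => [|i s IH].
  by under eq_fun do rewrite big_nil; exact: lip_at_cst.
by under eq_fun do rewrite big_cons; exact: lip_atM.
Qed.

Lemma lip_atX (f : affine K n -> K) k x : lip_at A f x -> lip_at A (fun y => f y ^+ k) x.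
Proof.
move=> lf; elim: k => [|k IH].
  by under eq_fun do rewrite expr0; exact: lip_at_cst.
by under eq_fun do rewrite exprS; exact: lip_atM.
Qed.

End PolyCurve.

Section MultivariatePolynomials.
Context {R : realType} {n : nat}.
Local Notation K := (@ComplexField R).

Lemma poly_funE (P : mpoly.mpoly n R[i]) (x : affine K n) :
  poly_fun P x = \sum_(m <- mpoly.msupp P) mpoly.mcoeff m P * \prod_j x 0 j ^+ (m : mpoly.multinom n) j.
Proof. by []. Qed.

Lemma poly_fun_lip (A : good_abs K) (P : mpoly.mpoly n R[i]) x : lip_at A (poly_fun P) x.
Proof.
apply: lip_at_sum => m; apply: lip_atM; first exact: lip_at_cst.
by apply: lip_at_prod => j; apply: lip_atX; exact: lip_at_coord.
Qed.

Lemma poly_fun_line (P : mpoly.mpoly n R[i]) (x v : affine K n) :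
  exists p : {poly K}, forall t : K, poly_fun P (x + t *: (v : 'rV[K]_n)) = p.[t].
Proof.
exists (\sum_(m <- mpoly.msupp P) (mpoly.mcoeff m P : K)%:P *
  \prod_j ((x 0 j)%:P + (v 0 j)%:P * 'X) ^+ (m : mpoly.multinom n) j).
move=> t; rewrite poly_funE horner_sum; apply: eq_bigr => m _.
rewrite hornerM hornerC horner_prod; congr (_ * _); apply: eq_bigr => j _.
by rewrite horner_exp !hornerE !mxE mulrC.
Qed.

End MultivariatePolynomials.

(** * Bump functions *)

Section Flat.
Context {R : realType}.

(* [flat 0] is the usual flat function [exp(-1/s)]; the family is closed under
   differentiation up to linear combinations. *)
Definition flat (j : nat) (s : R) : R := if 0 < s then s ^- j * expR (- s^-1) else 0.

Lemma flat_ge0 j s : 0 <= flat j s.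
Proof.
by rewrite /flat; case: ifP => // s0; rewrite mulr_ge0 ?expR_ge0// invr_ge0 exprn_ge0// ltW.
Qed.

(** The term of degree j + 2 in the exponential series of 1/s gives exp(-1/s) <= (j+2)! s^(j+2); the
    remaining square makes the derivative at 0 vanish. *)
Lemma flat_le j s : `|flat j s| <= (j.+2)`!%:R * s ^+ 2.
Proof.
rewrite /flat; case: ifP => s0; last by rewrite normr0 mulr_ge0// sqr_ge0.
have V0 : 0 < s^-1 by rewrite invr_gt0.
rewrite ger0_norm ?mulr_ge0 ?expR_ge0 ?invr_ge0 ?exprn_ge0 ?(ltW s0)//.
have f0 : 0 < (j.+2)`!%:R :> R by rewrite ltr0n fact_gt0.
have h2 : expR (- s^-1) <= (j.+2)`!%:R * s ^+ j.+2.
  have := exp_term_le j.+2 (ltW V0); rewrite exprVn expRN.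
  have := exprn_gt0 j.+2 s0; move: (s ^+ _) => a a0 h.
  rewrite -[leRHS]invrK lef_pV2 ?posrE ?expR_gt0 ?invr_gt0 ?mulr_gt0//.
  by rewrite invfM mulrC.
apply: (@le_trans _ _ (s ^- j * ((j.+2)`!%:R * s ^+ j.+2))).
  by rewrite ler_wpM2l// invr_ge0 exprn_ge0// ltW.
by rewrite -addn2 exprD mulrCA mulKf// expf_neq0// gt_eqF.
Qed.

Lemma is_derive_flat j (s : R) :
  is_derive s 1 (flat j) (- j%:R * flat j.+1 s + flat j.+2 s).
Proof.
have [s0|s0|->] := ltrgtP s 0.
- have -> : - j%:R * flat j.+1 s + flat j.+2 s = 0.
    by rewrite /flat ltNge (ltW s0) mulr0 addr0.
  have H : is_derive s 1 (cst (0 : R)) (0 : R) by exact: is_derive_cst.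
  apply: near_eq_is_derive H.
  have : \forall t \near s, t < 0 by apply: lt_nbhsl.
  by apply: filterS => t t0; rewrite /flat ltNge (ltW t0).
- have sn0 : s != 0 by rewrite gt_eqF.
  have dV := @is_deriveV R id s 1 1 sn0 (is_derive_id _ _).
  have dN : is_derive s 1 (fun t : R => - t^-1) (s ^- 2).
    by have := is_deriveN dV; rewrite /GRing.scale /= mulr1 opprK.
  have dE := @is_derive1_comp R expR (fun t => - t^-1) s _ _ (is_derive_expR (- s^-1)) dN.
  have dX := is_deriveX j dV.
  have H := is_deriveM dX dE.
  have {}H : is_derive s 1 ((fun t : R => t^-1) ^+ j * (expR \o (fun t : R => - t^-1)))
     (- j%:R * flat j.+1 s + flat j.+2 s).
    apply: (is_derive_eq H).
    rewrite /flat s0 /GRing.scale !fctE /= mulr1 -!exprVn.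
    move: (expR (- s^-1)) (s^-1) => e y; case: j {dX H} => [|k] /=.
      by rewrite !mul0r mulr0 addr0 oppr0 mul0r add0r expr0; ring.
    by rewrite !exprS; ring.
  apply: near_eq_is_derive H.
  have : \forall t \near s, 0 < t by apply: lt_nbhsr.
  by apply: filterS => t t0; rewrite /flat t0 !fctE /= exprVn.
- have flat0 k : flat k 0 = 0 by rewrite /flat ltxx.
  rewrite !flat0 mulr0 addr0.
  have f0 : 0 < (j.+2)`!%:R :> R by rewrite ltr0n fact_gt0.
  (* By [flat_le] the difference quotient at 0 is O(|h|). *)
  have cv : h^-1 *: ((flat j \o shift (0 : R)) (h *: (1 : R)) - flat j 0) @[h --> (0 : R)^'] --> (0 : R).
    apply/cvgrPdistC_le => e e0; near=> h.
    rewrite /= flat0 /GRing.scale /= mulr1 addr0 !subr0 normrM normfV.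
    have h0 : 0 < `|h| by rewrite normr_gt0; near: h; exact: nbhs_dnbhs_neq.
    rewrite ler_pdivrMl//; apply: le_trans (flat_le j h) _.
    rewrite -real_normK ?num_real// expr2 mulrCA ler_wpM2l//.
    rewrite -ler_pdivlMl//.
    by near: h; apply: dnbhs0_le; rewrite mulr_gt0 ?invr_gt0.
  by apply: DeriveDef; [apply/cvg_ex; exists 0|exact/cvg_lim].
Unshelve. all: by end_near. Qed.

Lemma continuous_flat j : continuous (flat j).
Proof.
move=> s; apply/differentiable_continuous/derivable1_diffP.
by have [] := is_derive_flat j s.
Qed.

End Flat.

Section ImAdditive.
Context {R : realType}.

Lemma ImD (x y : R[i]) : complex.Im (x + y) = complex.Im x + complex.Im y.
Proof. by case: x y => ? ? []. Qed.

Lemma ImN (x : R[i]) : complex.Im (- x) = - complex.Im x.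
Proof. by case: x. Qed.

Lemma ImMr (z : R[i]) (x : R) : complex.Im (z * x%:C) = complex.Im z * x.
Proof. by case: z => a b; simpc. Qed.

Lemma is_derive_affine (c d t : R) : is_derive t 1 (fun t => c + t * d) d.
Proof. by apply: is_derive_eq; rewrite /GRing.scale /=; ring. Qed.

End ImAdditive.

(** * Functions of class C^k on complex affine space *)

Section ClassC.
Context {R : realType} {n : nat}.
Local Notation K := (@ComplexField R).
Local Notation iota := (fun t : R => (t%:C : K)).
Local Notation class_C := (@class_C R K n iota).
Implicit Types phi psi : affine K n -> R.

Lemma class_C_continuous k phi : class_C k phi -> continuous phi.
Proof. by case: k => [|k] []. Qed.

Lemma class_CW k phi : class_C k.+1 phi -> class_C k phi.
Proof.
elim: k phi => [|k IH] phi [cphi dphi]; split=> // v.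
by have [psi [h /IH]] := dphi v; exists psi.
Qed.

Lemma class_C_cst k (c : R) : class_C k (fun=> c).
Proof.
elim: k c => [|k IH] c; split; try exact: cst_continuous; first by [].
move=> v; exists (fun=> 0); split=> // x; exact: is_derive_cst.
Qed.

Lemma class_CD k phi psi : class_C k phi -> class_C k psi ->
  class_C k (fun x => phi x + psi x).
Proof.
elim: k phi psi => [|k IH] phi psi [c1 d1] [c2 d2].
  by split=> // x; exact: (cvgD (c1 x) (c2 x)).
split; first by move=> x; exact: (cvgD (c1 x) (c2 x)).
move=> v; have [p [h1 cp]] := d1 v; have [q [h2 cq]] := d2 v.
exists (fun x => p x + q x); split; last exact: IH.
by move=> x; exact: (is_deriveD (h1 x) (h2 x)).
Qed.

Lemma class_CM k phi psi : class_C k phi -> class_C k psi ->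
  class_C k (fun x => phi x * psi x).
Proof.
elim: k phi psi => [|k IH] phi psi.
  by move=> [c1 _] [c2 _]; split=> // x; exact: (cvgM (c1 x) (c2 x)).
move=> C1 C2; have w1 := class_CW C1; have w2 := class_CW C2.
case: C1 C2 => [c1 d1] [c2 d2]; split.
  by move=> x; exact: (cvgM (c1 x) (c2 x)).
move=> v; have [p [h1 cp]] := d1 v; have [q [h2 cq]] := d2 v.
exists (fun x => phi x * q x + psi x * p x); split.
  move=> x; have := is_deriveM (h1 x) (h2 x).
  by rewrite /= rmorph0 scale0r addr0.
by apply: class_CD; exact: IH.
Qed.

Lemma class_C_sum k (I : Type) (s : seq I) (phi : I -> affine K n -> R) :
  (forall i, class_C k (phi i)) -> class_C k (fun x => \sum_(i <- s) phi i x).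
Proof.
move=> cp; elim: s => [|i s IH].
  rewrite (_ : (fun x => \sum_(i <- [::]) phi i x) = fun=> 0); first exact: class_C_cst.
  by apply/funext => x; rewrite big_nil.
rewrite (_ : (fun x => \sum_(j <- i :: s) phi j x) = fun x => phi i x + \sum_(j <- s) phi j x); first exact: class_CD.
by apply/funext => x; rewrite big_cons.
Qed.

(** The induction on k treats all j together, since differentiating [flat j] brings in [flat j.+1]
    and [flat j.+2]. *)
Lemma class_C_flat k j phi : (forall k, class_C k phi) -> class_C k (fun x => flat j (phi x)).
Proof.
move=> cphi; have cont m : continuous (fun x => flat m (phi x)).
  move=> x; apply: (@continuous_comp _ _ _ phi (flat m)); last exact: continuous_flat.
  exact: (class_C_continuous (cphi 0%N)).
elim: k j => [|k IH] j; split=> //; move=> v.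
have [_ /(_ v)[p [h cp]]] := cphi k.+1.
exists (fun x => (- j%:R * flat j.+1 (phi x) + flat j.+2 (phi x)) * p x); split.
  move=> x; have := @is_derive1_comp R (flat j) (fun t : R => phi (x + iota t *: v)) 0 _ _ _ (h x).
  by rewrite /= rmorph0 scale0r addr0; apply; exact: is_derive_flat.
apply: class_CM => //; apply: class_CD => //.
by apply: class_CM => //; exact: class_C_cst.
Qed.

Lemma near_Re_Im (x : affine K n) (e : R) : 0 < e ->
  nbhs x [set y : affine K n | forall i, `|complex.Re (y 0 i) - complex.Re (x 0 i)| < e /\
    `|complex.Im (y 0 i) - complex.Im (x 0 i)| < e].
Proof.
move=> e0; apply/(nbhs_cball (good_abs_complex R)).
have [d d0 dE] := cball_polydisc (good_abs_complex R) (n := n) (exprn_gt0 2 e0).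
exists d => // y /dE xy i; have := Re_Im_lt (xy i) (ltW e0).
by rewrite ReD ReN ImD ImN.
Qed.

Lemma class_C_Re k (i : 'I_n) : class_C k (fun x => complex.Re (x 0 i)).
Proof.
have cont : continuous (fun x : affine K n => complex.Re (x 0 i)).
  move=> x; apply: (iffRL (@cvgrPdistC_lt R R _ (nbhs x) _ _ _)) => e e0.
  by apply: filterS (near_Re_Im x e0) => y /(_ i)[].
case: k => [|k]; split=> // v; exists (fun=> complex.Re (v 0 i)); split; last exact: class_C_cst.
move=> x; rewrite (_ : (fun t : R => _) = fun t => complex.Re (x 0 i) + t * complex.Re (v 0 i)).
  exact: is_derive_affine.
apply/funext => t; rewrite !mxE ReD; congr (_ + _).
by rewrite mulrC ReMr mulrC.
Qed.

Lemma class_C_Im k (i : 'I_n) : class_C k (fun x => complex.Im (x 0 i)).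
Proof.
have cont : continuous (fun x : affine K n => complex.Im (x 0 i)).
  move=> x; apply: (iffRL (@cvgrPdistC_lt R R _ (nbhs x) _ _ _)) => e e0.
  by apply: filterS (near_Re_Im x e0) => y /(_ i)[].
case: k => [|k]; split=> // v; exists (fun=> complex.Im (v 0 i)); split; last exact: class_C_cst.
move=> x; rewrite (_ : (fun t : R => _) = fun t => complex.Im (x 0 i) + t * complex.Im (v 0 i)).
  exact: is_derive_affine.
apply/funext => t; rewrite !mxE ImD; congr (_ + _).
by rewrite mulrC ImMr mulrC.
Qed.

End ClassC.

Section Bump.
Context {R : realType} {n : nat}.
Local Notation K := (@ComplexField R).
Implicit Types x y : affine K n.

(** [affine] carries the topology of the modulus, so compactness is transported from a cube in
    R^(2n) along the continuous map h. *)
Lemma box_compact (x0 : affine K n) : compact [set x : affine K n | forall i,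
  `|complex.Re (x 0 i) - complex.Re (x0 0 i)| <= 1 /\
  `|complex.Im (x 0 i) - complex.Im (x0 0 i)| <= 1].
Proof.
pose h (v : 'rV[R]_(n + n)) : affine K n := \row_i ((complex.Re (x0 0 i) + v 0 (lshift n i)) +i*
  (complex.Im (x0 0 i) + v 0 (rshift n i)) : K).
have hRe v i : complex.Re (h v 0 i) = complex.Re (x0 0 i) + v 0 (lshift n i) by rewrite mxE.
have hIm v i : complex.Im (h v 0 i) = complex.Im (x0 0 i) + v 0 (rshift n i) by rewrite mxE.
have hc : continuous h.
  move=> v S [B [oB Bv BS]]; have [e e0 eB] := oB _ Bv.
  set m := Num.min 1 e; have m0 : 0 < m by rewrite lt_min ltr01.
  have [m1 me] : m <= 1 /\ m <= e by rewrite !ge_min !lexx orbT.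
  have d0 : 0 < m / 2 by rewrite divr_gt0.
  exists (fun i j => [set y | `|v i j - y| < m / 2]).
    by move=> i j; exact: (nbhsx_ballx (v i j) _ d0).
  move=> v' /= vv; apply/BS/eB => i; rewrite /= !mxE /=.
  have sq (y z : R) : `|y - z| < m / 2 -> (z - y) ^+ 2 < (m / 2) ^+ 2.
    by move=> yz; rewrite -real_normK ?num_real// distrC ltr_pXn2r ?nnegrE// ltW.
  (* Two squares below (m / 2)^2 add up to less than m^2 / 2 <= m <= e. *)
  have h1 := sq _ _ (vv 0 (lshift n i)); have h2 := sq _ _ (vv 0 (rshift n i)).
  have E (b c d : R) : b + c - (b + d) = c - d by ring.
  rewrite !E; apply: lt_le_trans (ltrD h1 h2) _.
  by apply: le_trans me; nra.
have cB : compact [set v : 'rV[R]_(n + n) | forall i, `[-1, 1]%classic (v ord0 i)].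
  exact: (@rV_compact R (n + n) (fun=> `[-1, 1]%classic) (fun=> @segment_compact R (-1) 1)).
have := continuous_compact (continuous_subspaceT hc) cB.
rewrite (_ : [set h x | x in _] = [set x : affine K n | forall i,
  `|complex.Re (x 0 i) - complex.Re (x0 0 i)| <= 1 /\
  `|complex.Im (x 0 i) - complex.Im (x0 0 i)| <= 1])//.
apply/seteqP; split=> [_ [v vB <-] i|x xB].
  rewrite hRe hIm !(addrAC _ (v _ _)) !subrr !add0r !ler_norml.
  by have := vB (lshift n i); have := vB (rshift n i); rewrite /= !in_itv.
exists (\row_(k < n + n) match fintype.split k with
  | inl i => complex.Re (x 0 i) - complex.Re (x0 0 i)
  | inr i => complex.Im (x 0 i) - complex.Im (x0 0 i) end).
  move=> k; rewrite /= mxE in_itv /=; case: splitP => i _.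
    by have [+ _] := xB i; rewrite ler_norml.
  by have [_] := xB i; rewrite ler_norml.
have E (b c : R) : b + (c - b) = c by rewrite addrC subrK.
apply/rowP => i; apply/eqP; rewrite eq_complex hRe hIm !mxE.
by rewrite (unsplitK (inl i)) (unsplitK (inr i)) !E !eqxx.
Qed.

(** Phi is exp(-1 / rho) where rho = 1 - |x - x0|^2 is positive, and 0 elsewhere. *)
Lemma bump_function (x0 : affine K n) : exists Phi : affine K n -> R[i],
  [/\ test_function setT Phi, positive Phi & Phi x0 != 0].
Proof.
(* Only sums and products occur, in the shape of [class_CD], [class_CM] and [class_C_sum]. *)
pose rho (x : affine K n) : R := 1 + \sum_i -1 *
  ((complex.Re (x 0 i) + - complex.Re (x0 0 i)) * (complex.Re (x 0 i) + - complex.Re (x0 0 i)) +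
   (complex.Im (x 0 i) + - complex.Im (x0 0 i)) * (complex.Im (x 0 i) + - complex.Im (x0 0 i))).
have crho k : class_C (fun t : R => (t%:C : K)) k rho.
  apply: class_CD; first exact: class_C_cst.
  apply: class_C_sum => i; apply: class_CM; first exact: class_C_cst.
  by apply: class_CD; apply: class_CM; apply: class_CD; rewrite ?class_C_Re ?class_C_Im;
    exact: class_C_cst || exact: class_C_Re || exact: class_C_Im.
pose Phi x : R[i] := (flat 0 (rho x))%:C.
have rho0 : rho x0 = 1.
  by rewrite /rho big1 ?addr0// => i _; rewrite !subrr !mulr0 addr0 mulr0.
have Phi0 : Phi x0 != 0.
  rewrite /Phi rho0 /flat ltr01 expr0 invr1 mul1r.
  by rewrite eq_complex /= eqxx andbT gt_eqF// expR_gt0.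
have rho_box x : 0 <= rho x -> forall i,
  `|complex.Re (x 0 i) - complex.Re (x0 0 i)| <= 1 /\
  `|complex.Im (x 0 i) - complex.Im (x0 0 i)| <= 1.
  rewrite /rho -mulr_sumr mulN1r subr_ge0 => h i.
  pose F (i : 'I_n) : R :=
    (complex.Re (x 0 i) - complex.Re (x0 0 i)) * (complex.Re (x 0 i) - complex.Re (x0 0 i)) +
    (complex.Im (x 0 i) - complex.Im (x0 0 i)) * (complex.Im (x 0 i) - complex.Im (x0 0 i)).
  rewrite -/(\sum_i F i) in h.
  have F0 j : 0 <= F j by rewrite /F -!expr2 addr_ge0// sqr_ge0.
  have : F i <= 1.
    by apply: le_trans h; rewrite (bigD1 i)//= lerDl; apply: sumr_ge0 => j _; exact: F0.
  have sq1 (y : R) : y ^+ 2 <= 1 -> `|y| <= 1.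
    by move=> y1; rewrite -(@ler_pXn2r _ 2)// ?nnegrE// real_normK ?num_real// expr1n.
  rewrite /F -!expr2 => h1; split; apply: sq1; apply: le_trans h1.
    by rewrite lerDl sqr_ge0.
  by rewrite lerDr sqr_ge0.
exists Phi; split=> //; last first.
  split; first by exists x0.
  by move=> x; rewrite ler0c flat_ge0.
split=> //.
  move=> k; split; first exact: class_C_flat.
  exact: class_C_cst.
have crho0 : continuous rho by exact: class_C_continuous (crho 0%N).
have cl : closed [set x | 0 <= rho x].
  rewrite (_ : [set x | _] = rho @^-1` [set y | 0 <= y]) //.
  by apply: preimage_closed; [move=> x _; exact: crho0|exact: closed_ge].
have clS : closed (supp Phi) by exact: closed_closure.
apply: (subclosed_compact clS (@box_compact x0)) => x xs; apply: rho_box.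
have /closure_id cE := cl.
suff : closure [set x | 0 <= rho x] x by rewrite -cE.
apply: closureS xs => y /=.
rewrite /Phi /flat leNgt; apply: contra_neqN => ry.
by rewrite ltNge (ltW ry).
Qed.

End Bump.

(** The line runs through two points x1 and x2 where the quotient has different values. At some
    point x0 of it the restrictions of P and Q have different orders; the bump is centred there, and
    the larger order decides the sign of the pole. *)
Lemma polynomial_quotient_pole (R : realType) (n : nat)
    (mu : {measure set (borel (@ComplexField R) n) -> \bar R})
    (P Q : mpoly.mpoly n R[i]) :
  normalized_haar mu ->
  quotient_nonconstant setT (poly_fun P) (poly_fun Q) ->
  (forall Phi, test_function setT Phi ->
     exists Z, zeta_continuation mu setT (poly_fun P) (poly_fun Q) Phi Z) ->
  exists Phi, [/\ test_function setT Phi, positive Phi &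
    exists s : R[i], zeta_pole mu setT (poly_fun P) (poly_fun Q) Phi s].
Proof.
move=> haar nc cont; pose A := good_abs_complex R.
have lP x : setT x -> lip_at A (poly_fun P) x by move=> _; exact: poly_fun_lip.
have lQ x : setT x -> lip_at A (poly_fun Q) x by move=> _; exact: poly_fun_lip.
have [x1 Qx1] : exists x1, poly_fun Q x1 != 0.
  apply: contrapT => nx; apply: nc; exists 0 => x _ Qx.
  by case: nx; exists x.
have [x2 [Qx2 PQ]] : exists x2, poly_fun Q x2 != 0 /\
    poly_fun P x1 / poly_fun Q x1 != poly_fun P x2 / poly_fun Q x2.
  apply: contrapT => nx; apply: nc; exists (poly_fun P x1 / poly_fun Q x1) => x _ Qx.
  apply/eqP; rewrite eq_sym; apply: contrapT => /negP ne.
  by case: nx; exists x.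
pose v : affine (@ComplexField R) n := x2 - x1.
have [p pE] := poly_fun_line P x1 v; have [q qE] := poly_fun_line Q x1 v.
have p0 := pE 0; have p1 := pE 1; have q0 := qE 0; have q1 := qE 1.
have vE : x1 + v = x2 by rewrite addrC subrK.
rewrite !scale0r addr0 in p0 q0; rewrite !scale1r vE in p1 q1.
rewrite p0 q0 p1 q1 in Qx1 Qx2 PQ.
have [z [i [j [p' [q' [ij pE' qE' p'z q'z]]]]]] :=
  @common_factor_orders R[i] p q Qx1 Qx2 PQ.
pose x0 : affine (@ComplexField R) n := x1 + z *: (v : 'rV_n).
have [Phi [tPhi pPhi Phi0]] := bump_function x0.
exists Phi; split=> //; have [Z cZ] := cont Phi tPhi.
have oT : open (setT : set (affine (@ComplexField R) n)) by exact: openT.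
move: ij; rewrite neq_ltn => /orP[ij|ji].
  have cb := polynomial_curve_bounds A ij qE pE qE' pE' q'z p'z.
  by have [s _ ps] := positive_pole haar oT lP lQ tPhi pPhi I Phi0 cZ cb; exists s%:C.
have cb := polynomial_curve_bounds A ji pE qE pE' qE' p'z q'z.
by have [s _ ps] := negative_pole haar oT lP lQ tPhi pPhi I Phi0 cZ cb; exists s%:C.
Qed.

Theorem corollary3p12 (R : realType) :
  (forall (K : local_field R) (n : nat)
     (mu : {measure set (borel K n) -> \bar R})
     (U : set (affine K n)) (f g : affine K n -> K),
   normalized_haar mu ->
   open U ->
   analytic_on U f -> analytic_on U g ->
   nowhere_zero_germ U f -> nowhere_zero_germ U g ->
   quotient_nonconstant U f g ->
   (forall Phi, test_function U Phi ->
      exists Z, zeta_continuation mu U f g Phi Z) ->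
   (forall x0, U x0 -> f x0 = 0 -> g x0 != 0 ->
      exists V : set (affine K n), [/\ open V, V x0 &
        forall Phi, test_function U Phi -> positive Phi ->
          supp Phi `<=` V -> Phi x0 != 0 ->
          exists2 sigma : R, sigma < 0 &
            zeta_pole mu U f g Phi sigma%:C]) /\
   (forall x0, U x0 -> f x0 != 0 -> g x0 = 0 ->
      exists V : set (affine K n), [/\ open V, V x0 &
        forall Phi, test_function U Phi -> positive Phi ->
          supp Phi `<=` V -> Phi x0 != 0 ->
          exists2 sigma : R, 0 < sigma &
            zeta_pole mu U f g Phi sigma%:C])) /\
  (forall (n : nat) (mu : {measure set (borel (@ComplexField R) n) -> \bar R})
     (P Q : mpoly.mpoly n R[i]),
   normalized_haar mu ->
   P != 0 -> Q != 0 ->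
   quotient_nonconstant setT (poly_fun P) (poly_fun Q) ->
   (forall Phi, test_function setT Phi ->
      exists Z, zeta_continuation mu setT (poly_fun P) (poly_fun Q) Phi Z) ->
   exists Phi, [/\ test_function setT Phi, positive Phi &
     exists s : R[i],
       zeta_pole mu setT (poly_fun P) (poly_fun Q) Phi s]).
Proof.
split=> [K n mu U f g haar oU af ag nf ng _ cont|n mu P Q haar _ _]; last first.
  exact: polynomial_quotient_pole.
have [A] := good_abs_inhabited K.
have lf x : U x -> lip_at A f x by move=> /af; exact: analytic_lip.
have lg x : U x -> lip_at A g x by move=> /ag; exact: analytic_lip.
(* The whole space serves as V: Phi is bounded below near x0 because Phi x0 != 0, and nonnegative
   elsewhere. *)
split=> x0 Ux0 fx gx; exists setT; split=> //; try exact: openT;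
  move=> Phi tPhi pPhi _ Phi0; have [Z cZ] := cont Phi tPhi.
  have [v cb] := analytic_curve_bounds A oU Ux0 (af _ Ux0) (ag _ Ux0) nf fx gx.
  exact: (negative_pole haar oU lf lg tPhi pPhi Ux0 Phi0 cZ cb).
have [v cb] := analytic_curve_bounds A oU Ux0 (ag _ Ux0) (af _ Ux0) ng gx fx.
exact: (positive_pole haar oU lf lg tPhi pPhi Ux0 Phi0 cZ cb).
Qed.
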